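(* Let $M$ be a microlinear space and $p,q,r$ natural numbers. If $\omega_1$ is a $[D\to M]$-valued $p$-form on $M$, $\omega_2$ is a $[D\to M]$-valued $q$-form on $M$ and $\omega_3$ is a $[D\to M]$-valued $r$-form on $M$, then the following graded Jacobi identity holds for the Frölicher–Nijenhuis bracket $\lceil\cdot,\cdot\rceil$, as an identity of $[D\to M]$-valued $(p+q+r)$-forms on $M$: $$\lceil \omega_1,\lceil\omega_2,\omega_3\rceil\rceil+(-1)^{p(q+r)}\lceil \omega_2,\lceil\omega_3,\omega_1\rceil\rceil+(-1)^{r(p+q)}\lceil \omega_3,\lceil\omega_1,\omega_2\rceil\rceil=0 .$$
   Context: Setting: synthetic differential geometry, i.e. (intuitionistic) reasoning inside a cartesian closed universe of spaces, as in Lavendhomme's ''Basic Concepts of Synthetic Differential Geometry''. $[X\to Y]$ is the exponential $Y^X$. $\mathbb{R}$ is the line, a commutative ring (with positive integers invertible) satisfying the generalized Kock–Lawvere axiom (for each Weil algebra $W$ the canonical map $W\to[\mathrm{Spec}_{\mathbb R}W\to\mathbb{R}]$ is bijective). $D=\{d\in\mathbb{R}: d^2=0\}$, $D(2)=\{(d_1,d_2)\in D^2: d_1d_2=0\}$. A space $X$ is microlinear if every finite diagram of infinitesimal objects $\mathrm{Spec}_{\mathbb R}W$ with cocone which $[-\to\mathbb{R}]$ turns into a limit diagram is also turned into a limit diagram by $[-\to X]$. If $X$ is microlinear, so is $[Y\to X]$ for every space $Y$. Tangent vectors: a tangent vector to a microlinear $X$ at $x$ is $t:D\to X$ with $t(0)=x$.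 Those at $x$ form an $\mathbb{R}$-module: $(\alpha t)(d)=t(\alpha d)$ and $(t_1+t_2)(d)=l(d,d)$, where $l:D(2)\to X$ is the unique map with $l(d,0)=t_1(d)$, $l(0,d)=t_2(d)$; zero is the constant map. Strong difference: for $\gamma_1,\gamma_2:D^2\to X$ ($X$ microlinear) with $\gamma_1|_{D(2)}=\gamma_2|_{D(2)}$, there is a unique $k:\{(d_1,d_2,e)\in D^3: d_1e=d_2e=0\}\to X$ with $k(d_1,d_2,0)=\gamma_2(d_1,d_2)$ and $k(d_1,d_2,d_1d_2)=\gamma_1(d_1,d_2)$; put $(\gamma_1\overset{\cdot}{-}\gamma_2)(e)=k(0,0,e)$. For $\gamma\in[D^p\to M]$, $\alpha\in\mathbb{R}$, $1\le i\le p$: $(\alpha\underset{i}{\cdot}\gamma)(d_1,\dots,d_p)=\gamma(d_1,\dots,\alpha d_i,\dots,d_p)$. For $\sigma$ in the permutation group $\mathbb{S}_p$ of $\{1,\dots,p\}$, with signature $\varepsilon_\sigma$: $\gamma^\sigma(d_1,\dots,d_p)=\gamma(d_{\sigma(1)},\dots,d_{\sigma(p)})$. For $\varphi\in[[D^p\to M]\to M]$: $(\alpha\underset{i}{\cdot}\varphi)(\gamma)=\varphi(\alpha\underset{i}{\cdot}\gamma)$, $\varphi^\sigma(\gamma)=\varphi(\gamma^\sigma)$. The Dirac distribution is $\delta_{(0,\dots,0)}(\gamma)=\gamma(0,\dots,0)$. A $[D\to M]$-valued $p$-semiform on $M$ is a map $\omega:D\to[[D^p\to M]\to M]$ with $\omega(0)=\delta_{(0,\dots,0)}$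 and $\alpha\underset{i}{\cdot}\omega(d)=\omega(\alpha d)$ for all $d\in D$, $\alpha\in\mathbb{R}$, $1\le i\le p$. It is a $p$-form if moreover $(\omega(d))^\sigma=\omega(\varepsilon_\sigma d)$ for all $d\in D$, $\sigma\in\mathbb{S}_p$. Sums and scalar multiples are those of tangent vectors to $[[D^p\to M]\to M]$ at $\delta_{(0,\dots,0)}$. Put $\omega^\sigma(d)=(\omega(d))^\sigma$. Convolutions: for $f\in[[A\to M]\to M]$, $g\in[[B\to M]\to M]$, define $f\ast g,\ f\,\widetilde{\ast}\,g\in[[A\times B\to M]\to M]$ by $(f\ast g)(h)=f(\lambda a.\,g(\lambda b.\,h(a,b)))$ and $(f\,\widetilde{\ast}\,g)(h)=g(\lambda b.\,f(\lambda a.\,h(a,b)))$. For a $p$-semiform $\omega_1$ and a $q$-semiform $\omega_2$, put $(\omega_1\circledast\omega_2)(d_1,d_2)=\omega_1(d_1)\ast\omega_2(d_2)$ and $(\omega_1\widetilde{\circledast}\omega_2)(d_1,d_2)=\omega_1(d_1)\,\widetilde{\ast}\,\omega_2(d_2)$ (with $D^p\times D^q=D^{p+q}$); these agree on $D(2)$, and $\lfloor\omega_1,\omega_2\rfloor=\omega_1\widetilde{\circledast}\omega_2\overset{\cdot}{-}\omega_1\circledast\omega_2$, which is a $(p+q)$-semiform. For a $(p+q)$-semiform $\omega$, $\mathcal{A}_{p,q}\omega=\frac{1}{p!\,q!}\sum_{\sigma\in\mathbb{S}_{p+q}}\varepsilon_\sigma\omega^\sigma$. The Frölicher–Nijenhuis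 bracket of a $p$-form $\omega_1$ and a $q$-form $\omega_2$ is the $(p+q)$-form $\lceil\omega_1,\omega_2\rceil=\mathcal{A}_{p,q}(\lfloor\omega_1,\omega_2\rfloor)$. *)

(* Defs.v *)
From HB Require Import structures.
From mathcomp Require Import all_boot all_fingroup ssralg boolp.

Set Implicit Arguments.
Unset Strict Implicit.
Unset Printing Implicit Defensive.

Import GRing.Theory.
Local Open Scope ring_scope.

(* Synthetic differential geometry contradicts classical logic when spaces are
   taken to be plain types: with excluded middle, the Kock-Lawvere axiom forces
   the line to be the zero ring.  The universe of spaces is therefore an
   arbitrary cartesian closed category with equalizers, whose internal logic
   carries no classical principle, and the internal language is read through
   generalized elements (Kripke-Joyal): an element of X at stage G is a map
   G -> X, an element x is transported to a later stage r : H -> G as x ∘ r,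
   and "for all d in X" stated at stage G ranges over the elements of X at all
   later stages. *)
Record universe : Type := Universe {
  space :> Type;
  hom : space -> space -> Type;
  idm : forall X, hom X X;
  comp : forall X Y Z, hom Y Z -> hom X Y -> hom X Z;
  comp_idl : forall X Y (f : hom X Y), comp (idm Y) f = f;
  comp_idr : forall X Y (f : hom X Y), comp f (idm X) = f;
  compA : forall X Y Z T (f : hom Z T) (g : hom Y Z) (h : hom X Y),
    comp f (comp g h) = comp (comp f g) h;
  pt : space;
  bang : forall X, hom X pt;
  bang_uniq : forall X (f : hom X pt), f = bang X;
  prodsp : space -> space -> space;
  pi1 : forall X Y, hom (prodsp X Y) X;
  pi2 : forall X Y, hom (prodsp X Y) Y;
  pair_hom : forall G X Y, hom G X -> hom G Y -> hom G (prodsp X Y);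
  pi1_pair : forall G X Y (f : hom G X) (g : hom G Y),
    comp (pi1 X Y) (pair_hom f g) = f;
  pi2_pair : forall G X Y (f : hom G X) (g : hom G Y),
    comp (pi2 X Y) (pair_hom f g) = g;
  pair_uniq : forall G X Y (h : hom G (prodsp X Y)),
    h = pair_hom (comp (pi1 X Y) h) (comp (pi2 X Y) h);
  expsp : space -> space -> space;
  ev : forall X Y, hom (prodsp (expsp X Y) X) Y;
  curry : forall G X Y, hom (prodsp G X) Y -> hom G (expsp X Y);
  ev_curry : forall G X Y (f : hom (prodsp G X) Y),
    comp (ev X Y) (pair_hom (comp (curry f) (pi1 G X)) (pi2 G X)) = f;
  curry_uniq : forall G X Y (g : hom G (expsp X Y)),
    g = curry (comp (ev X Y) (pair_hom (comp g (pi1 G X)) (pi2 G X)));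
  eqz : forall X Y, hom X Y -> hom X Y -> space;
  incl : forall X Y (f g : hom X Y), hom (eqz f g) X;
  eqz_eq : forall X Y (f g : hom X Y), comp f (incl f g) = comp g (incl f g);
  corestr : forall G X Y (f g : hom X Y) (h : hom G X),
    comp f h = comp g h -> hom G (eqz f g);
  incl_corestr : forall G X Y (f g : hom X Y) (h : hom G X)
    (e : comp f h = comp g h), comp (incl f g) (corestr e) = h;
  incl_mono : forall G X Y (f g : hom X Y) (h k : hom G (eqz f g)),
    comp (incl f g) h = comp (incl f g) k -> h = k
}.

Arguments idm {u X}.
Arguments bang {u X}.
Arguments pt {u}.
Arguments pi1 {u X Y}.
Arguments pi2 {u X Y}.
Arguments ev {u X Y}.
Arguments incl {u X Y f g}.

Declare Scope sdg_scope.
Delimit Scope sdg_scope with sdg.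
Notation "f ∘ g" := (comp f g) (at level 40, left associativity) : sdg_scope.
Notation "X ⊗ Y" := (prodsp X Y) (at level 40, left associativity) : sdg_scope.
Notation "X ⇒ Y" := (expsp X Y) (at level 55, right associativity) : sdg_scope.
Notation "⟨ f , g ⟩" := (pair_hom f g) (at level 0) : sdg_scope.
Local Open Scope sdg_scope.

Definition the (T : Type) (dflt : T) (P : T -> Prop) : T :=
  if pselect (exists x, P x) is left ex then sval (cid ex) else dflt.

Section InternalLanguage.
Context {E : universe}.

Definition app (G X Y : E) (f : hom G (X ⇒ Y)) (x : hom G X) : hom G Y :=
  ev ∘ ⟨f, x⟩.

(* The term λ x. b(x): the body receives the weakening r, to be applied to
   everything coming from stage G, and the bound variable x. *)
Definition lam (G X Y : E)
    (b : hom (G ⊗ X) G -> hom (G ⊗ X) X -> hom (G ⊗ X) Y) : hom G (X ⇒ Y) :=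
  curry (b pi1 pi2).

Definition is_iso (X Y : E) (f : hom X Y) : Prop :=
  exists g : hom Y X, g ∘ f = idm /\ f ∘ g = idm.

Fixpoint pow (X : E) (n : nat) : E :=
  if n is m.+1 then X ⊗ pow X m else pt.

Fixpoint proj (X : E) (n : nat) : 'I_n -> hom (pow X n) X :=
  match n with
  | 0 => fun i => False_rect _ (notF (ltn_ord i))
  | m.+1 => fun i =>
      if unlift ord0 i is Some j then proj X j ∘ pi2 else pi1
  end.

Fixpoint tup (G X : E) (n : nat) : ('I_n -> hom G X) -> hom G (pow X n) :=
  match n with
  | 0 => fun=> bang
  | m.+1 => fun x => ⟨x ord0, tup (fun j => x (lift ord0 j))⟩
  end.

Definition coord (G X : E) (n : nat) (x : hom G (pow X n)) (i : 'I_n) :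
  hom G X := proj X i ∘ x.

Lemma pair_comp (G H X Y : E) (f : hom G X) (g : hom G Y) (r : hom H G) :
  ⟨f, g⟩ ∘ r = ⟨f ∘ r, g ∘ r⟩.
Proof. by rewrite [LHS]pair_uniq !compA pi1_pair pi2_pair. Qed.

Lemma coord_tup (G X : E) n (x : 'I_n -> hom G X) i : coord (tup x) i = x i.
Proof.
rewrite /coord; elim: n x i => [|n IH] x i /=; first by case: i.
case: unliftP => [j|] ->; last by rewrite pi1_pair.
by rewrite -compA pi2_pair IH.
Qed.

Lemma tup_coord (G X : E) n (x : hom G (pow X n)) : tup (coord x) = x.
Proof.
rewrite /coord; elim: n x => [|n IH] x /=; first by rewrite [x]bang_uniq.
rewrite unlift_none [RHS]pair_uniq; congr pair_hom.
rewrite -[RHS]IH; congr tup; apply/funext => j.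
by rewrite liftK compA.
Qed.

Lemma app_lam (G X Y : E)
    (b : hom (G ⊗ X) G -> hom (G ⊗ X) X -> hom (G ⊗ X) Y) (x : hom G X) :
  app (lam b) x = b pi1 pi2 ∘ ⟨idm, x⟩.
Proof.
rewrite /app /lam -[in RHS](ev_curry (b pi1 pi2)) -compA; congr comp.
by rewrite pair_comp -compA pi1_pair pi2_pair comp_idr.
Qed.

(* D^p x D^q = D^(p+q) *)
Definition pcat (G X : E) (p q : nat) (a : hom G (pow X p))
    (b : hom G (pow X q)) : hom G (pow X (p + q)) :=
  tup (fun i => match split i with
                | inl j => coord a j
                | inr k => coord b k
                end).

End InternalLanguage.

Record ring_object (E : universe) : Type := RingObject {
  carrier :> space E;
  rzero : hom pt carrier;
  rone : hom pt carrier;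
  radd : hom (carrier ⊗ carrier) carrier;
  rmul : hom (carrier ⊗ carrier) carrier;
  ropp : hom carrier carrier;
  raddA : forall (G : E) (x y z : hom G carrier),
    radd ∘ ⟨x, radd ∘ ⟨y, z⟩⟩ = radd ∘ ⟨radd ∘ ⟨x, y⟩, z⟩;
  raddC : forall (G : E) (x y : hom G carrier), radd ∘ ⟨x, y⟩ = radd ∘ ⟨y, x⟩;
  radd0 : forall (G : E) (x : hom G carrier), radd ∘ ⟨rzero ∘ bang, x⟩ = x;
  raddN : forall (G : E) (x : hom G carrier),
    radd ∘ ⟨ropp ∘ x, x⟩ = rzero ∘ bang;
  rmulA : forall (G : E) (x y z : hom G carrier),
    rmul ∘ ⟨x, rmul ∘ ⟨y, z⟩⟩ = rmul ∘ ⟨rmul ∘ ⟨x, y⟩, z⟩;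
  rmulC : forall (G : E) (x y : hom G carrier), rmul ∘ ⟨x, y⟩ = rmul ∘ ⟨y, x⟩;
  rmul1 : forall (G : E) (x : hom G carrier), rmul ∘ ⟨rone ∘ bang, x⟩ = x;
  rmulD : forall (G : E) (x y z : hom G carrier),
    rmul ∘ ⟨radd ∘ ⟨x, y⟩, z⟩ = radd ∘ ⟨rmul ∘ ⟨x, z⟩, rmul ∘ ⟨y, z⟩⟩
}.

HB.instance Definition _ (E : universe) (A : ring_object E) (G : E) :=
  gen_eqMixin (hom G A).
HB.instance Definition _ (E : universe) (A : ring_object E) (G : E) :=
  gen_choiceMixin (hom G A).
HB.instance Definition _ (E : universe) (A : ring_object E) (G : E) :=
  GRing.isZmodule.Build (hom G A) (@raddA E A G) (@raddC E A G)
    (@radd0 E A G) (@raddN E A G).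
HB.instance Definition _ (E : universe) (A : ring_object E) (G : E) :=
  GRing.Zmodule_isComPzRing.Build (hom G A) (@rmulA E A G) (@rmulC E A G)
    (@rmul1 E A G) (@rmulD E A G).

Section Restriction.
Context {E : universe} {A : ring_object E}.
Implicit Types G H : E.

Lemma comp_0 G H (r : hom H G) : (0 : hom G A) ∘ r = 0.
Proof. by rewrite -[LHS]compA; congr comp; apply: bang_uniq. Qed.

Lemma comp_M G H (x y : hom G A) (r : hom H G) :
  (x * y) ∘ r = (x ∘ r) * (y ∘ r).
Proof. by rewrite -[LHS]compA pair_comp. Qed.

Lemma comp_D G H (x y : hom G A) (r : hom H G) :
  (x + y) ∘ r = (x ∘ r) + (y ∘ r).
Proof. by rewrite -[LHS]compA pair_comp. Qed.

End Restriction.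

(* Weil algebras in the sense of Lavendhomme: an algebra structure on the
   module A^(n+1), given by structure constants in A, with unit (1,0,...,0)
   and such that {x | x_0 = 0} is a nilpotent ideal.  The elements of W at
   stage G are its coordinate families. *)
Definition wmul (E : universe) (A : ring_object E) (n : nat)
    (c : 'I_n.+1 -> 'I_n.+1 -> 'I_n.+1 -> hom pt A) (G : E)
    (u v : 'I_n.+1 -> hom G A) : 'I_n.+1 -> hom G A :=
  fun k => \sum_i \sum_j (c i j k ∘ bang) * u i * v j.

Definition wone (E : universe) (A : ring_object E) (n : nat) (G : E) :
    'I_n.+1 -> hom G A :=
  fun k => (k == ord0)%:R.
Arguments wone {E} A n G.

Record weil (E : universe) (A : ring_object E) : Type := Weil {
  wdim : nat;
  wc : 'I_wdim.+1 -> 'I_wdim.+1 -> 'I_wdim.+1 -> hom pt A;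
  wmulC : forall G : E, commutative (wmul wc (G := G));
  wmulA : forall G : E, associative (wmul wc (G := G));
  wmul1 : forall G : E, left_id (wone A wdim G) (wmul wc (G := G));
  wideal : forall (G : E) (u v : 'I_wdim.+1 -> hom G A),
    u ord0 = 0 -> wmul wc u v ord0 = 0;
  wnilp : exists N : nat, forall (G : E) (u : 'I_N -> 'I_wdim.+1 -> hom G A),
    (forall i, u i ord0 = 0) ->
    forall k, (\big[wmul wc (G := G)/wone A wdim G]_(i < N) u i) k = 0
}.

(* Spec W is the space of algebra maps W -> A, such a map being identified with
   the tuple x of its values on the canonical basis. *)
Definition Spec (E : universe) (A : ring_object E) (W : weil A) : E :=
  let n := (wdim W).+1 in
  let x (i : 'I_n) : hom (pow A n) A := proj A i in
  eqz ⟨x ord0, tup (fun i : 'I_n => tup (fun j : 'I_n => x i * x j))⟩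
      ⟨(1 : hom (pow A n) A),
       tup (fun i : 'I_n => tup (fun j : 'I_n =>
         \sum_(k < n) (wc i j k ∘ bang) * x k))⟩.

(* The canonical map W -> [Spec W -> A], w |-> (x |-> x(w)). *)
Definition weil_eval (E : universe) (A : ring_object E) (W : weil A) :
    hom (pow A (wdim W).+1) (Spec W ⇒ A) :=
  lam (fun w x => \sum_(k < (wdim W).+1) coord w k * coord (incl ∘ x) k).

Record line (E : universe) : Type := Line {
  line_ring :> ring_object E;
  invn : nat -> hom pt line_ring;
  invnP : forall n, (0 < n)%N -> n%:R * invn n = 1;
  kock_lawvere : forall W : weil line_ring, is_iso (weil_eval W)
}.

Section Microlinearity.
Context {E : universe}.

Definition precomp (G X Y Z : E) (f : hom X Y) (t : hom G (Y ⇒ Z)) :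
  hom G (X ⇒ Z) := lam (fun r x => app (t ∘ r) (f ∘ x)).

(* A diagram is indexed by a finite graph: vertices I, arrows J. *)
Record weil_cocone (A : ring_object E) : Type := WeilCocone {
  vertex : finType;
  arrow : finType;
  src : arrow -> vertex;
  tgt : arrow -> vertex;
  dobj : vertex -> weil A;
  dmap : forall j, hom (Spec (dobj (src j))) (Spec (dobj (tgt j)));
  apex : weil A;
  leg : forall i, hom (Spec (dobj i)) (Spec apex);
  leg_comm : forall j, leg (tgt j) ∘ dmap j = leg (src j)
}.

Definition limit_after_exp (A : ring_object E) (C : weil_cocone A) (X : E) :
    Prop :=
  forall (G : E) (t : forall i : vertex C, hom G (Spec (dobj i) ⇒ X)),
    (forall j : arrow C, precomp (dmap j) (t (tgt j)) = t (src j)) ->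
    exists! u : hom G (Spec (apex C) ⇒ X),
      forall i : vertex C, precomp (leg i) u = t i.

Definition microlinear (A : ring_object E) (X : E) : Prop :=
  forall C : weil_cocone A, limit_after_exp C A -> limit_after_exp C X.

End Microlinearity.

Section InfinitesimalObjects.
Context {E : universe} (A : ring_object E).
Implicit Types G : E.

Definition D : E := eqz (idm * idm : hom A A) 0.
Definition dval G (d : hom G D) : hom G A := incl ∘ d.

Lemma mkD_subproof G (x : hom G A) :
  x * x = 0 -> (idm * idm : hom A A) ∘ x = 0 ∘ x.
Proof. by rewrite comp_M comp_0 comp_idl. Qed.
Definition mkD G (x : hom G A) (e : x * x = 0) : hom G D :=
  corestr (mkD_subproof e).

Lemma dval_sq G (d : hom G D) : dval d * dval d = 0.
Proof.
by rewrite /dval -[LHS](comp_M _ _ d) -(comp_0 d) -{1 2}[incl]comp_idl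
  -comp_M eqz_eq comp_0.
Qed.

Lemma dval_scale_sq G (x : hom G A) (d : hom G D) :
  (x * dval d) * (x * dval d) = 0.
Proof. by rewrite mulrACA dval_sq mulr0. Qed.

Definition dzero G : hom G D := mkD (mulr0 (0 : hom G A)).
Definition dscale G (x : hom G A) (d : hom G D) : hom G D :=
  mkD (dval_scale_sq x d).

Definition D2 : E :=
  eqz (dval pi1 * dval pi2 : hom (D ⊗ D) A) 0.

Lemma mkD2_subproof G (d1 d2 : hom G D) : dval d1 * dval d2 = 0 ->
  (dval pi1 * dval pi2 : hom (D ⊗ D) A) ∘ ⟨d1, d2⟩ = 0 ∘ ⟨d1, d2⟩.
Proof. by rewrite comp_M comp_0 /dval -!compA pi1_pair pi2_pair. Qed.
Definition mkD2 G (d1 d2 : hom G D) (e : dval d1 * dval d2 = 0) : hom G D2 :=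
  corestr (mkD2_subproof e).

Lemma dval0 G : dval (dzero G) = 0.
Proof. exact: incl_corestr. Qed.

Lemma dval_d0 G (d : hom G D) : dval d * dval (dzero G) = 0.
Proof. by rewrite dval0 mulr0. Qed.
Lemma dval_0d G (d : hom G D) : dval (dzero G) * dval d = 0.
Proof. by rewrite dval0 mul0r. Qed.

(* K = {(d1, d2, e) in D^3 | d1 e = d2 e = 0} *)
Definition K : E :=
  let d1 : hom (D ⊗ D ⊗ D) D := pi1 ∘ pi1 in
  let d2 : hom (D ⊗ D ⊗ D) D := pi2 ∘ pi1 in
  let e : hom (D ⊗ D ⊗ D) D := pi2 in
  eqz ⟨dval d1 * dval e, dval d2 * dval e⟩ ⟨(0 : hom _ A), (0 : hom _ A)⟩.

Lemma mkK_subproof G (d1 d2 e : hom G D) :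
  dval d1 * dval e = 0 -> dval d2 * dval e = 0 ->
  let x1 : hom (D ⊗ D ⊗ D) D := pi1 ∘ pi1 in
  let x2 : hom (D ⊗ D ⊗ D) D := pi2 ∘ pi1 in
  let x3 : hom (D ⊗ D ⊗ D) D := pi2 in
  ⟨dval x1 * dval x3, dval x2 * dval x3⟩ ∘ ⟨⟨d1, d2⟩, e⟩ =
  ⟨(0 : hom _ A), (0 : hom _ A)⟩ ∘ ⟨⟨d1, d2⟩, e⟩.
Proof.
move=> h1 h2 /=; rewrite !pair_comp !comp_M !comp_0 /dval.
rewrite -[X in ⟨X * _, _⟩]compA -[X in ⟨_ * X, _⟩]compA.
rewrite -[X in ⟨_, X * _⟩]compA -[X in ⟨_, _ * X⟩]compA.
by rewrite -!compA !(pi1_pair, pi2_pair) h1 h2.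
Qed.
Definition mkK G (d1 d2 e : hom G D) (h1 : dval d1 * dval e = 0)
  (h2 : dval d2 * dval e = 0) : hom G K := corestr (mkK_subproof h1 h2).

Definition dmul G (d1 d2 : hom G D) : hom G D := dscale (dval d1) d2.

Lemma dval_mul G (d1 d2 : hom G D) : dval (dmul d1 d2) = dval d1 * dval d2.
Proof. exact: incl_corestr. Qed.
Lemma dmul_l G (d1 d2 : hom G D) : dval d1 * dval (dmul d1 d2) = 0.
Proof. by rewrite dval_mul mulrA dval_sq mul0r. Qed.
Lemma dmul_r G (d1 d2 : hom G D) : dval d2 * dval (dmul d1 d2) = 0.
Proof. by rewrite dval_mul mulrCA dval_sq mulr0. Qed.

Definition K_base G (d1 d2 : hom G D) : hom G K :=
  mkK (dval_d0 d1) (dval_d0 d2).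
Definition K_graph G (d1 d2 : hom G D) : hom G K :=
  mkK (dmul_l d1 d2) (dmul_r d1 d2).
Definition K_axis G (e : hom G D) : hom G K := mkK (dval_0d e) (dval_0d e).

End InfinitesimalObjects.

Arguments dzero {E A G}.

Section TangentVectors.
Context {E : universe} {A : ring_object E}.
Implicit Types G H X : E.

Definition tzero G X (x : hom G X) : hom G (D A ⇒ X) := lam (fun r _ => x ∘ r).

Definition tscale G X (a : hom G A) (t : hom G (D A ⇒ X)) : hom G (D A ⇒ X) :=
  lam (fun r d => app (t ∘ r) (dscale (a ∘ r) d)).

(* The default value is irrelevant: l exists and is unique when X is
   microlinear and t1, t2 have the same base point. *)
Definition tadd_ext G X (t1 t2 : hom G (D A ⇒ X)) : hom G (D2 A ⇒ X) :=
  the (lam (fun r z => app (t1 ∘ r) (pi1 ∘ (incl ∘ z))))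
    (fun l => forall H (r : hom H G) (d : hom H (D A)),
       app (l ∘ r) (mkD2 (dval_d0 d)) = app (t1 ∘ r) d /\
       app (l ∘ r) (mkD2 (dval_0d d)) = app (t2 ∘ r) d).

Definition tadd G X (t1 t2 : hom G (D A ⇒ X)) : hom G (D A ⇒ X) :=
  lam (fun r d => app (tadd_ext t1 t2 ∘ r) (mkD2 (dval_sq d))).

(* The default value is irrelevant: k exists and is unique when X is
   microlinear and g1, g2 agree on D(2). *)
Definition sdiff_ext G X (g1 g2 : hom G (D A ⊗ D A ⇒ X)) : hom G (K A ⇒ X) :=
  the (lam (fun r z => app (g2 ∘ r) (pi1 ∘ (incl ∘ z))))
    (fun k => forall H (r : hom H G) (d1 d2 : hom H (D A)),
       app (k ∘ r) (K_base d1 d2) = app (g2 ∘ r) ⟨d1, d2⟩ /\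
       app (k ∘ r) (K_graph d1 d2) = app (g1 ∘ r) ⟨d1, d2⟩).

Definition sdiff G X (g1 g2 : hom G (D A ⊗ D A ⇒ X)) : hom G (D A ⇒ X) :=
  lam (fun r e => app (sdiff_ext g1 g2 ∘ r) (K_axis e)).

End TangentVectors.

Section Forms.
Context {E : universe} (A : line E) (M : E).
Implicit Types G H : E.

Definition cube (p : nat) : E := pow (D A) p ⇒ M.
Definition dist (p : nat) : E := cube p ⇒ M.
Definition tfield (p : nat) : E := D A ⇒ dist p.

Definition cube_scale p G (i : 'I_p) (a : hom G A) (g : hom G (cube p)) :
    hom G (cube p) :=
  lam (fun r d => app (g ∘ r)
    (tup (fun j => if j == i then dscale (a ∘ r) (coord d j) else coord d j))).

Definition cube_perm p G (s : 'S_p) (g : hom G (cube p)) : hom G (cube p) :=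
  lam (fun r d => app (g ∘ r) (tup (fun i => coord d (s i)))).

Definition dist_scale p G (i : 'I_p) (a : hom G A) (f : hom G (dist p)) :
    hom G (dist p) :=
  lam (fun r g => app (f ∘ r) (cube_scale i (a ∘ r) g)).

Definition dist_perm p G (s : 'S_p) (f : hom G (dist p)) : hom G (dist p) :=
  lam (fun r g => app (f ∘ r) (cube_perm s g)).

Definition dirac p G : hom G (dist p) :=
  lam (fun r g => app g (tup (fun=> dzero))).

Definition semiform p G (w : hom G (tfield p)) : Prop :=
  app w dzero = dirac p G /\
  forall H (r : hom H G) (d : hom H (D A)) (a : hom H A) (i : 'I_p),
    dist_scale i a (app (w ∘ r) d) = app (w ∘ r) (dscale a d).

Definition form p G (w : hom G (tfield p)) : Prop :=
  semiform w /\
  forall H (r : hom H G) (d : hom H (D A)) (s : 'S_p),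
    dist_perm s (app (w ∘ r) d) = app (w ∘ r) (dscale ((-1) ^+ s) d).

Definition field_perm p G (s : 'S_p) (w : hom G (tfield p)) : hom G (tfield p) :=
  lam (fun r d => dist_perm s (app (w ∘ r) d)).

Definition conv p q G (f : hom G (dist p)) (g : hom G (dist q)) :
    hom G (dist (p + q)) :=
  lam (fun r h => app (f ∘ r) (lam (fun r' a =>
    app (g ∘ r ∘ r') (lam (fun r'' b =>
      app (h ∘ r' ∘ r'') (pcat (a ∘ r'') b)))))).

Definition conv_tilde p q G (f : hom G (dist p)) (g : hom G (dist q)) :
    hom G (dist (p + q)) :=
  lam (fun r h => app (g ∘ r) (lam (fun r' b =>
    app (f ∘ r ∘ r') (lam (fun r'' a =>
      app (h ∘ r' ∘ r'') (pcat a (b ∘ r''))))))).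

Definition cconv p q G (w1 : hom G (tfield p)) (w2 : hom G (tfield q)) :
    hom G (D A ⊗ D A ⇒ dist (p + q)) :=
  lam (fun r d => conv (app (w1 ∘ r) (pi1 ∘ d)) (app (w2 ∘ r) (pi2 ∘ d))).

Definition cconv_tilde p q G (w1 : hom G (tfield p)) (w2 : hom G (tfield q)) :
    hom G (D A ⊗ D A ⇒ dist (p + q)) :=
  lam (fun r d =>
    conv_tilde (app (w1 ∘ r) (pi1 ∘ d)) (app (w2 ∘ r) (pi2 ∘ d))).

Definition lie p q G (w1 : hom G (tfield p)) (w2 : hom G (tfield q)) :
    hom G (tfield (p + q)) :=
  sdiff (cconv_tilde w1 w2) (cconv w1 w2).

Definition alt p q G (w : hom G (tfield (p + q))) : hom G (tfield (p + q)) :=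
  tscale (invn A (p`! * q`!) ∘ bang)
    (\big[@tadd E A G (dist (p + q))/tzero (dirac (p + q) G)]_(s : 'S_(p + q))
       tscale ((-1) ^+ s) (field_perm s w)).

Definition fn_bracket p q G (w1 : hom G (tfield p)) (w2 : hom G (tfield q)) :
    hom G (tfield (p + q)) :=
  alt (lie w1 w2).

End Forms.

Arguments fn_bracket {E A M p q G}.
Arguments dirac {E A M}.

Lemma addn_cycle1 p q r : (q + (r + p) = p + q + r)%N.
Proof. by rewrite addnA addnC addnA. Qed.

Lemma addn_cycle2 p q r : (r + (p + q) = p + q + r)%N.
Proof. exact: addnC. Qed.

(* D^m = D^n for m = n, coordinates keeping their positions. *)
Definition field_cast (E : universe) (A : line E) (M G : E) (m n : nat)
    (e : m = n) (w : hom G (tfield A M m)) : hom G (tfield A M n) :=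
  ecast k (hom G (tfield A M k)) e w.

(* Main.v *)
From HB Require Import structures.
From Pilot Require Import Defs.
From mathcomp Require Import all_boot all_fingroup ssralg boolp ring.
Import Pilot.Defs.

Set Implicit Arguments.
Unset Strict Implicit.
Unset Printing Implicit Defensive.

Import GRing.Theory.
Local Open Scope ring_scope.
Local Open Scope sdg_scope.

(* At the level of the products circledast, the bracket of w1 and w2 is the
   commutator w2 w1 - w1 w2 of two noncommuting operations, and the Jacobi
   identity is the cancellation of the six orders of w1, w2, w3.  The six maps
   D^3 -> X so obtained have no common base on which they could be subtracted,
   so they are all read off one map m on a larger infinitesimal object: with
   base the order 123, it has one direction e_i for each inner bracket
   (depending on d_i) and one direction g_i for each double bracket.  Walking
   around the hexagon of adjacent orders expresses each order as m composed
   with a polynomial map, and the two ways of reaching 321 differ exactly by the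
   sum of the three double brackets.

   Existence and uniqueness of m, sums of tangent vectors, and strong
   differences all come from microlinearity applied to spaces of simplicial
   complexes, {d in D^n | the product of the d_i over a non-face vanishes},
   whose functions are by Kock-Lawvere the square-free polynomials supported on
   the faces.

   The bracket is homogeneous, hence additive, in its second argument, so the
   inner alternation is absorbed by the outer one; the signs of the identity
   are those of the block rotations of the coordinates. *)

(** The walk rests on one property of [K]: a map out of it is determined by its values on any two of
    three parts, the base [e = 0], the graph [e = d1 d2] and the axis [d1 = d2 = 0]. Base and graph
    carry the two maps whose strong difference is read on the axis. An edge of the hexagon, with the
    third form as a parameter, is known on one part from a vertex already reached and on the axis
    from an inner or a double bracket; so its polynomial is forced, and its remaining part gives the
    next vertex. For the order 321 the two results agree in all [d_i] and [e_i], while their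
    [g]-coordinates, (x, 0, x) and (0, -x, 0) with x = d1 d2 d3, differ by (x, x, x). Since x cannot
    be divided out, it is removed by uniqueness on [K]: an equation in which a product is replaced
    by the third coordinate holds on the base and on the graph, hence on the axis, where that
    coordinate is free. *)

Section CartesianClosed.
Context {E : universe}.
Implicit Types G H K X Y Z : E.

Lemma pair_ext G X Y (f g : hom G (X ⊗ Y)) :
  pi1 ∘ f = pi1 ∘ g -> pi2 ∘ f = pi2 ∘ g -> f = g.
Proof. by move=> e1 e2; rewrite [f]pair_uniq e1 e2 -pair_uniq. Qed.

Lemma pi1_pair_comp G H X Y (f : hom G X) (g : hom G Y) (r : hom H G) :
  pi1 ∘ (⟨f, g⟩ ∘ r) = f ∘ r.
Proof. by rewrite compA pi1_pair. Qed.

Lemma pi2_pair_comp G H X Y (f : hom G X) (g : hom G Y) (r : hom H G) :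
  pi2 ∘ (⟨f, g⟩ ∘ r) = g ∘ r.
Proof. by rewrite compA pi2_pair. Qed.

Lemma app_comp G H X Y (f : hom G (X ⇒ Y)) (x : hom G X) (r : hom H G) :
  app f x ∘ r = app (f ∘ r) (x ∘ r).
Proof. by rewrite /app -compA pair_comp. Qed.

Lemma exp_ext G X Y (f g : hom G (X ⇒ Y)) :
  (forall H (r : hom H G) x, app (f ∘ r) x = app (g ∘ r) x) -> f = g.
Proof. by move=> e; rewrite [f]curry_uniq [g]curry_uniq; congr curry; apply: e. Qed.

Lemma app_lam_comp G H X Y
    (b : hom (G ⊗ X) G -> hom (G ⊗ X) X -> hom (G ⊗ X) Y)
    (r : hom H G) (x : hom H X) :
  app (lam b ∘ r) x = b pi1 pi2 ∘ ⟨r, x⟩.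
Proof.
rewrite /app /lam -[in RHS](ev_curry (b pi1 pi2)) -compA; congr comp.
by rewrite pair_comp -compA pi1_pair pi2_pair.
Qed.

(* A map G ⊗ X -> Y, seen as a function of the generalized elements. *)
Definition natural G X Y (F : forall H, hom H G -> hom H X -> hom H Y) :=
  forall H K (r : hom H G) (x : hom H X) (s : hom K H),
    F H r x ∘ s = F K (r ∘ s) (x ∘ s).

Definition lamN G X Y (F : forall H, hom H G -> hom H X -> hom H Y) :
  hom G (X ⇒ Y) := lam (F (G ⊗ X)).

(** Yoneda: naturality carries the value at the universal element [(pi1, pi2)] of stage [G ⊗ X] to
    every [(r, x)]. *)
Lemma app_lamN G X Y (F : forall H, hom H G -> hom H X -> hom H Y) :
  natural F -> forall H (r : hom H G) x, app (lamN F ∘ r) x = F H r x.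
Proof. by move=> nF H r x; rewrite app_lam_comp nF pi1_pair pi2_pair. Qed.

Lemma natural_app G X Y (f : hom G (X ⇒ Y)) :
  natural (fun H (r : hom H G) x => app (f ∘ r) x).
Proof. by move=> H K r x s; rewrite app_comp compA. Qed.

Lemma precompE G H X Y Z (f : hom X Y) (t : hom G (Y ⇒ Z)) (r : hom H G) x :
  app (precomp f t ∘ r) x = app (t ∘ r) (f ∘ x).
Proof. by rewrite app_lam_comp app_comp -!compA pi1_pair pi2_pair. Qed.

Lemma tup_comp G H X n (x : 'I_n -> hom G X) (r : hom H G) :
  tup x ∘ r = tup (fun i => x i ∘ r).
Proof.
elim: n x => [|n IH] x /=; first exact: bang_uniq.
by rewrite pair_comp IH.
Qed.

Lemma eq_tup G X n (x y : 'I_n -> hom G X) : x =1 y -> tup x = tup y.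
Proof. by move=> /funext->. Qed.

Lemma coord_comp G H X n (x : hom G (pow X n)) (r : hom H G) i :
  coord (x ∘ r) i = coord x i ∘ r.
Proof. exact: compA. Qed.

Lemma coord_tup_comp G H X n (x : 'I_n -> hom G X) (r : hom H G) i :
  coord (tup x ∘ r) i = x i ∘ r.
Proof. by rewrite coord_comp coord_tup. Qed.

Lemma coord_ext G X n (x y : hom G (pow X n)) : coord x =1 coord y -> x = y.
Proof. by move=> /funext e; rewrite -[x]tup_coord e tup_coord. Qed.

Lemma exp_swap G X Y Z (t : hom (G ⊗ Y) (X ⇒ Z)) :
  exists u : hom G (X ⇒ (Y ⇒ Z)), forall H (r : hom H G) x y,
    app (app (u ∘ r) x) y = app (t ∘ ⟨r, y⟩) x.
Proof.
pose F H (r : hom H (G ⊗ X)) (y : hom H Y) := app (t ∘ ⟨pi1 ∘ r, y⟩) (pi2 ∘ r).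
have nF : natural F by move=> H K r y s; rewrite /F app_comp -!compA pair_comp -!compA.
exists (lam (fun r x => lamN F ∘ ⟨r, x⟩)) => H r x y.
by rewrite app_lam_comp -compA pair_comp pi1_pair pi2_pair app_lamN // /F
  pi1_pair pi2_pair.
Qed.

End CartesianClosed.

Section MicrolinearExp.
Context {E : universe} (A : ring_object E).

(** A cone with values in [Y ⇒ X] at stage [G] is a cone with values in [X] at stage [G ⊗ Y], and
    the limit property is required at every stage; [exp_swap] brings the solution back. *)
Lemma microlinear_exp (X Y : E) : microlinear A X -> microlinear A (Y ⇒ X).
Proof.
move=> mX C /mX {mX} mX G t ct.
have nt i : natural (fun H (r : hom H (G ⊗ Y)) x =>
    app (app (t i ∘ (pi1 ∘ r)) x) (pi2 ∘ r)).
  by move=> H K r x s; rewrite !app_comp -!compA.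
have [j|u [uP uU]] := mX (G ⊗ Y)
    (fun i => lamN (fun H r x => app (app (t i ∘ (pi1 ∘ r)) x) (pi2 ∘ r))).
  by apply: exp_ext => H r x; rewrite precompE !app_lamN // -ct precompE.
have [v vP] := exp_swap u.
exists v; split=> [i|v' v'P].
  apply: exp_ext => H r x; apply: exp_ext => K s y.
  rewrite precompE !app_comp -!compA vP.
  have := congr1 (fun f => app (f ∘ ⟨r ∘ s, y⟩) (x ∘ s)) (uP i).
  by rewrite precompE app_lamN // pi1_pair pi2_pair => <-; rewrite compA.
have nv : natural (fun H (r : hom H (G ⊗ Y)) x =>
    app (app (v' ∘ (pi1 ∘ r)) x) (pi2 ∘ r)).
  by move=> H K r x s; rewrite !app_comp -!compA.
apply: exp_ext => H r x; apply: exp_ext => K s y.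
rewrite !app_comp -!compA vP.
rewrite (uU (lamN (fun H r x => app (app (v' ∘ (pi1 ∘ r)) x) (pi2 ∘ r)))).
  by rewrite app_lamN // pi1_pair pi2_pair.
move=> i; apply: exp_ext => L q z.
by rewrite precompE !app_lamN // -v'P precompE.
Qed.

End MicrolinearExp.

(** * Weil algebras of simplicial complexes *)

(** A singleton need not be a face: such a generator is zero, so that complexes with different
    supports can share the vertex type [T]. The empty face is required because it indexes the
    unit. *)
Record complex (T : finType) := Complex {
  faces : {set {set T}};
  faces0 : set0 \in faces;
  facesS : forall S S' : {set T}, S \in faces -> S' \subset S -> S' \in faces
}.

Arguments faces {T} _ : simpl never.

Section Enumeration.
Context {T : finType} (C : complex T).

(** The empty face comes first because the unit of a Weil algebra must be the basis vector
    [ord0]. *)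
Definition face_seq : seq {set T} := set0 :: enum (faces C :\ set0).

Lemma size_face_seq : size face_seq = #|faces C :\ set0|.+1.
Proof. by rewrite /= -cardE. Qed.

Lemma mem_face_seq S : (S \in face_seq) = (S \in faces C).
Proof.
rewrite inE mem_enum !inE; case: eqP => [->|_] //=.
by rewrite faces0.
Qed.

Lemma uniq_face_seq : uniq face_seq.
Proof. by rewrite /= mem_enum !inE eqxx enum_uniq. Qed.

Definition face (i : 'I_#|faces C :\ set0|.+1) : {set T} := nth set0 face_seq i.
Definition face_idx (S : {set T}) : 'I_#|faces C :\ set0|.+1 :=
  inord (index S face_seq).

Lemma face_in i : face i \in faces C.
Proof. by rewrite -mem_face_seq mem_nth // size_face_seq. Qed.

Lemma faceK : cancel face face_idx.
Proof.
move=> i; rewrite /face_idx /face index_uniq ?uniq_face_seq ?size_face_seq //.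
exact: inord_val.
Qed.

Lemma face_idxK S : S \in faces C -> face (face_idx S) = S.
Proof.
rewrite -mem_face_seq => inS; rewrite /face inordK ?nth_index //.
by rewrite -size_face_seq index_mem.
Qed.

Lemma face_ord0 : face ord0 = set0. Proof. by []. Qed.

Lemma sum_face (V : nmodType) (g : {set T} -> V) :
  \sum_i g (face i) = \sum_(S in faces C) g S.
Proof.
rewrite [RHS](reindex_onto face face_idx); last exact: face_idxK.
by apply: eq_bigl => i; rewrite face_in faceK eqxx.
Qed.

End Enumeration.

Section SubsetConvolution.
Context {T : finType} {R : comPzRingType}.
Implicit Types (u v w : {set T} -> R) (S B : {set T}).

(** The coefficient at [S] in a product of square-free polynomials: a generator occurring in both
    factors would be squared, so only the splittings of [S] into two disjoint parts count. *)
Definition sconv u v S : R := \sum_(B : {set T} | B \subset S) u B * v (S :\: B).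

Lemma setDDid S B : B \subset S -> S :\: (S :\: B) = B.
Proof. by move=> /setIidPr; rewrite setDDr setDv set0U. Qed.

Lemma sconvC u v S : sconv u v S = sconv v u S.
Proof.
rewrite /sconv (reindex_onto (setD S) (setD S)); last exact: setDDid.
apply: eq_big => [B|B /andP[_ /eqP->]]; last by rewrite mulrC.
rewrite subsetDl /=; apply/eqP/idP => [<-|/setDDid //].
exact: subsetDl.
Qed.

Lemma sconvA u v w S : sconv u (sconv v w) S = sconv (sconv u v) w S.
Proof.
rewrite /sconv; under eq_bigr do rewrite mulr_sumr.
under [RHS]eq_bigr do rewrite mulr_suml.
rewrite [RHS](exchange_big_dep (fun B : {set T} => B \subset S)) /=; last first.
  by move=> B C sBS; move/subset_trans; apply.
apply: eq_bigr => B sBS.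
(* The intermediate sets on the right contain [B]; removing [B] matches them with the subsets of
   [S :\: B] on the left. *)
rewrite [RHS](reindex_onto (fun C => B :|: C) (fun C => C :\: B)) /=; last first.
  by move=> C /andP[_ sBC]; rewrite -{2}(setID C B) (setIidPr sBC).
apply: eq_big => C.
  rewrite subUset sBS subsetUl subsetD /= andbT; congr andb.
  rewrite setDUl setDv set0U; apply/idP/eqP => [dBC|<-]; last first.
    by rewrite disjoints_subset setDE subsetIr.
  exact/setDidPl.
rewrite subsetD => /andP[_ /setDidPl e].
by rewrite setDUl setDv set0U e setDDl mulrA.
Qed.

Lemma sconv1 v S : sconv (fun B : {set T} => (B == set0)%:R) v S = v S.
Proof.
rewrite /sconv (bigD1 set0) ?sub0set //= eqxx mul1r setD0 big1 ?addr0 //.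
by move=> B /andP[_ /negPf->]; rewrite mul0r.
Qed.
End SubsetConvolution.

Lemma eq_sconv (T : finType) (R : comPzRingType) (u u' v v' : {set T} -> R)
    (S : {set T}) :
  (forall B : {set T}, B \subset S -> u B = u' B) ->
  (forall B : {set T}, B \subset S -> v B = v' B) ->
  sconv u v S = sconv u' v' S.
Proof.
move=> eu ev; apply: eq_bigr => B sBS.
by rewrite eu // ev // subsetDl.
Qed.

Section Restriction.
Context {E : universe} {A : ring_object E}.
Implicit Types G H : E.

Lemma comp_1 G H (r : hom H G) : (1 : hom G A) ∘ r = 1.
Proof. by rewrite -[LHS]compA; congr comp; apply: bang_uniq. Qed.

Lemma comp_N G H (x : hom G A) (r : hom H G) : (- x) ∘ r = - (x ∘ r).
Proof. by rewrite -[LHS]compA. Qed.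

Lemma comp_nat G H n (r : hom H G) : (n%:R : hom G A) ∘ r = n%:R.
Proof.
elim: n => [|n IH]; first exact: comp_0.
by rewrite !mulrS comp_D IH comp_1.
Qed.

Lemma comp_sum G H (I : Type) (s : seq I) (P : pred I) (F : I -> hom G A)
    (r : hom H G) :
  (\sum_(i <- s | P i) F i) ∘ r = \sum_(i <- s | P i) (F i ∘ r).
Proof.
by elim/big_rec2: _ => [|i x y _ <-]; [exact: comp_0 | rewrite comp_D].
Qed.

Lemma comp_prod G H (I : Type) (s : seq I) (P : pred I) (F : I -> hom G A)
    (r : hom H G) :
  (\prod_(i <- s | P i) F i) ∘ r = \prod_(i <- s | P i) (F i ∘ r).
Proof.
by elim/big_rec2: _ => [|i x y _ <-]; [exact: comp_1 | rewrite comp_M].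
Qed.

End Restriction.

(* The algebra of a simplicial complex: generators of square zero, and the
   products over non-faces vanish; the faces index a basis. *)
Section ComplexAlgebra.
Context {E : universe} (A : ring_object E) {T : finType} (C : complex T).
Implicit Types G H : E.
Local Notation dim := #|faces C :\ set0|.

(** If the union of two disjoint faces is not a face, no [k] meets the second condition and the
    product is zero. *)
Definition face_const (i j k : 'I_dim.+1) : hom pt A :=
  ([disjoint face i & face j] && (face k == face i :|: face j))%:R.

Definition coef G (u : 'I_dim.+1 -> hom G A) (S : {set T}) : hom G A :=
  if S \in faces C then u (face_idx C S) else 0.

Lemma coef_face G (u : 'I_dim.+1 -> hom G A) i : coef u (face i) = u i.
Proof. by rewrite /coef face_in faceK. Qed.

Lemma coef_set0 G (u : 'I_dim.+1 -> hom G A) : coef u set0 = u ord0.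
Proof. exact: (coef_face u ord0). Qed.

(** Reduces the laws of the algebra to those of [sconv]. Nothing is lost by cutting off at the
    faces, since all subsets of a face are faces. *)
Lemma wmul_sconv G (u v : 'I_dim.+1 -> hom G A) k :
  wmul face_const u v k = sconv (coef u) (coef v) (face k).
Proof.
transitivity (\sum_(B in faces C) \sum_(B' in faces C)
  ([disjoint B & B'] && (face k == B :|: B'))%:R * coef u B * coef v B').
  rewrite /wmul -sum_face; apply: eq_bigr => i _.
  rewrite -sum_face; apply: eq_bigr => j _.
  by rewrite !coef_face comp_nat.
rewrite /sconv (big_setID [set B : {set T} | B \subset face k]) /=.
rewrite [X in _ + X]big1 ?addr0 => [|B]; last first.
  rewrite !inE => /andP[nB _]; apply: big1 => B' _.
  case: eqP => [e|_]; last by rewrite andbF !mul0r.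
  by rewrite e subsetUl in nB.
apply: eq_big => [B|B].
  rewrite !inE; case sB: (B \subset face k); rewrite ?andbF //.
  by rewrite (facesS (face_in k)).
rewrite !inE => /andP[_ sB].
rewrite (bigD1 (face k :\: B)) ?(facesS (face_in k)) ?subsetDl //=.
rewrite big1 ?addr0 => [|B' /andP[_ /eqP nB']]; last first.
  have [dBB'|] := boolP [disjoint B & B']; last by rewrite !mul0r.
  case: eqP => [e|_]; last by rewrite !mul0r.
  case: nB'; rewrite e setDUl setDv set0U; apply/esym/setDidPl.
  by rewrite disjoint_sym.
have -> : [disjoint B & face k :\: B].
  by rewrite disjoint_sym disjoints_subset setDE subsetIr.
rewrite -{1}(setID (face k) B) (setIidPr sB) eqxx mulr1n mul1r.
by [].
Qed.

Lemma coef_wmul G (u v : 'I_dim.+1 -> hom G A) (S : {set T}) : S \in faces C ->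
  coef (wmul face_const u v) S = sconv (coef u) (coef v) S.
Proof. by move=> inS; rewrite /coef inS wmul_sconv face_idxK. Qed.

Lemma cplx_wmulC G : commutative (wmul face_const (G := G)).
Proof. by move=> u v; apply/funext => k; rewrite !wmul_sconv sconvC. Qed.

Lemma cplx_wmulA G : associative (wmul face_const (G := G)).
Proof.
move=> u v w; apply/funext => k; rewrite !wmul_sconv.
transitivity (sconv (coef u) (sconv (coef v) (coef w)) (face k)).
  apply: eq_sconv => // B sB; apply: coef_wmul.
  exact: facesS (face_in k) sB.
rewrite sconvA; apply/esym/eq_sconv => // B sB; apply: coef_wmul.
exact: facesS (face_in k) sB.
Qed.

Lemma coef_wone G (S : {set T}) : S \in faces C -> coef (wone A dim G) S = (S == set0)%:R.
Proof.
move=> inS; rewrite /coef inS /wone; congr (nat_of_bool _)%:R.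
by rewrite -(can_eq (@faceK _ C)) face_idxK.
Qed.

Lemma cplx_wmul1 G : left_id (wone A dim G) (wmul face_const (G := G)).
Proof.
move=> u; apply/funext => k; rewrite wmul_sconv -[RHS]coef_face -[RHS]sconv1.
by apply: eq_sconv => // B sB; rewrite coef_wone // (facesS (face_in k)).
Qed.

Lemma cplx_ideal G (u v : 'I_dim.+1 -> hom G A) :
  u ord0 = 0 -> wmul face_const u v ord0 = 0.
Proof.
move=> u0; rewrite wmul_sconv /sconv big1 // => B.
by rewrite face_ord0 subset0 => /eqP->; rewrite coef_set0 u0 mul0r.
Qed.

Lemma cplx_nilp : exists N : nat,
  forall G (u : 'I_N -> 'I_dim.+1 -> hom G A),
  (forall i, u i ord0 = 0) ->
  forall k, (\big[wmul face_const (G := G)/wone A dim G]_(i < N) u i) k = 0.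
Proof.
(* A product of [N] elements without constant term has coefficient zero at every set of fewer than
   [N] vertices, and no set has more than [#|T|]. *)
exists #|T|.+1 => G u u0 k.
suff H N (v : 'I_N -> 'I_dim.+1 -> hom G A) : (forall i, v i ord0 = 0) ->
    forall S : {set T}, (#|S| < N)%N ->
    coef (\big[wmul face_const (G := G)/wone A dim G]_(i < N) v i) S = 0.
  by rewrite -coef_face; apply: H => //; rewrite ltnS max_card.
elim: N v => [//|N IH] v v0 S ltS.
have [inS|/negPf nS] := boolP (S \in faces C); last by rewrite /coef nS.
rewrite big_ord_recl coef_wmul // /sconv big1 // => B sBS.
have [->|nB] := eqVneq B set0; first by rewrite coef_set0 v0 mul0r.
rewrite IH ?mulr0 // -ltnS (leq_trans _ ltS) // ltnS -[X in (_ < X)%N](cardsID B).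
by rewrite (setIidPr sBS) -[X in (X < _)%N]add0n ltn_add2r card_gt0.
Qed.

Definition complex_weil : weil A :=
  Weil cplx_wmulC cplx_wmulA cplx_wmul1 cplx_ideal cplx_nilp.

End ComplexAlgebra.

(** * Points of spectra and of spaces of complexes *)

Section SpecPoints.
Context {E : universe} {A : ring_object E} (W : weil A).
Implicit Types G H : E.

Definition spec_coord H (x : hom H (Spec W)) : 'I_(wdim W).+1 -> hom H A :=
  coord (incl ∘ x).

Lemma spec_coord_comp G H (x : hom G (Spec W)) (r : hom H G) i :
  spec_coord (x ∘ r) i = spec_coord x i ∘ r.
Proof. by rewrite /spec_coord compA coord_comp. Qed.

Lemma spec_ext H (x y : hom H (Spec W)) : spec_coord x =1 spec_coord y -> x = y.
Proof. by move=> e; apply: incl_mono; apply: coord_ext. Qed.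

Lemma spec_coord0 H (x : hom H (Spec W)) : spec_coord x ord0 = 1.
Proof.
have := congr1 (fun f => pi1 ∘ (f ∘ x)) (eqz_eq _ _).
by rewrite -!compA !pi1_pair_comp comp_1.
Qed.

Lemma spec_coordM H (x : hom H (Spec W)) i j :
  spec_coord x i * spec_coord x j =
  \sum_k (wc i j k ∘ bang) * spec_coord x k.
Proof.
have := congr1 (fun f => coord (coord (pi2 ∘ (f ∘ x)) i) j) (eqz_eq _ _).
rewrite -!compA !pi2_pair_comp !coord_tup_comp.
rewrite comp_M comp_sum => e; rewrite /spec_coord /coord e.
apply: eq_bigr => k _; rewrite comp_M -compA; congr (_ ∘ _ * _).
exact: bang_uniq.
Qed.

Lemma mkSpec_subproof H (y : 'I_(wdim W).+1 -> hom H A) :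
  y ord0 = 1 ->
  (forall i j, y i * y j = \sum_k (wc i j k ∘ bang) * y k) ->
  exists x : hom H (Spec W), spec_coord x = y.
Proof.
move=> y0 yM; set n := (wdim W).+1.
have e : ⟨proj A ord0, tup (fun i : 'I_n => tup (fun j : 'I_n => proj A i * proj A j))⟩
    ∘ tup y =
  ⟨(1 : hom (pow A n) A), tup (fun i : 'I_n => tup (fun j : 'I_n =>
    \sum_(k < n) (wc i j k ∘ bang) * proj A k))⟩ ∘ tup y.
  have py i : proj A i ∘ tup y = y i by exact: (coord_tup y i).
  apply: pair_ext; rewrite ?pi1_pair_comp ?pi2_pair_comp; first by rewrite py y0 comp_1.
  rewrite !tup_comp; apply: eq_tup => i; rewrite !tup_comp; apply: eq_tup => j.
  rewrite comp_M !py yM comp_sum; apply: eq_bigr => k _.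
  by rewrite comp_M py -compA [bang ∘ _]bang_uniq.
exists (corestr e); apply/funext => i.
by rewrite /spec_coord incl_corestr coord_tup.
Qed.

End SpecPoints.

Section DPoints.
Context {E : universe} {A : ring_object E}.
Implicit Types G H : E.

Lemma dval_mkD H (x : hom H A) (e : x * x = 0) : dval (mkD e) = x.
Proof. exact: incl_corestr. Qed.

Lemma D_ext H (d d' : hom H (D A)) : dval d = dval d' -> d = d'.
Proof. exact: incl_mono. Qed.

Lemma dval_comp G H (d : hom G (D A)) (r : hom H G) : dval (d ∘ r) = dval d ∘ r.
Proof. exact: compA. Qed.

Lemma dval_scale H (a : hom H A) (d : hom H (D A)) : dval (dscale a d) = a * dval d.
Proof. exact: dval_mkD. Qed.

Lemma dzero_comp G H (r : hom H G) : dzero ∘ r = dzero :> hom H (D A).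
Proof. by apply: D_ext; rewrite dval_comp !dval0 comp_0. Qed.

Lemma dscale_comp G H (a : hom G A) (d : hom G (D A)) (r : hom H G) :
  dscale a d ∘ r = dscale (a ∘ r) (d ∘ r).
Proof. by apply: D_ext; rewrite dval_comp !dval_scale comp_M -dval_comp. Qed.

Lemma dmul_comp G H (d d' : hom G (D A)) (r : hom H G) :
  dmul d d' ∘ r = dmul (d ∘ r) (d' ∘ r).
Proof. by rewrite /dmul dscale_comp -dval_comp. Qed.

End DPoints.

Section ComplexPoints.
Context {E : universe} (A : ring_object E) {T : finType} (C : complex T).
Implicit Types G H : E.

Definition Sp : E := Spec (complex_weil A C).

Definition mono H (d : T -> hom H (D A)) (S : {set T}) : hom H A :=
  \prod_(t in S) dval (d t).

(** The equations that cut the space of the complex out of D^T; by [dco_valid], [sp_ext] and [mkSp]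
    the points of [Sp] are exactly the valid families. *)
Definition valid H (d : T -> hom H (D A)) :=
  forall S : {set T}, S \notin faces C -> mono d S = 0.

Definition sp_mono H (x : hom H Sp) (S : {set T}) : hom H A :=
  @coef E A T C H (spec_coord x) S.

Lemma sp_mono_comp G H (x : hom G Sp) (r : hom H G) S :
  sp_mono (x ∘ r) S = sp_mono x S ∘ r.
Proof.
by rewrite /sp_mono /coef; case: ifP => _; rewrite ?comp_0 // spec_coord_comp.
Qed.

Lemma sp_mono0 H (x : hom H Sp) : sp_mono x set0 = 1.
Proof. by rewrite /sp_mono coef_set0 spec_coord0. Qed.

Lemma sp_monoM H (x : hom H Sp) S S' :
  sp_mono x S * sp_mono x S' =
  if [disjoint S & S'] then sp_mono x (S :|: S') else 0.
Proof.
have [inS|nS] := boolP (S \in faces C); last first.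
  rewrite {1 3}/sp_mono /coef (negPf nS) mul0r.
  case: ifP => _ //; case: ifP => // inU.
  by rewrite (facesS inU) ?subsetUl in nS.
have [inS'|nS'] := boolP (S' \in faces C); last first.
  rewrite {2 3}/sp_mono /coef (negPf nS') mulr0.
  case: ifP => _ //; case: ifP => // inU.
  by rewrite (facesS inU) ?subsetUr in nS'.
rewrite {1 2}/sp_mono /coef inS inS' (spec_coordM x) /=.
transitivity (\sum_(B in faces C)
  ([disjoint S & S'] && (B == S :|: S'))%:R * sp_mono x B).
  rewrite -sum_face; apply: eq_bigr => k _.
  rewrite /sp_mono coef_face; congr (_ * _).
  by rewrite comp_nat !face_idxK.
have [dSS'|_] := boolP [disjoint S & S']; last by rewrite big1 // => B _; rewrite mul0r.
have [inU|nU] := boolP (S :|: S' \in faces C).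
  rewrite (bigD1 (S :|: S')) //= eqxx mulr1n mul1r big1 ?addr0 //.
  by move=> B /andP[_ /negPf->]; rewrite mul0r.
rewrite big1 => [|B inB]; first by rewrite /sp_mono /coef (negPf nU).
case: eqP => [e|_]; last by rewrite mul0r.
by rewrite -e inB in nU.
Qed.

Lemma sp_sq H (x : hom H Sp) t : sp_mono x [set t] * sp_mono x [set t] = 0.
Proof. by rewrite sp_monoM; case: ifP => //; rewrite -setI_eq0 setIid -cards_eq0 cards1. Qed.

Definition dco H (x : hom H Sp) (t : T) : hom H (D A) := mkD (sp_sq x t).

Lemma dco_comp G H (x : hom G Sp) (r : hom H G) t : dco (x ∘ r) t = dco x t ∘ r.
Proof. by apply: D_ext; rewrite dval_comp !dval_mkD sp_mono_comp. Qed.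

(** Splitting off one vertex at a time recovers the values on all basis vectors from those on the
    vertices; hence a point of the spectrum is determined by its family of elements of D. *)
Lemma sp_monoE H (x : hom H Sp) S : sp_mono x S = mono (dco x) S.
Proof.
have [n] := ubnP #|S|; elim: n S => // n IH S; rewrite ltnS => leS.
have [->|/set0Pn[t tS]] := eqVneq S set0; first by rewrite sp_mono0 /mono big_set0.
rewrite /mono (big_setD1 t) //= -[X in _ * X]IH; last first.
  by rewrite (leq_trans _ leS) // [X in (_ < X)%N](cardsD1 t) tS.
by rewrite dval_mkD sp_monoM disjoints1 !inE eqxx setD1K.
Qed.

Lemma dco_valid H (x : hom H Sp) : valid (dco x).
Proof. by move=> S nS; rewrite -sp_monoE /sp_mono /coef (negPf nS). Qed.

Lemma sp_ext H (x y : hom H Sp) : dco x =1 dco y -> x = y.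
Proof.
move=> /funext e; apply: spec_ext => i.
have: sp_mono x (face i) = sp_mono y (face i) by rewrite !sp_monoE e.
by rewrite /sp_mono !coef_face.
Qed.

Lemma mono_comp G H (d : T -> hom G (D A)) (r : hom H G) S :
  mono d S ∘ r = mono (fun t => d t ∘ r) S.
Proof. by rewrite /mono comp_prod; apply: eq_bigr => t _; rewrite dval_comp. Qed.

Lemma monoM H (d : T -> hom H (D A)) S S' :
  mono d S * mono d S' = if [disjoint S & S'] then mono d (S :|: S') else 0.
Proof.
case: ifP => [dSS'|/negbT].
  by rewrite /mono -bigU //; apply: eq_bigl => t; rewrite !inE.
rewrite -setI_eq0 => /set0Pn[t]; rewrite inE => /andP[tS tS'].
rewrite /mono (big_setD1 t) //= [X in _ * X](big_setD1 t) //=.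
by rewrite mulrACA dval_sq mul0r.
Qed.

(** The products over faces serve as values on the basis. Multiplicativity is automatic except for
    disjoint faces whose union is not a face, and there validity gives zero. *)
Lemma mkSp_subproof H (d : T -> hom H (D A)) : valid d ->
  exists x : hom H Sp, dco x = d.
Proof.
move=> vd.
have [||x xP] := @mkSpec_subproof _ _ (complex_weil A C) H (fun i => mono d (face i)).
- by rewrite /mono face_ord0 big_set0.
- move=> i j; rewrite monoM /=.
  transitivity (\sum_(B in faces C)
    ([disjoint face i & face j] && (B == face i :|: face j))%:R * mono d B);
    last by rewrite -sum_face; apply: eq_bigr => k _; rewrite comp_nat.
  case: ifP => _; last by rewrite big1 // => B _; rewrite mul0r.
  have [inU|nU] := boolP (face i :|: face j \in faces C).
    rewrite (bigD1 (face i :|: face j)) //= eqxx mulr1n mul1r big1 ?addr0 //.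
    by move=> B /andP[_ /negPf->]; rewrite mul0r.
  rewrite vd // big1 // => B inB; case: eqP => [e|_]; last by rewrite mul0r.
  by rewrite -e inB in nU.
exists x; apply/funext => t; apply: D_ext; rewrite dval_mkD /sp_mono xP /coef.
case: ifP => [int|/negbT nt]; first by rewrite face_idxK // /mono big_set1.
by rewrite -(vd _ nt) /mono big_set1.
Qed.

Definition mkSp H (d : T -> hom H (D A)) (v : valid d) : hom H Sp :=
  sval (cid (mkSp_subproof v)).

Lemma dco_mkSp H (d : T -> hom H (D A)) (v : valid d) : dco (mkSp v) = d.
Proof. by rewrite /mkSp; case: (cid _). Qed.

Lemma valid_comp G H (d : T -> hom G (D A)) (r : hom H G) :
  valid d -> valid (fun t => d t ∘ r).
Proof. by move=> v S nS; rewrite -mono_comp v // comp_0. Qed.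

Lemma mkSp_comp G H (d : T -> hom G (D A)) (v : valid d) (r : hom H G) :
  mkSp v ∘ r = mkSp (valid_comp r v).
Proof. by apply: sp_ext => t; rewrite dco_comp !dco_mkSp. Qed.

End ComplexPoints.

(** * Gluing along complexes *)

Section KockLawvere.
Context {E : universe} (A : line E) {T : finType} (C : complex T).
Implicit Types G H : E.

Definition poly_eval G (a : {set T} -> hom G A) H (r : hom H G)
    (x : hom H (Sp A C)) : hom H A :=
  \sum_(S in faces C) (a S ∘ r) * mono (dco x) S.

Lemma weil_evalE (W : weil A) H (w : hom H (pow A (wdim W).+1)) x :
  app (weil_eval W ∘ w) x = \sum_k coord w k * spec_coord x k.
Proof.
rewrite app_lam_comp comp_sum; apply: eq_bigr => k _.
by rewrite comp_M -!coord_comp -compA pi1_pair pi2_pair.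
Qed.

Lemma weil_eval_tup G (a : {set T} -> hom G A) H (r : hom H G) (x : hom H (Sp A C)) :
  app (weil_eval (complex_weil A C) ∘ tup (fun i => a (face i)) ∘ r) x =
  poly_eval a r x.
Proof.
rewrite -compA weil_evalE /poly_eval -sum_face; apply: eq_bigr => k _.
rewrite coord_tup_comp -sp_monoE /sp_mono coef_face; congr (_ * _).
Qed.

Lemma poly_evalP G (f : hom G (Sp A C ⇒ A)) :
  exists a, forall H (r : hom H G) x, app (f ∘ r) x = poly_eval a r x.
Proof.
have [g [gK Kg]] := kock_lawvere (complex_weil A C).
exists (@coef E A T C G (coord (g ∘ f))) => H r x.
rewrite -weil_eval_tup -[f in LHS]comp_idl -Kg -!compA.
congr (app (_ ∘ _) x); rewrite !compA; congr comp.
by rewrite -[LHS]tup_coord; apply: eq_tup => i; rewrite coef_face.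
Qed.

Lemma poly_eval_inj G (a b : {set T} -> hom G A) :
  (forall H (r : hom H G) (x : hom H (Sp A C)), poly_eval a r x = poly_eval b r x) ->
  forall S, S \in faces C -> a S = b S.
Proof.
move=> eab S inS; have [g [gK Kg]] := kock_lawvere (complex_weil A C).
suff /(congr1 (fun f => coord (g ∘ f) (face_idx C S))) :
    weil_eval (complex_weil A C) ∘ tup (fun i => a (face i)) =
    weil_eval (complex_weil A C) ∘ tup (fun i => b (face i)).
  by rewrite !compA gK !comp_idl !coord_tup face_idxK.
by apply: exp_ext => H r x; rewrite !weil_eval_tup.
Qed.

End KockLawvere.

Section SpanGlue.
Context {E : universe} (A : ring_object E) {I J : finType}.
Context (W : I -> weil A) (V : J -> weil A) (U : weil A) (s t : J -> I).
Context (a : forall j, hom (Spec (V j)) (Spec (W (s j)))).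
Context (b : forall j, hom (Spec (V j)) (Spec (W (t j)))).
Context (phi : forall i, hom (Spec (W i)) (Spec U)).
Hypothesis phi_ab : forall j, phi (s j) ∘ a j = phi (t j) ∘ b j.

Definition has_glue (X : E) := forall G (f : forall i, hom G (Spec (W i) ⇒ X)),
  (forall j H (r : hom H G) x,
     app (f (s j) ∘ r) (a j ∘ x) = app (f (t j) ∘ r) (b j ∘ x)) ->
  exists! u : hom G (Spec U ⇒ X), forall i H (r : hom H G) x,
    app (u ∘ r) (phi i ∘ x) = app (f i ∘ r) x.

(** An arrow of a diagram has one source and one target, so each overlap [V j] becomes a vertex of
    its own with two outgoing arrows, told apart by the boolean. *)
Let vert (v : I + J) : weil A :=
  match v with inl i => W i | inr j => V j end.

Let atgt (e : J * bool) : I + J := inl (if e.2 then s e.1 else t e.1).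

Let amap (e : J * bool) : hom (Spec (vert (inr e.1))) (Spec (vert (atgt e))) :=
  match e as e0 return hom (Spec (vert (inr e0.1))) (Spec (vert (atgt e0))) with
  | (j, true) => a j
  | (j, false) => b j
  end.

Let vleg (v : I + J) : hom (Spec (vert v)) (Spec U) :=
  match v with inl i => phi i | inr j => phi (s j) ∘ a j end.

Let vleg_comm e : vleg (atgt e) ∘ amap e = vleg (inr e.1).
Proof. by case: e => j [] //=; rewrite phi_ab. Qed.

Definition span_cocone : weil_cocone A := WeilCocone vleg_comm.

Lemma span_limitP X : limit_after_exp span_cocone X <-> has_glue X.
Proof.
split=> [lX G f fab|gX G f fc].
  pose f' (v : I + J) : hom G (Spec (vert v) ⇒ X) :=
    match v with inl i => f i | inr j => precomp (a j) (f (s j)) end.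
  have [|u [uP uU]] := lX G f'.
    move=> [j []] //=; apply: exp_ext => H r x.
    by rewrite !precompE fab.
  exists u; split=> [i H r x|u' u'P].
    by rewrite -[f i](uP (inl i)) precompE.
  apply: uU => -[i|j] /=; apply: exp_ext => H r x; rewrite !precompE ?u'P //.
  by rewrite -compA u'P.
have [|u [uP uU]] := gX G (fun i => f (inl i)).
  move=> j H r x; have := fc (j, true); have := fc (j, false).
  by move=> /= <- /(congr1 (fun g => app (g ∘ r) x)); rewrite !precompE.
exists u; split=> [v|u' u'P].
  case: v => [i|j]; apply: exp_ext => H r x; rewrite !precompE ?uP //=.
  by rewrite -compA uP -(fc (j, true)) precompE.
apply: uU => i H r x.
by rewrite -(u'P (inl i)) precompE.
Qed.

(** Microlinearity in the form used below: gluing has to be checked for the line alone, where it is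
    a statement about coefficients of polynomials. *)
Lemma span_glue X : has_glue A -> microlinear A X -> has_glue X.
Proof. by move=> /span_limitP gA mX; apply/span_limitP/mX. Qed.

End SpanGlue.

Section Covers.
Context {T : finType}.

Definition simplex (F : {set T}) : complex T.
Proof.
exists (powerset F) => [|S S']; first by rewrite inE sub0set.
by rewrite !inE => sSF sS'S; apply: subset_trans sSF.
Defined.

(** [i0] witnesses that there is a facet, hence that the empty set is a face. *)
Definition cover_complex (I : finType) (i0 : I) (F : I -> {set T}) : complex T.
Proof.
exists [set S : {set T} | [exists i, S \subset F i]] => [|S S'].
  by rewrite inE; apply/existsP; exists i0; apply: sub0set.
rewrite !inE => /existsP[i sSF] sS'S; apply/existsP; exists i.
exact: subset_trans sSF.
Defined.

Lemma simplex_face F (S : {set T}) : (S \in faces (simplex F)) = (S \subset F).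
Proof. by rewrite inE. Qed.

Lemma cover_face (I : finType) (i0 : I) F (S : {set T}) :
  (S \in faces (cover_complex i0 F)) = [exists i, S \subset F i].
Proof. by rewrite inE. Qed.

End Covers.

Section Inclusions.
Context {E : universe} (A : ring_object E) {T : finType}.
Implicit Types (G H : E) (C : complex T).

(** The retraction of D^T onto the subspace D^F. It allows points of all simplices to be described
    by families over the same [T]. *)
Definition restr H (F : {set T}) (d : T -> hom H (D A)) (t : T) : hom H (D A) :=
  if t \in F then d t else dzero.

Lemma dco_simplex H F (x : hom H (Sp A (simplex F))) : dco x = restr F (dco x).
Proof.
apply/funext => t; rewrite /restr; case: ifP => // /negbT nt; apply: D_ext.
have := dco_valid x (S := [set t]).
by rewrite simplex_face sub1set nt /mono big_set1 dval0 => ->.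
Qed.

Lemma mono_restr H F (d : T -> hom H (D A)) (S : {set T}) :
  mono (restr F d) S = if S \subset F then mono d S else 0.
Proof.
case: ifP => [sSF|/negbT/subsetPn[t tS ntF]].
  by apply: eq_bigr => t tS; rewrite /restr (subsetP sSF).
by rewrite /mono (big_setD1 t) //= /restr (negPf ntF) dval0 mul0r.
Qed.

Lemma valid_sub C C' H (d : T -> hom H (D A)) :
  faces C \subset faces C' -> valid C d -> valid C' d.
Proof. by move=> sCC' vd S nS; apply: vd; apply: contra nS; apply: subsetP. Qed.

Definition inc C C' (sCC' : faces C \subset faces C') : hom (Sp A C) (Sp A C') :=
  mkSp (valid_sub sCC' (dco_valid idm)).

Lemma dco_inc C C' (sCC' : faces C \subset faces C') H (x : hom H (Sp A C)) :
  dco (inc sCC' ∘ x) = dco x.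
Proof.
by apply/funext => t; rewrite dco_comp dco_mkSp -dco_comp comp_idl.
Qed.

Lemma sp_factor C C' H (x : hom H (Sp A C')) : valid C (dco x) ->
  exists y : hom H (Sp A C), dco y = dco x.
Proof. by move=> v; exists (mkSp v); rewrite dco_mkSp. Qed.

Lemma valid_simplex H F (d : T -> hom H (D A)) : valid (simplex F) (restr F d).
Proof. by move=> S; rewrite simplex_face mono_restr => /negPf->. Qed.

End Inclusions.

Lemma poly_eval_sub (E : universe) (A : line E) (T : finType) (C C' : complex T)
    (G : E) (a : {set T} -> hom G A) (H : E) (r : hom H G) (x : hom H (Sp A C))
    (y : hom H (Sp A C')) :
  faces C \subset faces C' -> dco y = dco x -> poly_eval a r y = poly_eval a r x.
Proof.
move=> sCC' e; rewrite /poly_eval e (big_setID (faces C)) /= (setIidPr sCC').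
rewrite [X in _ + X]big1 ?addr0 // => S; rewrite inE => /andP[nS _].
by rewrite (dco_valid x) // mulr0.
Qed.

Lemma eq_poly_eval (E : universe) (A : line E) (T : finType) (C : complex T)
    (G : E) (a b : {set T} -> hom G A) (H : E) (r : hom H G) (x : hom H (Sp A C)) :
  {in faces C, a =1 b} -> poly_eval a r x = poly_eval b r x.
Proof. by move=> e; apply: eq_bigr => S inS; rewrite e. Qed.

(* The space of a complex is the union of its facets, as seen by microlinear
   spaces. *)
Section Cover.
Context {E : universe} (A : line E) {T I : finType} (i0 : I) (F : I -> {set T}).
Implicit Types G H : E.
Local Notation C := (cover_complex i0 F).

Let sub_l (j : I * I) :
  faces (simplex (F j.1 :&: F j.2)) \subset faces (simplex (F j.1)).
Proof. by rewrite powersetS subsetIl. Qed.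
Let sub_r (j : I * I) :
  faces (simplex (F j.1 :&: F j.2)) \subset faces (simplex (F j.2)).
Proof. by rewrite powersetS subsetIr. Qed.
Let sub_c (i : I) : faces (simplex (F i)) \subset faces C.
Proof.
apply/subsetP => S; rewrite simplex_face cover_face => sS.
by apply/existsP; exists i.
Qed.

(** Over each facet the map is a polynomial. On the intersection of two facets the polynomials
    agree, so their coefficients at common faces are equal, and together they form one polynomial
    over the union. *)
Lemma has_glue_cover :
  has_glue (fun j => inc A (sub_l j)) (fun j => inc A (sub_r j))
    (fun i => inc A (sub_c i)) A.
Proof.
move=> G f fab.
pose c i := sval (cid (poly_evalP (f i))).
have cP i H (r : hom H G) x : app (f i ∘ r) x = poly_eval (c i) r x.
  by rewrite /c; case: (cid _).
have cE i j (S : {set T}) : S \subset F i -> S \subset F j -> c i S = c j S.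
  move=> sSi sSj; apply: (@poly_eval_inj _ _ _ (simplex (F i :&: F j))).
    move=> H r x; have := fab (i, j) H r x; rewrite !cP.
    rewrite (poly_eval_sub _ _ (sub_l (i, j)) (dco_inc _ _)).
    by rewrite (poly_eval_sub _ _ (sub_r (i, j)) (dco_inc _ _)).
  by rewrite simplex_face subsetI sSi.
(* A face lying in several facets has the same coefficient in all of them, so any choice does; the
   value 0 concerns only non-faces. *)
pose a (S : {set T}) := if [pick i | S \subset F i] is Some i then c i S else 0.
have aE i (S : {set T}) : S \subset F i -> a S = c i S.
  move=> sSi; rewrite /a; case: pickP => [j sSj|/(_ i)]; last by rewrite sSi.
  exact: cE.
exists (weil_eval (complex_weil A C) ∘ tup (fun i => a (face i))).
split=> [i H r x|u uP].
  rewrite weil_eval_tup (poly_eval_sub _ _ (sub_c i) (dco_inc _ _)) cP.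
  by apply: eq_poly_eval => S; rewrite simplex_face; apply: aE.
have [b bP] := poly_evalP u.
apply: exp_ext => H r x; rewrite weil_eval_tup bP.
apply: eq_poly_eval => S; rewrite cover_face => /existsP[i sSi].
rewrite (aE i) //; apply: (@poly_eval_inj _ _ _ (simplex (F i))) => [K q y|].
  by rewrite -cP -uP bP (poly_eval_sub _ _ (sub_c i) (dco_inc _ _)).
by rewrite simplex_face.
Qed.

Context (X : E) (mX : microlinear A X).

Let glueX : has_glue (fun j => inc A (sub_l j)) (fun j => inc A (sub_r j))
    (fun i => inc A (sub_c i)) X.
Proof.
apply: span_glue has_glue_cover mX => j.
by apply: sp_ext => t; rewrite !dco_inc /inc !dco_mkSp.
Qed.

(** The data are functions of whole families [d], used only at [restr (F i) d]; applying the lemma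
    then requires no mention of the simplices and of the inclusions between them. *)
Lemma cover_glue G
    (f : I -> forall H, hom H G -> (T -> hom H (D A)) -> hom H X) :
  (forall i H K (r : hom H G) d (s : hom K H),
    f i H r d ∘ s = f i K (r ∘ s) (fun t => d t ∘ s)) ->
  (forall i j H (r : hom H G) d,
    f i H r (restr (F i :&: F j) d) = f j H r (restr (F i :&: F j) d)) ->
  exists u : hom G (Sp A C ⇒ X), forall i H (r : hom H G) x d,
    dco x = restr (F i) d -> app (u ∘ r) x = f i H r (restr (F i) d).
Proof.
move=> nf fE.
have nf' i : natural (fun H (r : hom H G) (x : hom H (Sp A (simplex (F i)))) =>
    f i H r (dco x)).
  by move=> H K r x s; rewrite nf; congr f; apply/funext => t; rewrite dco_comp.
have [|u [uP _]] := @glueX G (fun i => lamN (fun H r x => f i H r (dco x))).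
  by move=> j H r x; rewrite !(app_lamN (nf' _)) !dco_inc dco_simplex fE.
exists u => i H r x d e.
have [|y yE] := sp_factor (C := simplex (F i)) (x := x).
  by rewrite e; apply: valid_simplex.
have -> : x = inc A (sub_c i) ∘ y by apply: sp_ext => t; rewrite dco_inc yE.
by rewrite uP (app_lamN (nf' i)) yE e.
Qed.

Lemma cover_uniq G (u v : hom G (Sp A C ⇒ X)) :
  (forall i H (r : hom H G) x, dco x = restr (F i) (dco x) ->
    app (u ∘ r) x = app (v ∘ r) x) -> u = v.
Proof.
move=> uv; have [|w [_ wU]] := @glueX G (fun i => precomp (inc A (sub_c i)) u).
  move=> j H r x; rewrite !precompE; congr app.
  by apply: sp_ext => t; rewrite !dco_inc.
have <- : w = u by apply: wU => i H r x; rewrite precompE.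
apply: wU => i H r x; rewrite precompE (uv i) //.
by rewrite dco_inc; apply: dco_simplex.
Qed.

End Cover.

(** * The space of strong differences and the axes D(2) *)

Section KPoints.
Context {E : universe} {A : ring_object E}.
Implicit Types G H : E.

Definition K_1 H (z : hom H (K A)) : hom H (D A) := pi1 ∘ (pi1 ∘ (incl ∘ z)).
Definition K_2 H (z : hom H (K A)) : hom H (D A) := pi2 ∘ (pi1 ∘ (incl ∘ z)).
Definition K_3 H (z : hom H (K A)) : hom H (D A) := pi2 ∘ (incl ∘ z).

Lemma K_ext H (z z' : hom H (K A)) :
  K_1 z = K_1 z' -> K_2 z = K_2 z' -> K_3 z = K_3 z' -> z = z'.
Proof.
by move=> e1 e2 e3; apply: incl_mono; apply: pair_ext => //; apply: pair_ext.
Qed.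

Lemma K_comp G H (z : hom G (K A)) (r : hom H G) :
  (K_1 (z ∘ r) = K_1 z ∘ r) * (K_2 (z ∘ r) = K_2 z ∘ r) *
  (K_3 (z ∘ r) = K_3 z ∘ r).
Proof. by rewrite /K_1 /K_2 /K_3 !compA. Qed.

Lemma K_13 H (z : hom H (K A)) : dval (K_1 z) * dval (K_3 z) = 0.
Proof.
have := congr1 (fun f => pi1 ∘ (f ∘ z)) (eqz_eq _ _).
rewrite -!compA !pi1_pair_comp comp_M comp_0 -!dval_comp.
by rewrite /K_1 /K_3 !compA.
Qed.

Lemma K_23 H (z : hom H (K A)) : dval (K_2 z) * dval (K_3 z) = 0.
Proof.
have := congr1 (fun f => pi2 ∘ (f ∘ z)) (eqz_eq _ _).
rewrite -!compA !pi2_pair_comp comp_M comp_0 -!dval_comp.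
by rewrite /K_2 /K_3 !compA.
Qed.

Section Make.
Variables (H : E) (d1 d2 e : hom H (D A)).
Hypotheses (h1 : dval d1 * dval e = 0) (h2 : dval d2 * dval e = 0).

Lemma K_1_mk : K_1 (mkK h1 h2) = d1.
Proof. by rewrite /K_1 incl_corestr !pi1_pair. Qed.

Lemma K_2_mk : K_2 (mkK h1 h2) = d2.
Proof. by rewrite /K_2 incl_corestr pi1_pair pi2_pair. Qed.

Lemma K_3_mk : K_3 (mkK h1 h2) = e.
Proof. by rewrite /K_3 incl_corestr pi2_pair. Qed.

End Make.

Definition K_mkE := (K_1_mk, K_2_mk, K_3_mk).

Lemma eq_mkK H (d1 d2 e d1' d2' e' : hom H (D A))
    (h1 : dval d1 * dval e = 0) (h2 : dval d2 * dval e = 0)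
    (h1' : dval d1' * dval e' = 0) (h2' : dval d2' * dval e' = 0) :
  d1 = d1' -> d2 = d2' -> e = e' -> mkK h1 h2 = mkK h1' h2'.
Proof. by move=> e1 e2 e3; apply: K_ext; rewrite !K_mkE. Qed.

Lemma mkK_comp G H (r : hom H G) (d1 d2 e : hom G (D A)) (d1' d2' e' : hom H (D A))
    (h1 : dval d1 * dval e = 0) (h2 : dval d2 * dval e = 0)
    (h1' : dval d1' * dval e' = 0) (h2' : dval d2' * dval e' = 0) :
  d1 ∘ r = d1' -> d2 ∘ r = d2' -> e ∘ r = e' -> mkK h1 h2 ∘ r = mkK h1' h2'.
Proof. by move=> e1 e2 e3; apply: K_ext; rewrite K_comp !K_mkE. Qed.

Definition D2_1 H (z : hom H (D2 A)) : hom H (D A) := pi1 ∘ (incl ∘ z).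
Definition D2_2 H (z : hom H (D2 A)) : hom H (D A) := pi2 ∘ (incl ∘ z).

Lemma D2_ext H (z z' : hom H (D2 A)) :
  D2_1 z = D2_1 z' -> D2_2 z = D2_2 z' -> z = z'.
Proof. by move=> e1 e2; apply: incl_mono; apply: pair_ext. Qed.

Lemma D2_comp G H (z : hom G (D2 A)) (r : hom H G) :
  (D2_1 (z ∘ r) = D2_1 z ∘ r) * (D2_2 (z ∘ r) = D2_2 z ∘ r).
Proof. by rewrite /D2_1 /D2_2 !compA. Qed.

Lemma D2_12 H (z : hom H (D2 A)) : dval (D2_1 z) * dval (D2_2 z) = 0.
Proof.
have e : (dval pi1 * dval pi2 : hom (D A ⊗ D A) A) ∘ (incl ∘ z) = 0 ∘ (incl ∘ z).
  by rewrite !(compA _ incl z) eqz_eq.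
by rewrite comp_0 comp_M -!dval_comp in e.
Qed.

Lemma D2_1_mk H (d1 d2 : hom H (D A)) (e : dval d1 * dval d2 = 0) :
  D2_1 (mkD2 e) = d1.
Proof. by rewrite /D2_1 incl_corestr pi1_pair. Qed.

Lemma D2_2_mk H (d1 d2 : hom H (D A)) (e : dval d1 * dval d2 = 0) :
  D2_2 (mkD2 e) = d2.
Proof. by rewrite /D2_2 incl_corestr pi2_pair. Qed.

Definition D2_mkE := (D2_1_mk, D2_2_mk).

Lemma eq_mkD2 H (d1 d2 d1' d2' : hom H (D A)) (e : dval d1 * dval d2 = 0)
    (e' : dval d1' * dval d2' = 0) :
  d1 = d1' -> d2 = d2' -> mkD2 e = mkD2 e'.
Proof. by move=> e1 e2; apply: D2_ext; rewrite !D2_mkE. Qed.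

Lemma mkD2_comp G H (r : hom H G) (d1 d2 : hom G (D A)) (d1' d2' : hom H (D A))
    (e : dval d1 * dval d2 = 0) (e' : dval d1' * dval d2' = 0) :
  d1 ∘ r = d1' -> d2 ∘ r = d2' -> mkD2 e ∘ r = mkD2 e'.
Proof. by move=> e1 e2; apply: D2_ext; rewrite D2_comp !D2_mkE. Qed.

End KPoints.

Section KComplex.
Context {E : universe} (A : line E).
Implicit Types G H : E.

(** The vertices [Some false], [Some true] and [None] carry the coordinates d1, d2 and e of [K]. *)
Definition K_square : {set option bool} := [set Some false; Some true].
Definition K_facet (b : bool) := if b then K_square else [set None].
Definition K_complex := cover_complex true K_facet.
(** The subspace D(2) of the square, where the base and the graph of [K] meet. *)
Definition K_cross := cover_complex true (fun b : bool => [set Some b]).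

Lemma K_square_face (S : {set option bool}) : (S \subset K_square) = (None \notin S).
Proof.
apply/idP/idP => [/subsetP sS|nS].
  by apply/negP => /sS; rewrite !inE.
by apply/subsetP => -[[]|] inS; rewrite !inE //= inS in nS *.
Qed.

Lemma K_complex_face (S : {set option bool}) :
  (S \in faces K_complex) = (None \notin S) || (S == [set None]).
Proof.
rewrite cover_face -K_square_face; apply/existsP/orP => [[[] sS]|[]].
- by left.
- have [->|nS] := eqVneq S set0; [left|right].
    exact: sub0set.
  by rewrite eqEsubset sS sub1set; case/set0Pn: nS => t tS;
    have := subsetP sS _ tS; rewrite inE => /eqP <-.
- by exists true.
by move/eqP->; exists false.
Qed.

Lemma K_cross_face (S : {set option bool}) :
  (S \in faces K_cross) = (S \subset K_square) && (S != K_square).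
Proof.
rewrite cover_face; apply/existsP/andP => [[b sS]|[sS nS]].
  split.
    by apply: subset_trans sS _; case: b; rewrite sub1set !inE.
  apply/eqP => e; move: sS; rewrite e => /subsetP sS.
  have := sS (Some (~~ b)); rewrite !inE; case: b {sS} => /(_ isT) //.
have [t tQ ntS] : exists2 t, t \in K_square & t \notin S.
  by apply/subsetPn; apply: contra nS => sQS; rewrite eqEsubset sS.
case: t tQ ntS => [b _ ntS|]; last by rewrite !inE.
 exists (~~ b); apply/subsetP => t tS; rewrite inE.
have := subsetP sS _ tS; rewrite !inE.
by case: t tS b ntS => [[]|] tS [] //; rewrite tS.
Qed.

Lemma K_cross_sub : faces K_cross \subset faces (simplex K_square).
Proof. by apply/subsetP => S; rewrite K_cross_face simplex_face => /andP[]. Qed.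

Let sub_square : faces (simplex K_square) \subset faces K_complex.
Proof.
by apply/subsetP => S; rewrite simplex_face K_complex_face K_square_face => ->.
Qed.

Definition graph_pt H (x : hom H (Sp A (simplex K_square))) (t : option bool) :
    hom H (D A) :=
  if t is Some b then dco x (Some b)
  else dmul (dco x (Some false)) (dco x (Some true)).

Lemma mono_graph H (x : hom H (Sp A (simplex K_square))) (S : {set option bool}) :
  mono (graph_pt x) S =
  if None \notin S then mono (dco x) S
  else if S == [set None] then mono (dco x) K_square else 0.
Proof.
case: ifPn => [nS|/negPn nS].
  by apply: eq_bigr => -[b|] // inS; rewrite inS in nS.
case: eqP => [->|neS]; rewrite /mono.
  rewrite big_set1 /= dval_mul /K_square big_setU1 ?inE //= big_set1.
  by [].
have [b bS] : exists b, Some b \in S.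
  apply/existsP; apply: contra_notT neS; rewrite negb_exists => /forallP nb.
  apply/setP => -[b|]; rewrite !inE //; exact/negbTE.
rewrite (big_setD1 None) //= (big_setD1 (Some b)) ?inE //= dval_mul.
rewrite mulrA; suff -> : dval (dco x (Some false)) * dval (dco x (Some true)) *
  dval (dco x (Some b)) = 0 by rewrite mul0r.
by case: (b); [rewrite -mulrA dval_sq mulr0 | rewrite mulrAC dval_sq mul0r].
Qed.

Lemma graph_valid H (x : hom H (Sp A (simplex K_square))) :
  valid K_complex (graph_pt x).
Proof.
move=> S; rewrite K_complex_face negb_or mono_graph => /andP[/negPf-> /negPf->].
by [].
Qed.

Definition graph_inc : hom (Sp A (simplex K_square)) (Sp A K_complex) :=
  mkSp (graph_valid idm).

Lemma dco_graph H (x : hom H (Sp A (simplex K_square))) :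
  dco (graph_inc ∘ x) = graph_pt x.
Proof.
apply/funext => t; rewrite dco_comp dco_mkSp /graph_pt.
by case: t => [b|]; rewrite ?dmul_comp -!dco_comp comp_idl.
Qed.

Definition K_leg (b : bool) : hom (Sp A (simplex K_square)) (Sp A K_complex) :=
  if b then graph_inc else inc A sub_square.

(** Substituting e = d1 d2 adds the coefficient of e to that of d1 d2 and changes no other
    coefficient. *)
Lemma poly_eval_graph G (a : {set option bool} -> hom G A) H (r : hom H G)
    (x : hom H (Sp A (simplex K_square))) :
  poly_eval a r (graph_inc ∘ x) =
  poly_eval (fun S => if S == K_square then a S + a [set None] else a S) r x.
Proof.
rewrite /poly_eval dco_graph (bigD1 [set None]) ?K_complex_face ?eqxx ?orbT //=.
rewrite [RHS](bigD1 K_square) ?simplex_face //= eqxx.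
have nN : None \notin K_square by rewrite -K_square_face.
rewrite [X in _ + X](bigD1 K_square) /=; last first.
  rewrite K_complex_face nN /=; apply/eqP => /setP/(_ None).
  by rewrite (negPf nN) inE eqxx.
rewrite !mono_graph nN set11 eqxx /= comp_D mulrDl addrA.
congr (_ + _); first by rewrite addrC.
apply: eq_big => [S|S].
  rewrite K_complex_face simplex_face K_square_face; congr andb.
  have [nS|] := boolP (None \in S); last first.
    by move=> nS; rewrite orTb /=; apply/eqP => e; rewrite e inE eqxx in nS.
  by rewrite orFb andbN.
move=> /andP[/andP[inS nS] /negPf->]; rewrite mono_graph.
by move: inS; rewrite K_complex_face (negPf nS) orbF => ->.
Qed.

(** Agreement on D(2) identifies all coefficients of the two maps except those of d1 d2, and the
    difference of these two is the coefficient of e. *)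
Lemma has_glue_K :
  has_glue (s := fun _ : unit => true) (t := fun _ : unit => false)
    (fun=> inc A K_cross_sub) (fun=> inc A K_cross_sub) K_leg A.
Proof.
move=> G f fab.
have [c0 c0P] := poly_evalP (f false); have [c1 c1P] := poly_evalP (f true).
have cE (S : {set option bool}) : S \subset K_square -> S != K_square -> c1 S = c0 S.
  move=> sS nS; apply: (@poly_eval_inj _ _ _ K_cross) => [H r x|].
    have := fab tt H r x; rewrite c0P c1P.
    by rewrite !(poly_eval_sub _ _ K_cross_sub (dco_inc _ _)).
  by rewrite K_cross_face sS.
have nN (S : {set option bool}) : S \subset K_square -> (S == [set None]) = false.
  rewrite K_square_face => nS; apply/eqP => e.
  by rewrite e inE eqxx in nS.
pose c S := if S == [set None] then c1 K_square - c0 K_square else c0 S.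
exists (weil_eval (complex_weil A K_complex) ∘ tup (fun i => c (face i))).
split=> [[] H r x|u uP]; rewrite /K_leg.
- rewrite weil_eval_tup poly_eval_graph c1P; apply: eq_poly_eval => S.
  rewrite simplex_face /c => sS; rewrite nN // eqxx.
  have [->|nS] := eqVneq S K_square; first by rewrite addrC subrK.
  by rewrite cE.
- rewrite weil_eval_tup (poly_eval_sub _ _ sub_square (dco_inc _ _)) c0P.
  by apply: eq_poly_eval => S; rewrite simplex_face /c => sS; rewrite nN.
have [b bP] := poly_evalP u.
have b0 (S : {set option bool}) : S \subset K_square -> b S = c0 S.
  move=> sS; apply: (@poly_eval_inj _ _ _ (simplex K_square)) => [H r x|].
    rewrite -c0P -(uP false) bP /K_leg.
    by rewrite (poly_eval_sub _ _ sub_square (dco_inc _ _)).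
  by rewrite simplex_face.
have b1 : b K_square + b [set None] = c1 K_square.
  have := @poly_eval_inj _ _ _ (simplex K_square) _ (fun S =>
    if S == K_square then b S + b [set None] else b S) c1 _ K_square.
  rewrite eqxx simplex_face subxx; apply=> // H r x.
  by rewrite -poly_eval_graph -c1P -(uP true) bP.
apply: exp_ext => H r x; rewrite weil_eval_tup bP; apply: eq_poly_eval => S.
rewrite K_complex_face -K_square_face /c => /orP[sS|/eqP->].
  by rewrite nN // b0.
by rewrite eqxx -b1 b0 // addrC addKr.
Qed.

End KComplex.

Section KTransport.
Context {E : universe} (A : line E) (X : E) (mX : microlinear A X).
Implicit Types G H : E.

Lemma K_base_comp G H (d1 d2 : hom G (D A)) (r : hom H G) :
  K_base d1 d2 ∘ r = K_base (d1 ∘ r) (d2 ∘ r).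
Proof. by apply: K_ext; rewrite !K_comp !K_mkE // dzero_comp. Qed.

Lemma K_axis_comp G H (e : hom G (D A)) (r : hom H G) :
  K_axis e ∘ r = K_axis (e ∘ r).
Proof. by apply: K_ext; rewrite !K_comp !K_mkE // dzero_comp. Qed.

Definition K_pt H (z : hom H (K A)) (t : option bool) : hom H (D A) :=
  match t with
  | Some false => K_1 z
  | Some true => K_2 z
  | None => K_3 z
  end.

Lemma mono2 (T : finType) H (d : T -> hom H (D A)) (S : {set T}) s t :
  s \in S -> t \in S -> s != t -> dval (d s) * dval (d t) = 0 -> mono d S = 0.
Proof.
move=> sS tS nst e; rewrite /mono (big_setD1 s) //= (big_setD1 t) /=.
  by rewrite mulrA e mul0r.
by rewrite !inE eq_sym nst.
Qed.

Lemma K_pt_valid H (z : hom H (K A)) : valid K_complex (K_pt z).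
Proof.
move=> S; rewrite K_complex_face negb_or negbK => /andP[NS /eqP nS].
have [b bS] : exists b, Some b \in S.
  apply/existsP; apply: contra_notT nS; rewrite negb_exists => /forallP nb.
  by apply/setP => -[b|]; rewrite !inE //; apply/negbTE.
apply: (mono2 bS NS) => //; case: b bS => _; [exact: K_23|exact: K_13].
Qed.

(** [K] is defined by equations in D^3, whereas microlinearity speaks of spectra. Maps out of [K]
    are compared by pulling them back along [sp_to_K], of which this is a section. *)
Definition K_to_sp : hom (K A) (Sp A K_complex) := mkSp (K_pt_valid idm).

Lemma dco_K_to_sp H (z : hom H (K A)) : dco (K_to_sp ∘ z) = K_pt z.
Proof.
apply/funext => t; rewrite dco_comp dco_mkSp.
by case: t => [[]|] /=; rewrite -!K_comp comp_idl.
Qed.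

Lemma K_complex_dval H (x : hom H (Sp A K_complex)) b :
  dval (dco x (Some b)) * dval (dco x None) = 0.
Proof.
have := dco_valid x (S := [set Some b; None]).
rewrite K_complex_face !inE eqxx orbT /mono big_setU1 ?inE //= big_set1.
apply; apply/eqP => /setP/(_ (Some b)).
by rewrite !inE eqxx.
Qed.

Definition sp_to_K H (x : hom H (Sp A K_complex)) : hom H (K A) :=
  mkK (K_complex_dval x false) (K_complex_dval x true).

Lemma sp_to_K_comp G H (x : hom G (Sp A K_complex)) (r : hom H G) :
  sp_to_K x ∘ r = sp_to_K (x ∘ r).
Proof. by apply: K_ext; rewrite !K_comp !K_mkE dco_comp. Qed.

Lemma K_to_spK H (z : hom H (K A)) : sp_to_K (K_to_sp ∘ z) = z.
Proof. by apply: K_ext; rewrite K_mkE dco_K_to_sp. Qed.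

Lemma square_dco_None H (x : hom H (Sp A (simplex K_square))) : dco x None = dzero.
Proof. by rewrite dco_simplex /restr -[_ \in _]negbK -K_square_face subxx. Qed.

Lemma sp_to_K_base H (x : hom H (Sp A K_complex)) : dco x None = dzero ->
  sp_to_K x = K_base (dco x (Some false)) (dco x (Some true)).
Proof. by move=> e; apply: K_ext; rewrite !K_mkE. Qed.

Lemma dco_leg_base H (x : hom H (Sp A (simplex K_square))) :
  dco (K_leg A false ∘ x) = dco x.
Proof. exact: dco_inc. Qed.

Lemma sp_to_K_leg_base H (x : hom H (Sp A (simplex K_square))) :
  sp_to_K (K_leg A false ∘ x) = K_base (dco x (Some false)) (dco x (Some true)).
Proof. by rewrite sp_to_K_base dco_leg_base // square_dco_None. Qed.

Lemma sp_to_K_leg_graph H (x : hom H (Sp A (simplex K_square))) :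
  sp_to_K (K_leg A true ∘ x) = K_graph (dco x (Some false)) (dco x (Some true)).
Proof. by apply: K_ext; rewrite !K_mkE dco_graph. Qed.

Definition square_pt H (d1 d2 : hom H (D A)) (t : option bool) : hom H (D A) :=
  match t with
  | Some false => d1
  | Some true => d2
  | None => dzero
  end.

Lemma square_pt_valid H (d1 d2 : hom H (D A)) :
  valid (simplex K_square) (square_pt d1 d2).
Proof.
move=> S; rewrite simplex_face K_square_face negbK => NS.
by rewrite /mono (big_setD1 None) //= dval0 mul0r.
Qed.

Lemma cross_dval H (x : hom H (Sp A K_cross)) :
  dval (dco x (Some false)) * dval (dco x (Some true)) = 0.
Proof.
have := dco_valid x (S := K_square); rewrite K_cross_face eqxx andbF.
by rewrite /mono big_setU1 ?inE //= big_set1 => ->.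
Qed.

Lemma cross_None H (x : hom H (Sp A K_cross)) : dco x None = dzero.
Proof.
apply: D_ext; rewrite dval0; have := dco_valid x (S := [set None]).
by rewrite K_cross_face K_square_face set11 /mono big_set1 => ->.
Qed.

Let glueK : has_glue (s := fun _ : unit => true) (t := fun _ : unit => false)
  (fun=> inc A (K_cross_sub)) (fun=> inc A K_cross_sub) (K_leg A) X.
Proof.
apply: (span_glue _ (@has_glue_K E A) mX) => _; apply: sp_ext => t.
rewrite dco_graph dco_leg_base /graph_pt !dco_mkSp; case: t => // .
by rewrite cross_None; apply: D_ext; rewrite dval_mul cross_dval dval0.
Qed.

Lemma K_glue G (g1 g2 : hom G (D A ⊗ D A ⇒ X)) :
  (forall H (r : hom H G) (d1 d2 : hom H (D A)), dval d1 * dval d2 = 0 ->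
    app (g1 ∘ r) ⟨d1, d2⟩ = app (g2 ∘ r) ⟨d1, d2⟩) ->
  exists k : hom G (K A ⇒ X), forall H (r : hom H G) (d1 d2 : hom H (D A)),
    app (k ∘ r) (K_base d1 d2) = app (g2 ∘ r) ⟨d1, d2⟩ /\
    app (k ∘ r) (K_graph d1 d2) = app (g1 ∘ r) ⟨d1, d2⟩.
Proof.
move=> g12; pose f (b : bool) H (r : hom H G) (x : hom H (Sp A (simplex K_square))) :=
  app ((if b then g1 else g2) ∘ r) ⟨dco x (Some false), dco x (Some true)⟩.
have nf b : natural (f b).
  by move=> H K r x s; rewrite /f app_comp compA pair_comp -!dco_comp.
have [|u [uP _]] := @glueK G (fun b => lamN (f b)).
  move=> _ H r x; rewrite !(app_lamN (nf _)) /f !dco_inc.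
  by apply: g12; apply: cross_dval.
exists (precomp K_to_sp u) => H r d1 d2; rewrite !precompE.
pose x := mkSp (square_pt_valid d1 d2).
have -> : K_to_sp ∘ K_base d1 d2 = K_leg A false ∘ x.
  apply: sp_ext => t; rewrite dco_K_to_sp dco_leg_base dco_mkSp.
  by case: t => [[]|] /=; rewrite K_mkE.
have -> : K_to_sp ∘ K_graph d1 d2 = K_leg A true ∘ x.
  apply: sp_ext => t; rewrite dco_K_to_sp dco_graph /graph_pt dco_mkSp.
  by case: t => [[]|] /=; rewrite K_mkE.
by rewrite !uP !(app_lamN (nf _)) /f !dco_mkSp.
Qed.

Lemma K_uniq G (F F' : forall H, hom H G -> hom H (K A) -> hom H X) :
  natural F -> natural F' ->
  (forall H (r : hom H G) d1 d2, F H r (K_base d1 d2) = F' H r (K_base d1 d2)) ->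
  (forall H (r : hom H G) d1 d2, F H r (K_graph d1 d2) = F' H r (K_graph d1 d2)) ->
  forall H r z, F H r z = F' H r z.
Proof.
move=> nF nF' eb eg H r z.
pose lift (F0 : forall H, hom H G -> hom H (K A) -> hom H X) :=
  lamN (fun H (r : hom H G) x => F0 H r (sp_to_K x)).
have nat_lift F0 : natural F0 ->
    natural (fun H (r : hom H G) x => F0 H r (sp_to_K x)).
  by move=> n0 H0 K0 r0 x s; rewrite n0 sp_to_K_comp.
have [|u [_ uU]] := @glueK G (fun b => lamN (fun H (r : hom H G) x =>
    F H r (sp_to_K (K_leg A b ∘ x)))).
  (* Over D(2) the base and the graph are the same points of [K], as d1 d2 = 0; hence the two
     restrictions of [F] are compatible. *)
  move=> _ H0 r0 x; rewrite !app_lamN.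
  - congr F; rewrite sp_to_K_leg_base sp_to_K_leg_graph.
    apply: K_ext; rewrite !K_mkE //.
    by apply: D_ext; rewrite dval_mul dval0 !dco_inc cross_dval.
  - by move=> H1 K1 r1 y s; rewrite nF sp_to_K_comp compA.
  - by move=> H1 K1 r1 y s; rewrite nF sp_to_K_comp compA.
have nb b : natural (fun H (r : hom H G) x => F H r (sp_to_K (K_leg A b ∘ x))).
  by move=> H1 K1 r1 y s; rewrite nF sp_to_K_comp compA.
have uF : u = lift F.
  by apply: uU => b H0 r0 x; rewrite (app_lamN (nat_lift _ _ nF)) (app_lamN (nb b)).
have uF' : u = lift F'.
  apply: uU => b H0 r0 x; rewrite (app_lamN (nat_lift _ _ nF')) (app_lamN (nb b)).
  by case: b; rewrite ?sp_to_K_leg_base ?sp_to_K_leg_graph ?eb ?eg.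
have := congr1 (fun v => app (v ∘ r) (K_to_sp ∘ z)) (etrans (esym uF) uF').
by rewrite (app_lamN (nat_lift _ _ nF)) (app_lamN (nat_lift _ _ nF')) K_to_spK.
Qed.

(** Base and axis are the two facets of [K_complex], so uniqueness on a cover applies; the graph in
    [K_uniq] is not a facet and needs its own gluing. *)
Lemma K_uniq_axis G (F F' : forall H, hom H G -> hom H (K A) -> hom H X) :
  natural F -> natural F' ->
  (forall H (r : hom H G) d1 d2, F H r (K_base d1 d2) = F' H r (K_base d1 d2)) ->
  (forall H (r : hom H G) e, F H r (K_axis e) = F' H r (K_axis e)) ->
  forall H r z, F H r z = F' H r z.
Proof.
move=> nF nF' eb ea H r z.
pose lift (F0 : forall H, hom H G -> hom H (K A) -> hom H X) :=
  lamN (fun H (r : hom H G) x => F0 H r (sp_to_K x)).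
have nat_lift F0 : natural F0 ->
    natural (fun H (r : hom H G) x => F0 H r (sp_to_K x)).
  by move=> n0 H0 K0 r0 x s; rewrite n0 sp_to_K_comp.
have: lift F = lift F'.
  apply: (cover_uniq mX) => b H0 r0 x.
  rewrite (app_lamN (nat_lift _ _ nF)) (app_lamN (nat_lift _ _ nF')).
  case: b => e.
    rewrite sp_to_K_base ?eb // e /restr /K_facet.
    by rewrite -[_ \in _]negbK -K_square_face subxx.
  have -> // : sp_to_K x = K_axis (dco x None).
  by apply: K_ext; rewrite !K_mkE // e /restr /K_facet inE.
move/(congr1 (fun v => app (v ∘ r) (K_to_sp ∘ z))).
by rewrite (app_lamN (nat_lift _ _ nF)) (app_lamN (nat_lift _ _ nF')) K_to_spK.
Qed.

End KTransport.

Section KFlip.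
Context {E : universe} {A : ring_object E}.
Implicit Types G H : E.

Lemma K_flip_sq H (z : hom H (K A)) :
  (dval (K_1 z) * dval (K_2 z) - dval (K_3 z)) *
  (dval (K_1 z) * dval (K_2 z) - dval (K_3 z)) = 0.
Proof.
have e1 := dval_sq (K_1 z); have e3 := dval_sq (K_3 z); have e13 := K_13 z.
ring: e1 e3 e13.
Qed.

Lemma K_flip_1 H (z : hom H (K A)) : dval (K_1 z) * dval (mkD (K_flip_sq z)) = 0.
Proof.
rewrite dval_mkD; have e1 := dval_sq (K_1 z); have e13 := K_13 z.
ring: e1 e13.
Qed.

Lemma K_flip_2 H (z : hom H (K A)) : dval (K_2 z) * dval (mkD (K_flip_sq z)) = 0.
Proof.
rewrite dval_mkD; have e1 := dval_sq (K_2 z); have e13 := K_23 z.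
ring: e1 e13.
Qed.

(** The involution e -> d1 d2 - e exchanges base and graph and reverses the axis. It turns
    uniqueness from base and axis into uniqueness from graph and axis. *)
Definition K_flip H (z : hom H (K A)) : hom H (K A) := mkK (K_flip_1 z) (K_flip_2 z).

Lemma K_flip_comp G H (z : hom G (K A)) (r : hom H G) :
  K_flip z ∘ r = K_flip (z ∘ r).
Proof.
apply: K_ext; rewrite !K_comp !K_mkE ?K_comp //.
by apply: D_ext; rewrite dval_comp !dval_mkD comp_D comp_N comp_M !K_comp -!dval_comp.
Qed.

Lemma K_flipK H (z : hom H (K A)) : K_flip (K_flip z) = z.
Proof.
apply: K_ext; rewrite !K_mkE //; apply: D_ext.
by rewrite dval_mkD !K_mkE dval_mkD opprB addrC subrK.
Qed.

Lemma K_flip_base H (d1 d2 : hom H (D A)) : K_flip (K_base d1 d2) = K_graph d1 d2.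
Proof.
apply: K_ext; rewrite !K_mkE //; apply: D_ext.
by rewrite dval_mkD !K_mkE dval0 subr0 dval_mul.
Qed.

Lemma K_flip_axis H (e : hom H (D A)) : K_flip (K_axis e) = K_axis (dscale (-1) e).
Proof.
apply: K_ext; rewrite !K_mkE //; apply: D_ext.
by rewrite dval_mkD !K_mkE dval0 mul0r sub0r dval_scale mulN1r.
Qed.

End KFlip.

Lemma the_eq (T : Type) (dflt : T) (P : T -> Prop) x :
  P x -> (forall y, P y -> y = x) -> the dflt P = x.
Proof.
move=> Px uP; rewrite /the; case: pselect => [ex|[]]; last by exists x.
by case: (cid ex) => y /= /uP.
Qed.

(** * Characterization of strong differences and of sums of tangent vectors *)

Section Specs.
Context {E : universe} (A : line E) (X : E) (mX : microlinear A X).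
Implicit Types G H : E.

Lemma K_uniq_graph_axis G (F F' : forall H, hom H G -> hom H (K A) -> hom H X) :
  natural F -> natural F' ->
  (forall H (r : hom H G) d1 d2, F H r (K_graph d1 d2) = F' H r (K_graph d1 d2)) ->
  (forall H (r : hom H G) e, F H r (K_axis e) = F' H r (K_axis e)) ->
  forall H r z, F H r z = F' H r z.
Proof.
move=> nF nF' eg ea H r z; rewrite -(K_flipK z).
have nf F0 : natural F0 ->
    natural (fun H (r : hom H G) (z : hom H (K A)) => F0 H r (K_flip z)).
  by move=> n0 H0 K0 r0 x s; rewrite n0 K_flip_comp.
apply: (K_uniq_axis mX (nf _ _ nF) (nf _ _ nF')) => [H0 r0 d1 d2|H0 r0 e].
  by rewrite K_flip_base eg.
by rewrite K_flip_axis ea.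
Qed.

(** [K_uniq] leaves only one map with the property required in [sdiff_ext], so any such [k] computes
    the strong difference. *)
Lemma sdiff_spec G (g1 g2 : hom G (D A ⊗ D A ⇒ X)) (k : hom G (K A ⇒ X)) :
  (forall H (r : hom H G) (d1 d2 : hom H (D A)),
    app (k ∘ r) (K_base d1 d2) = app (g2 ∘ r) ⟨d1, d2⟩ /\
    app (k ∘ r) (K_graph d1 d2) = app (g1 ∘ r) ⟨d1, d2⟩) ->
  forall H (r : hom H G) e, app (sdiff g1 g2 ∘ r) e = app (k ∘ r) (K_axis e).
Proof.
move=> kP H r e; rewrite /sdiff app_lam_comp app_comp -compA pi1_pair.
rewrite K_axis_comp pi2_pair; congr (app (_ ∘ r) _); apply: the_eq => // k' k'P.
apply: exp_ext => H0 r0 z.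
apply: (K_uniq mX (F := fun H r z => app (k' ∘ r) z)
  (F' := fun H r z => app (k ∘ r) z)); try exact: natural_app.
  by move=> H1 r1 d1 d2; rewrite (proj1 (k'P _ _ _ _)) (proj1 (kP _ _ _ _)).
by move=> H1 r1 d1 d2; rewrite (proj2 (k'P _ _ _ _)) (proj2 (kP _ _ _ _)).
Qed.

Definition axes_complex := cover_complex true (fun b : bool => [set b]).

Definition D2_pt H (z : hom H (D2 A)) (b : bool) : hom H (D A) :=
  if b then D2_1 z else D2_2 z.

Lemma axes_face (S : {set bool}) :
  (S \in faces axes_complex) = ~~ ((true \in S) && (false \in S)).
Proof.
rewrite cover_face negb_and; apply/existsP/orP => [[b /subsetP sS]|nS].
  by case: b sS => sS; [right|left]; apply/negP => /sS; rewrite inE.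
case: nS => nS; [exists false|exists true]; apply/subsetP => b; rewrite inE;
  by case: b => // bS; rewrite bS in nS.
Qed.

Lemma D2_pt_valid H (z : hom H (D2 A)) : valid axes_complex (D2_pt z).
Proof.
move=> S; rewrite axes_face negbK => /andP[tS fS].
by apply: (mono2 tS fS) => //; apply: D2_12.
Qed.

Lemma D2_glue G (t1 t2 : hom G (D A ⇒ X)) : app t1 dzero = app t2 dzero ->
  exists l : hom G (D2 A ⇒ X), forall H (r : hom H G) (d : hom H (D A)),
    app (l ∘ r) (mkD2 (dval_d0 d)) = app (t1 ∘ r) d /\
    app (l ∘ r) (mkD2 (dval_0d d)) = app (t2 ∘ r) d.
Proof.
move=> t12.
pose f (b : bool) H (r : hom H G) (d : bool -> hom H (D A)) :=
  app ((if b then t1 else t2) ∘ r) (d b).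
have [b H K r d s||u uP] := @cover_glue E A _ _ true (fun b : bool => [set b]) X
    mX G f.
- by rewrite /f app_comp compA.
- move=> b b' H r d; rewrite /f; have [->//|nb] := eqVneq b b'.
  have e c : restr ([set b] :&: [set b']) d c = dzero.
    by rewrite /restr !inE; case: eqP => [->|//]; rewrite (negPf nb).
  (* The hypothesis concerns the base points at stage [G]; writing zero as a restriction along [r]
     brings it to stage [H]. *)
  rewrite !e; have z0 : dzero = dzero ∘ r :> hom H (D A) by rewrite dzero_comp.
  rewrite [dzero]z0 -!app_comp; case: b b' nb {e} => [] [] // _.
    by rewrite t12.
  by rewrite t12.
pose l := lamN (fun H (r : hom H G) z => app (u ∘ r) (mkSp (D2_pt_valid z))).
have nl : natural (fun H (r : hom H G) z => app (u ∘ r) (mkSp (D2_pt_valid z))).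
  move=> H K r z s; rewrite app_comp compA mkSp_comp; congr app.
  by apply: sp_ext => t; rewrite !dco_mkSp /D2_pt; case: t; rewrite D2_comp.
exists l => H r d; rewrite !app_lamN //; split.
  rewrite (uP true H r _ (fun=> d)).
    by rewrite /f /restr set11.
  rewrite dco_mkSp; apply/funext => -[]; rewrite /D2_pt /restr inE /=.
    by rewrite D2_1_mk.
  by rewrite D2_2_mk.
rewrite (uP false H r _ (fun=> d)).
  by rewrite /f /restr set11.
rewrite dco_mkSp; apply/funext => -[]; rewrite /D2_pt /restr inE /=.
  by rewrite D2_1_mk.
by rewrite D2_2_mk.
Qed.

Lemma axes_dval H (x : hom H (Sp A axes_complex)) :
  dval (dco x true) * dval (dco x false) = 0.
Proof.
have := dco_valid x (S := [set true; false]).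
by rewrite axes_face !inE /mono big_setU1 ?inE //= big_set1 => ->.
Qed.

Lemma D2_uniq G (F F' : forall H, hom H G -> hom H (D2 A) -> hom H X) :
  natural F -> natural F' ->
  (forall H (r : hom H G) d, F H r (mkD2 (dval_d0 d)) = F' H r (mkD2 (dval_d0 d))) ->
  (forall H (r : hom H G) d, F H r (mkD2 (dval_0d d)) = F' H r (mkD2 (dval_0d d))) ->
  forall H r z, F H r z = F' H r z.
Proof.
move=> nF nF' e1 e2 H r z.
pose lift (F0 : forall H, hom H G -> hom H (D2 A) -> hom H X) :=
  lamN (fun H (r : hom H G) x => F0 H r (mkD2 (axes_dval x))).
have nat_lift F0 : natural F0 ->
    natural (fun H (r : hom H G) x => F0 H r (mkD2 (axes_dval x))).
  move=> n0 H0 K0 r0 x s; rewrite n0; congr F0.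
  by apply: D2_ext; rewrite D2_comp ?D2_1_mk ?D2_2_mk dco_comp.
have: lift F = lift F'.
  apply: (cover_uniq mX) => b H0 r0 x.
  rewrite (app_lamN (nat_lift _ _ nF)) (app_lamN (nat_lift _ _ nF')).
  case: b => e.
    have -> // : mkD2 (axes_dval x) = mkD2 (dval_d0 (dco x true)).
    by apply: D2_ext; rewrite ?D2_1_mk ?D2_2_mk // e /restr inE.
  have -> // : mkD2 (axes_dval x) = mkD2 (dval_0d (dco x false)).
  by apply: D2_ext; rewrite ?D2_1_mk ?D2_2_mk // e /restr inE.
move/(congr1 (fun v => app (v ∘ r) (mkSp (D2_pt_valid z)))).
rewrite (app_lamN (nat_lift _ _ nF)) (app_lamN (nat_lift _ _ nF')).
have -> // : mkD2 (axes_dval (mkSp (D2_pt_valid z))) = z.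
by apply: D2_ext; rewrite ?D2_1_mk ?D2_2_mk dco_mkSp.
Qed.

Lemma tadd_spec G (t1 t2 : hom G (D A ⇒ X)) (l : hom G (D2 A ⇒ X)) :
  (forall H (r : hom H G) (d : hom H (D A)),
    app (l ∘ r) (mkD2 (dval_d0 d)) = app (t1 ∘ r) d /\
    app (l ∘ r) (mkD2 (dval_0d d)) = app (t2 ∘ r) d) ->
  forall H (r : hom H G) d,
    app (tadd t1 t2 ∘ r) d = app (l ∘ r) (mkD2 (dval_sq d)).
Proof.
move=> lP H r d; rewrite /tadd app_lam_comp app_comp -compA pi1_pair.
have -> : mkD2 (dval_sq pi2) ∘ ⟨r, d⟩ = mkD2 (dval_sq d).
  by apply: D2_ext; rewrite D2_comp ?D2_1_mk ?D2_2_mk pi2_pair.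
congr (app (_ ∘ r) _); apply: the_eq => // l' l'P.
apply: exp_ext => H0 r0 z.
apply: (D2_uniq (F := fun H r z => app (l' ∘ r) z)
  (F' := fun H r z => app (l ∘ r) z)); try exact: natural_app.
  by move=> H1 r1 e; rewrite (proj1 (l'P _ _ _)) (proj1 (lP _ _ _)).
by move=> H1 r1 e; rewrite (proj2 (l'P _ _ _)) (proj2 (lP _ _ _)).
Qed.

End Specs.

(** * Tangent modules *)

Section TangentAddition.
Context {E : universe} (A : line E) (X : E) (mX : microlinear A X).
Implicit Types G H : E.

(** Any natural family on D(2) extending both vectors computes the sum, so the laws below only need
    an explicit formula for one. *)
Lemma taddE G (t1 t2 : hom G (D A ⇒ X))
    (l : forall H, hom H G -> hom H (D2 A) -> hom H X) :
  natural l ->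
  (forall H (r : hom H G) d, l H r (mkD2 (dval_d0 d)) = app (t1 ∘ r) d) ->
  (forall H (r : hom H G) d, l H r (mkD2 (dval_0d d)) = app (t2 ∘ r) d) ->
  forall H (r : hom H G) d,
    app (tadd t1 t2 ∘ r) d = l H r (mkD2 (dval_sq d)).
Proof.
move=> nl l1 l2 H r d; rewrite -(app_lamN nl); apply: (tadd_spec mX) => H0 r0 d0.
by rewrite !(app_lamN nl).
Qed.

Lemma tzeroE G (x : hom G X) H (r : hom H G) d : app (@tzero E A G X x ∘ r) d = x ∘ r.
Proof. by rewrite app_lam_comp -compA pi1_pair. Qed.

Lemma tscaleE G (a : hom G A) (t : hom G (D A ⇒ X)) H (r : hom H G) d :
  app (tscale a t ∘ r) d = app (t ∘ r) (dscale (a ∘ r) d).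
Proof.
by rewrite app_lam_comp app_comp dscale_comp -!compA pi1_pair pi2_pair.
Qed.

Lemma D2_lin_sq H (a b : hom H A) (z : hom H (D2 A)) :
  (a * dval (D2_1 z) + b * dval (D2_2 z)) *
  (a * dval (D2_1 z) + b * dval (D2_2 z)) = 0.
Proof.
have e1 := dval_sq (D2_1 z); have e2 := dval_sq (D2_2 z); have e12 := D2_12 z.
ring: e1 e2 e12.
Qed.

Definition D2_lin H (a b : hom H A) (z : hom H (D2 A)) : hom H (D A) :=
  mkD (D2_lin_sq a b z).

Lemma D2_lin_comp G H (a b : hom G A) (z : hom G (D2 A)) (r : hom H G) :
  D2_lin a b z ∘ r = D2_lin (a ∘ r) (b ∘ r) (z ∘ r).
Proof.
apply: D_ext; rewrite dval_comp !dval_mkD comp_D !comp_M.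
by rewrite !D2_comp -!dval_comp.
Qed.

Lemma dval_lin H (a b : hom H A) (z : hom H (D2 A)) :
  dval (D2_lin a b z) = a * dval (D2_1 z) + b * dval (D2_2 z).
Proof. exact: dval_mkD. Qed.

Lemma D2_scale_zero H (a : hom H A) (z : hom H (D2 A)) :
  dval (dscale a (D2_1 z)) * dval (dscale a (D2_2 z)) = 0.
Proof. by rewrite !dval_scale mulrACA D2_12 mulr0. Qed.

Variable G : E.
Implicit Types t : hom G (D A ⇒ X).

Lemma tan_ext t t' :
  (forall H (r : hom H G) d, app (t ∘ r) d = app (t' ∘ r) d) -> t = t'.
Proof. exact: exp_ext. Qed.

Lemma tan_based t x H (r : hom H G) :
  app t dzero = x -> app (t ∘ r) dzero = x ∘ r.
Proof. by move=> <-; rewrite app_comp dzero_comp. Qed.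

Lemma mkD2_00 H : mkD2 (dval_sq (dzero : hom H (D A))) = mkD2 (dval_d0 dzero).
Proof. by apply: D2_ext; rewrite ?D2_mkE. Qed.

Lemma tadd_based t1 t2 x :
  app t1 dzero = x -> app t2 dzero = x -> app (tadd t1 t2) dzero = x.
Proof.
move=> e1 e2; have [l lP] := D2_glue mX (etrans e1 (esym e2)).
rewrite -[tadd _ _]comp_idr (tadd_spec mX lP) mkD2_00 (proj1 (lP _ _ _)).
by rewrite comp_idr.
Qed.

Lemma tzero_based x : app (@tzero E A G X x) dzero = x.
Proof. by rewrite -[tzero x]comp_idr tzeroE comp_idr. Qed.

Lemma tscale_based a t x : app t dzero = x -> app (tscale a t) dzero = x.
Proof.
move=> e; rewrite -[tscale a t]comp_idr tscaleE !comp_idr -[RHS]e; congr app.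
by apply: D_ext; rewrite dval_scale dval0 mulr0.
Qed.

Lemma taddC t1 t2 : app t1 dzero = app t2 dzero -> tadd t1 t2 = tadd t2 t1.
Proof.
move=> e; have [l lP] := D2_glue mX e.
have sw H (z : hom H (D2 A)) : dval (D2_2 z) * dval (D2_1 z) = 0.
  by rewrite mulrC D2_12.
apply: tan_ext => H r d; rewrite (tadd_spec mX lP).
rewrite (taddE (l := fun H r z => app (l ∘ r) (mkD2 (sw H z)))).
- by congr app; apply: eq_mkD2; rewrite ?D2_mkE.
- move=> H0 K0 r0 z s; rewrite app_comp compA; congr app.
  by apply: mkD2_comp; rewrite D2_comp.
- move=> H0 r0 d0; rewrite -(proj2 (lP _ _ _)); congr app.
  by apply: eq_mkD2; rewrite ?D2_mkE.
- move=> H0 r0 d0; rewrite -(proj1 (lP _ _ _)); congr app.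
  by apply: eq_mkD2; rewrite ?D2_mkE.
Qed.

Lemma tadd0 x t : app t dzero = x -> tadd (tzero x) t = t.
Proof.
move=> e; apply: tan_ext => H r d.
rewrite (taddE (l := fun H r z => app (t ∘ r) (D2_2 z))) ?D2_2_mk //.
- by move=> H0 K0 r0 z s; rewrite app_comp compA D2_comp.
- by move=> H0 r0 d0; rewrite D2_2_mk tzeroE; apply: tan_based.
- by move=> H0 r0 d0; rewrite D2_2_mk.
Qed.

Lemma tscaleDl (a b : hom G A) t :
  tadd (tscale a t) (tscale b t) = tscale (a + b) t.
Proof.
apply: tan_ext => H r d.
rewrite (taddE (l := fun H r z => app (t ∘ r) (D2_lin (a ∘ r) (b ∘ r) z))).
- rewrite tscaleE; congr app; apply: D_ext.
  by rewrite dval_lin !D2_mkE dval_scale comp_D mulrDl.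
- by move=> H0 K0 r0 z s; rewrite app_comp D2_lin_comp !compA.
- move=> H0 r0 d0; rewrite tscaleE; congr app; apply: D_ext.
  by rewrite dval_lin !D2_mkE dval_scale dval0 mulr0 addr0.
- move=> H0 r0 d0; rewrite tscaleE; congr app; apply: D_ext.
  by rewrite dval_lin !D2_mkE dval_scale dval0 mulr0 add0r.
Qed.

Lemma tscaleDr (a : hom G A) t1 t2 : app t1 dzero = app t2 dzero ->
  tscale a (tadd t1 t2) = tadd (tscale a t1) (tscale a t2).
Proof.
move=> e; have [l lP] := D2_glue mX e; apply: tan_ext => H r d.
rewrite tscaleE (tadd_spec mX lP).
rewrite (taddE (l := fun H r z => app (l ∘ r) (mkD2 (D2_scale_zero (a ∘ r) z)))).
- by congr app; apply: eq_mkD2; rewrite ?D2_mkE.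
- move=> H0 K0 r0 z s; rewrite app_comp compA; congr app.
  by apply: mkD2_comp; rewrite dscale_comp D2_comp compA.
- move=> H0 r0 d0; rewrite tscaleE -(proj1 (lP _ _ _)); congr app.
  apply: eq_mkD2; rewrite ?D2_mkE //.
  by apply: D_ext; rewrite dval_scale dval0 mulr0.
- move=> H0 r0 d0; rewrite tscaleE -(proj2 (lP _ _ _)); congr app.
  apply: eq_mkD2; rewrite ?D2_mkE //.
  by apply: D_ext; rewrite dval_scale dval0 mulr0.
Qed.

Lemma tscaleA (a b : hom G A) t : tscale a (tscale b t) = tscale (a * b) t.
Proof.
apply: tan_ext => H r d; rewrite !tscaleE; congr app; apply: D_ext.
by rewrite !dval_scale comp_M mulrCA mulrA.
Qed.

Lemma tscale1 t : tscale 1 t = t.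
Proof.
apply: tan_ext => H r d; rewrite tscaleE; congr app; apply: D_ext.
by rewrite dval_scale comp_1 mul1r.
Qed.

Lemma tscale0 t x : app t dzero = x -> tscale 0 t = tzero x.
Proof.
move=> e; apply: tan_ext => H r d; rewrite tscaleE tzeroE -(tan_based _ e).
by congr app; apply: D_ext; rewrite dval_scale comp_0 mul0r dval0.
Qed.

(* Both sides are the diagonal of a common extension of t1, t2, t3 to D(3). *)
Lemma taddA t1 t2 t3 : app t1 dzero = app t2 dzero -> app t2 dzero = app t3 dzero ->
  tadd t1 (tadd t2 t3) = tadd (tadd t1 t2) t3.
Proof.
move=> e12 e23.
pose ts (c : option bool) := match c with
  | None => t1 | Some true => t2 | Some false => t3 end.
pose C := cover_complex None (fun c : option bool => [set c]).
pose f c H (r : hom H G) (d : option bool -> hom H (D A)) := app (ts c ∘ r) (d c).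
have ts0 c : app (ts c) dzero = app t1 dzero.
  by case: c => [[]|] //=; rewrite e12 // -e23.
have [c H K r d s||u uP] := @cover_glue E A _ _ None (fun c => [set c]) X mX G f.
- by rewrite /f app_comp compA.
- move=> b b' H r d; rewrite /f; have [->//|nb] := eqVneq b b'.
  have e c : restr ([set b] :&: [set b']) d c = dzero.
    by rewrite /restr !inE; case: eqP => [->|//]; rewrite (negPf nb).
  by rewrite !e !(tan_based _ (ts0 _)).
pose pt3 H (d1 d2 d3 : hom H (D A)) c :=
  match c with None => d1 | Some true => d2 | Some false => d3 end.
have pt3_valid H (d1 d2 d3 : hom H (D A)) : dval d1 * dval d2 = 0 ->
    dval d1 * dval d3 = 0 -> dval d2 * dval d3 = 0 -> valid C (pt3 H d1 d2 d3).
  move=> z12 z13 z23 S; rewrite cover_face => /existsPn nS.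
  have [s sS] : exists s, s \in S.
    by have /subsetPn[s] := nS None; exists s.
  have /subsetPn[t tS] := nS s; rewrite inE => nts.
  apply: (mono2 tS sS nts); rewrite /pt3.
  by case: t s nts {sS tS} => [[]|] [[]|] //= _; rewrite mulrC.
have zz H (z : hom H (D2 A)) a b : D2_1 z = a -> D2_2 z = b -> dval a * dval b = 0.
  by move=> <- <-; apply: D2_12.
(* [m] takes the three vanishing products as arguments; [m_eq] and [m_nat] make the choice of their
   proofs immaterial. *)
pose m H (r : hom H G) d1 d2 d3 z12 z13 z23 :=
  app (u ∘ r) (mkSp (pt3_valid H d1 d2 d3 z12 z13 z23)).
have m_eq H r d1 d2 d3 z12 z13 z23 d1' d2' d3' z12' z13' z23' :
    d1 = d1' -> d2 = d2' -> d3 = d3' ->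
    m H r d1 d2 d3 z12 z13 z23 = m H r d1' d2' d3' z12' z13' z23'.
  move=> e1 e2 e3; rewrite /m; congr app; apply: sp_ext => t.
  by rewrite !dco_mkSp e1 e2 e3.
have m_nat H K (s : hom K H) r d1 d2 d3 z12 z13 z23 d1' d2' d3' z12' z13' z23' :
    d1 ∘ s = d1' -> d2 ∘ s = d2' -> d3 ∘ s = d3' ->
    m H r d1 d2 d3 z12 z13 z23 ∘ s = m K (r ∘ s) d1' d2' d3' z12' z13' z23'.
  move=> e1 e2 e3; rewrite /m app_comp compA; congr app; apply: sp_ext => t.
  by rewrite dco_comp !dco_mkSp; case: t => [[]|].
have m_ax c H r d1 d2 d3 z12 z13 z23 (e : hom H (D A)) :
    pt3 H d1 d2 d3 = restr [set c] (fun=> e) ->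
    m H r d1 d2 d3 z12 z13 z23 = app (ts c ∘ r) e.
  move=> pe; rewrite /m (uP c H r _ (fun=> e)); last by rewrite dco_mkSp.
  by rewrite /f /restr set11.
have sq H (d : hom H (D A)) := dval_sq d.
have d0 H (d : hom H (D A)) := dval_d0 d.
have od H (d : hom H (D A)) := dval_0d d.
have ax1 H r (d : hom H (D A)) : m H r d dzero dzero (d0 H d) (d0 H d) (d0 H dzero)
    = app (t1 ∘ r) d.
  by apply: (m_ax None); apply/funext => -[[]|]; rewrite /restr inE.
have ax2 H r (d : hom H (D A)) : m H r dzero d dzero (od H d) (od H dzero) (d0 H d)
    = app (t2 ∘ r) d.
  by apply: (m_ax (Some true)); apply/funext => -[[]|]; rewrite /restr inE.
have ax3 H r (d : hom H (D A)) : m H r dzero dzero d (od H dzero) (od H d) (od H d)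
    = app (t3 ∘ r) d.
  by apply: (m_ax (Some false)); apply/funext => -[[]|]; rewrite /restr inE.
have add23 H r (d : hom H (D A)) : app (tadd t2 t3 ∘ r) d =
    m H r dzero d d (od H d) (od H d) (sq H d).
  rewrite (taddE (l := fun H r z => m H r dzero (D2_1 z) (D2_2 z)
    (od H _) (od H _) (D2_12 z))).
  - by apply: m_eq; rewrite ?D2_mkE.
  - by move=> H0 K0 r0 z s; apply: m_nat; rewrite ?D2_comp ?dzero_comp.
  - by move=> H0 r0 d'; rewrite -ax2; apply: m_eq; rewrite ?D2_mkE.
  - by move=> H0 r0 d'; rewrite -ax3; apply: m_eq; rewrite ?D2_mkE.
have add12 H r (d : hom H (D A)) : app (tadd t1 t2 ∘ r) d =
    m H r d d dzero (sq H d) (d0 H d) (d0 H d).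
  rewrite (taddE (l := fun H r z => m H r (D2_1 z) (D2_2 z) dzero
    (D2_12 z) (d0 H _) (d0 H _))).
  - by apply: m_eq; rewrite ?D2_mkE.
  - by move=> H0 K0 r0 z s; apply: m_nat; rewrite ?D2_comp ?dzero_comp.
  - by move=> H0 r0 d'; rewrite -ax1; apply: m_eq; rewrite ?D2_mkE.
  - by move=> H0 r0 d'; rewrite -ax2; apply: m_eq; rewrite ?D2_mkE.
apply: tan_ext => H r d; transitivity (m H r d d d (sq H d) (sq H d) (sq H d)).
  rewrite (taddE (l := fun H r z => m H r (D2_1 z) (D2_2 z) (D2_2 z)
    (D2_12 z) (D2_12 z) (sq H _))).
  - by apply: m_eq; rewrite ?D2_mkE.
  - by move=> H0 K0 r0 z s; apply: m_nat; rewrite ?D2_comp.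
  - by move=> H0 r0 d'; rewrite -ax1; apply: m_eq; rewrite ?D2_mkE.
  - by move=> H0 r0 d'; rewrite add23; apply: m_eq; rewrite ?D2_mkE.
rewrite (taddE (l := fun H r z => m H r (D2_1 z) (D2_1 z) (D2_2 z)
  (sq H _) (D2_12 z) (D2_12 z))).
- by apply: m_eq; rewrite ?D2_mkE.
- by move=> H0 K0 r0 z s; apply: m_nat; rewrite ?D2_comp.
- by move=> H0 r0 d'; rewrite add12; apply: m_eq; rewrite ?D2_mkE.
- by move=> H0 r0 d'; rewrite -ax3; apply: m_eq; rewrite ?D2_mkE.
Qed.

End TangentAddition.

(** [tadd] obeys the module laws only for vectors with a common base point. Bundling the base point
    gives a module over the elements of [A] at stage [G], to which iterated sums and linear maps
    apply. *)
Record tangent (E : universe) (A : line E) (X : E) (mX : microlinear A X) (G : E)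
    (x : hom G X) := Tangent {
  tvec :> hom G (D A ⇒ X);
  tvecP : app tvec dzero = x
}.

Section TangentModule.
Context {E : universe} {A : line E} {X : E} {mX : microlinear A X}.
Context {G : E} {x : hom G X}.
Local Notation tan := (tangent mX x).

Lemma tvec_inj : injective (@tvec E A X mX G x).
Proof.
move=> [t tP] [t' t'P] /= e; case: _ / e t'P => t'P.
by congr Tangent; apply: Prop_irrelevance.
Qed.

HB.instance Definition _ := gen_eqMixin tan.
HB.instance Definition _ := gen_choiceMixin tan.

Definition tan_add (t t' : tan) : tan :=
  Tangent mX (tadd_based mX (tvecP t) (tvecP t')).
Definition tan_zero : tan := Tangent mX (tzero_based A x).
Definition tan_scale (a : hom G A) (t : tan) : tan :=
  Tangent mX (tscale_based a (tvecP t)).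

Let base_eq (t t' : tan) : app t dzero = app t' dzero.
Proof. by rewrite !tvecP. Qed.

Lemma tan_addA : associative tan_add.
Proof. by move=> t1 t2 t3; apply: tvec_inj; apply: taddA. Qed.
Lemma tan_addC : commutative tan_add.
Proof. by move=> t1 t2; apply: tvec_inj; apply: taddC. Qed.
Lemma tan_add0 : left_id tan_zero tan_add.
Proof. by move=> t; apply: tvec_inj; apply: tadd0; rewrite ?tvecP. Qed.
Lemma tan_addN : left_inverse tan_zero (tan_scale (-1)) tan_add.
Proof.
move=> t; apply: tvec_inj; rewrite /= -{2}(tscale1 t) tscaleDl // addNr.
exact/tscale0/tvecP.
Qed.

HB.instance Definition _ :=
  GRing.isZmodule.Build tan tan_addA tan_addC tan_add0 tan_addN.

Lemma tan_scaleA a b (t : tan) : tan_scale a (tan_scale b t) = tan_scale (a * b) t.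
Proof. by apply: tvec_inj; apply: tscaleA. Qed.
Lemma tan_scale1 : left_id 1 tan_scale.
Proof. by move=> t; apply: tvec_inj; apply: tscale1. Qed.
Lemma tan_scaleDr : right_distributive tan_scale +%R.
Proof. by move=> a t t'; apply: tvec_inj; apply: tscaleDr. Qed.
Lemma tan_scaleDl (t : tan) : {morph tan_scale^~ t : a b / a + b}.
Proof. by move=> a b; apply: tvec_inj; rewrite /= tscaleDl. Qed.

HB.instance Definition _ := GRing.Zmodule_isLmodule.Build (hom G A) tan
  tan_scaleA tan_scale1 tan_scaleDr tan_scaleDl.

Lemma tvec_sum (I : Type) (s : seq I) (P : pred I) (F : I -> tan) :
  tvec (\sum_(i <- s | P i) F i) =
  \big[@tadd E A G X/@tzero E A G X x]_(i <- s | P i) tvec (F i).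
Proof. exact: (big_morph (@tvec E A X mX G x)). Qed.

End TangentModule.

Section TangentMaps.
Context {E : universe} (A : line E) (X : E) (mX : microlinear A X).
Implicit Types G H : E.

Lemma tadd_comp G H (t1 t2 : hom G (D A ⇒ X)) (r : hom H G) :
  app t1 dzero = app t2 dzero -> tadd t1 t2 ∘ r = tadd (t1 ∘ r) (t2 ∘ r).
Proof.
move=> e; have [l lP] := D2_glue mX e; apply: exp_ext => K s d.
rewrite -compA (tadd_spec mX lP) compA.
by rewrite (tadd_spec mX (l := l ∘ r)) // => K0 s0 d0; rewrite -!compA; apply: lP.
Qed.

Lemma tscale_comp G H (a : hom G A) (t : hom G (D A ⇒ X)) (r : hom H G) :
  tscale a t ∘ r = tscale (a ∘ r) (t ∘ r).
Proof. by apply: exp_ext => K s d; rewrite -compA !tscaleE !compA. Qed.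

Lemma tscaleE1 G (a : hom G A) (t : hom G (D A ⇒ X)) d :
  app (tscale a t) d = app t (dscale a d).
Proof. by rewrite -[tscale a t]comp_idr tscaleE !comp_idr. Qed.

(** Cancellation of an infinitesimal factor: composed with the third coordinate of [K], both vectors
    agree on the base trivially and on the graph by hypothesis, hence also on the axis, where this
    coordinate is arbitrary. *)
Lemma tan_mul_inj G (t t' : hom G (D A ⇒ X)) :
  (forall H (r : hom H G) d e, app (t ∘ r) (dmul d e) = app (t' ∘ r) (dmul d e)) ->
  t = t'.
Proof.
move=> e; apply: exp_ext => H r d.
have := @K_uniq E A X mX G (fun H r z => app (t ∘ r) (K_3 z))
  (fun H r z => app (t' ∘ r) (K_3 z)) _ _ _ _ H r (K_axis d).
rewrite K_mkE; apply.
- by move=> H0 K0 r0 z s; rewrite app_comp compA K_comp.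
- by move=> H0 K0 r0 z s; rewrite app_comp compA K_comp.
- move=> H0 r0 d1 d2; rewrite K_mkE.
  have -> : dzero = dmul dzero dzero :> hom H0 (D A); last exact: e.
  by apply: D_ext; rewrite dval_mul !dval0 mul0r.
- by move=> H0 r0 d1 d2; rewrite K_mkE e.
Qed.

End TangentMaps.

(* Tangent spaces are Euclidean modules: f(d1 u + d2 v) and d1 f(u) + d2 f(v)
   agree on the axes of D(2), hence on its diagonal, where d may be cancelled. *)
Lemma homogeneous_additive (E : universe) (A : line E) (X Y : E)
    (mX : microlinear A X) (mY : microlinear A Y) (G : E) (x : hom G X)
    (y : hom G Y)
    (f : forall H, hom H G -> hom H (D A ⇒ X) -> hom H (D A ⇒ Y)) :
  (forall H (r : hom H G) t, app t dzero = x ∘ r -> app (f H r t) dzero = y ∘ r) ->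
  (forall H K (r : hom H G) t (s : hom K H), app t dzero = x ∘ r ->
    f H r t ∘ s = f K (r ∘ s) (t ∘ s)) ->
  (forall H (r : hom H G) a t, app t dzero = x ∘ r ->
    f H r (tscale a t) = tscale a (f H r t)) ->
  forall u v, app u dzero = x -> app v dzero = x ->
    f G idm (tadd u v) = tadd (f G idm u) (f G idm v).
Proof.
move=> fb fn fh u v ub vb.
have ub' H (r : hom H G) : app (u ∘ r) dzero = x ∘ r by apply: tan_based.
have vb' H (r : hom H G) : app (v ∘ r) dzero = x ∘ r by apply: tan_based.
have xi : x ∘ idm = x by rewrite comp_idr.
have fub : app (f G idm u) dzero = y by rewrite fb ?xi // comp_idr.
have fvb : app (f G idm v) dzero = y by rewrite fb ?xi // comp_idr.
have fu H (r : hom H G) : f G idm u ∘ r = f H r (u ∘ r) by rewrite fn ?xi // comp_idl.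
have fv H (r : hom H G) : f G idm v ∘ r = f H r (v ∘ r) by rewrite fn ?xi // comp_idl.
have fuv H (r : hom H G) : f G idm (tadd u v) ∘ r = f H r (tadd u v ∘ r).
  by rewrite fn ?comp_idl // xi; apply: tadd_based.
pose lc (Z : E) (tu tv : hom G (D A ⇒ Z)) H (r : hom H G) (z : hom H (D2 A)) :=
  tadd (tscale (dval (D2_1 z)) (tu ∘ r)) (tscale (dval (D2_2 z)) (tv ∘ r)).
have lcn (Z : E) (mZ : microlinear A Z) w tu tv : app tu dzero = w ->
    app tv dzero = w -> natural (lc Z tu tv).
  move=> e1 e2 H K r z s; rewrite /lc (tadd_comp mZ) ?tscale_comp.
    by rewrite !D2_comp !dval_comp !compA.
  by rewrite !(@tscale_based _ _ _ _ _ _ (w ∘ r)) //; apply: tan_based.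
pose F H (r : hom H G) (z : hom H (D2 A)) := f H r (lc X u v H r z).
have lcb H (r : hom H G) z : app (lc X u v H r z) dzero = x ∘ r.
  by apply: tadd_based => //; apply: tscale_based.
have nF : natural F by move=> H K r z s; rewrite /F fn // (lcn X mX x).
have lc1 (Z : E) (mZ : microlinear A Z) w tu tv : app tu dzero = w ->
    app tv dzero = w -> forall H (r : hom H G) d,
    lc Z tu tv H r (mkD2 (dval_d0 d)) = tscale (dval d) (tu ∘ r).
  move=> e1 e2 H r d; rewrite /lc !D2_mkE dval0 (tscale0 (tan_based r e2)).
  by rewrite taddC ?tadd0 // ?tzero_based;
    rewrite (@tscale_based _ _ _ _ _ _ (w ∘ r)) ?tzero_based //; apply: tan_based.
have lc2 (Z : E) (mZ : microlinear A Z) w tu tv : app tu dzero = w ->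
    app tv dzero = w -> forall H (r : hom H G) d,
    lc Z tu tv H r (mkD2 (dval_0d d)) = tscale (dval d) (tv ∘ r).
  move=> e1 e2 H r d; rewrite /lc !D2_mkE dval0 (tscale0 (tan_based r e1)).
  by rewrite tadd0 // (@tscale_based _ _ _ _ _ _ (w ∘ r)) //; apply: tan_based.
have lcd (Z : E) (mZ : microlinear A Z) w tu tv : app tu dzero = w ->
    app tv dzero = w -> forall H (r : hom H G) d,
    lc Z tu tv H r (mkD2 (dval_sq d)) = tscale (dval d) (tadd tu tv ∘ r).
  move=> e1 e2 H r d; rewrite /lc !D2_mkE (tadd_comp mZ) ?e1 ?e2 //.
  by rewrite tscaleDr // !(@tan_based _ _ _ _ _ w).
have key : forall H (r : hom H G) z, F H r z =
    lc Y (f G idm u) (f G idm v) H r z.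
  apply: (D2_uniq (microlinear_exp mY) nF) => [|H r d|H r d].
  - exact: (lcn Y mY y).
  - by rewrite /F (lc1 X mX x) // (lc1 Y mY y) // fh // fu.
  - by rewrite /F (lc2 X mX x) // (lc2 Y mY y) // fh // fv.
apply: (tan_mul_inj mY) => H r d e.
have := congr1 (fun t => app t e) (key H r (mkD2 (dval_sq d))).
rewrite /F (lcd X mX x) // (lcd Y mY y) // fh; last exact/tan_based/tadd_based.
by rewrite -fuv !tscaleE1.
Qed.

Section PostComposition.
Context {E : universe} (A : line E) {X Y : E}.
Context (mX : microlinear A X) (mY : microlinear A Y).
Context (phi : forall G : E, hom G X -> hom G Y).
Hypothesis phiN : forall (G H : E) (x : hom G X) (r : hom H G),
  phi x ∘ r = phi (x ∘ r).
Implicit Types G H : E.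

Definition tpost G (t : hom G (D A ⇒ X)) : hom G (D A ⇒ Y) :=
  lamN (fun H (r : hom H G) d => phi (app (t ∘ r) d)).

Lemma tpostE G (t : hom G (D A ⇒ X)) H (r : hom H G) d :
  app (tpost t ∘ r) d = phi (app (t ∘ r) d).
Proof.
by rewrite app_lamN // => H0 K0 r0 x s; rewrite phiN app_comp compA.
Qed.

Lemma tpost_add G (t1 t2 : hom G (D A ⇒ X)) : app t1 dzero = app t2 dzero ->
  tpost (tadd t1 t2) = tadd (tpost t1) (tpost t2).
Proof.
move=> e; have [l lP] := D2_glue mX e; apply: exp_ext => H r d.
rewrite tpostE (tadd_spec mX lP).
rewrite (taddE mY (l := fun H r z => phi (app (l ∘ r) z))) //.
- by move=> H0 K0 r0 z s; rewrite phiN app_comp compA.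
- by move=> H0 r0 d0; rewrite tpostE (proj1 (lP _ _ _)).
- by move=> H0 r0 d0; rewrite tpostE (proj2 (lP _ _ _)).
Qed.

Lemma tpost_scale G (a : hom G A) (t : hom G (D A ⇒ X)) :
  tpost (tscale a t) = tscale a (tpost t).
Proof. by apply: exp_ext => H r d; rewrite tpostE !tscaleE tpostE. Qed.

End PostComposition.

(** * Convolutions and the bracket *)

Section Reindexing.
Context {E : universe} (A : line E) (M : E).
Implicit Types G H : E.

(** Arbitrary maps of indices, not only permutations: casts, block rotations and permutations of the
    second factor all become instances, and no transport along equations between dimensions
    remains. *)
Definition cube_re G n m (s : 'I_n -> 'I_m) (g : hom G (cube A M n)) :
    hom G (cube A M m) :=
  lam (fun r d => app (g ∘ r) (tup (fun i => coord d (s i)))).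

Definition dist_re G n m (s : 'I_n -> 'I_m) (f : hom G (dist A M m)) :
    hom G (dist A M n) :=
  lam (fun r g => app (f ∘ r) (cube_re s g)).

Lemma cube_reE G n m (s : 'I_n -> 'I_m) (g : hom G (cube A M n)) H (r : hom H G) d :
  app (cube_re s g ∘ r) d = app (g ∘ r) (tup (fun i => coord d (s i))).
Proof.
rewrite app_lam_comp app_comp -compA pi1_pair tup_comp; congr app.
by apply: eq_tup => i; rewrite -coord_comp pi2_pair.
Qed.

Lemma cube_re_comp G H n m (s : 'I_n -> 'I_m) (g : hom G (cube A M n)) (r : hom H G) :
  cube_re s g ∘ r = cube_re s (g ∘ r).
Proof. by apply: exp_ext => K q d; rewrite -compA !cube_reE compA. Qed.

Lemma dist_reE G n m (s : 'I_n -> 'I_m) (f : hom G (dist A M m)) H (r : hom H G) g :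
  app (dist_re s f ∘ r) g = app (f ∘ r) (cube_re s g).
Proof.
by rewrite app_lam_comp app_comp -compA pi1_pair cube_re_comp pi2_pair.
Qed.

Lemma dist_re_comp G H n m (s : 'I_n -> 'I_m) (f : hom G (dist A M m)) (r : hom H G) :
  dist_re s f ∘ r = dist_re s (f ∘ r).
Proof. by apply: exp_ext => K q d; rewrite -compA !dist_reE compA. Qed.

Lemma cube_re_re G n m l (s : 'I_n -> 'I_m) (t : 'I_m -> 'I_l)
    (g : hom G (cube A M n)) :
  cube_re t (cube_re s g) = cube_re (t \o s) g.
Proof.
apply: exp_ext => H r d; rewrite !cube_reE; congr app.
by apply: eq_tup => i; rewrite coord_tup.
Qed.

Lemma dist_re_re G n m l (s : 'I_n -> 'I_m) (t : 'I_m -> 'I_l)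
    (f : hom G (dist A M l)) :
  dist_re s (dist_re t f) = dist_re (t \o s) f.
Proof. by apply: exp_ext => H r g; rewrite !dist_reE cube_re_re. Qed.

Lemma diracE p G H (r : hom H G) (g : hom H (cube A M p)) :
  app (dirac p G ∘ r) g = app g (tup (fun=> dzero)).
Proof.
rewrite app_lam_comp app_comp pi2_pair tup_comp; congr app.
by apply: eq_tup => i; rewrite dzero_comp.
Qed.

Lemma dirac_comp p G H (r : hom H G) : dirac p G ∘ r = dirac p H :> hom H (dist A M p).
Proof. by apply: exp_ext => K q g; rewrite -compA !diracE. Qed.

Lemma dist_re_dirac G n m (s : 'I_n -> 'I_m) :
  dist_re s (dirac m G) = dirac n G :> hom G (dist A M n).
Proof.
apply: exp_ext => H r g; rewrite dist_reE !diracE.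
rewrite -[cube_re s g]comp_idr cube_reE comp_idr; congr app.
by apply: eq_tup => i; rewrite coord_tup.
Qed.

Definition field_re G n m (s : 'I_n -> 'I_m) (w : hom G (tfield A M m)) :
    hom G (tfield A M n) :=
  tpost (fun G => @dist_re G n m s) w.

Lemma field_reE G n m (s : 'I_n -> 'I_m) (w : hom G (tfield A M m)) H (r : hom H G) d :
  app (field_re s w ∘ r) d = dist_re s (app (w ∘ r) d).
Proof. by rewrite tpostE // => *; rewrite dist_re_comp. Qed.

Lemma field_re_re G n m l (s : 'I_n -> 'I_m) (t : 'I_m -> 'I_l)
    (w : hom G (tfield A M l)) :
  field_re s (field_re t w) = field_re (t \o s) w.
Proof. by apply: exp_ext => H r d; rewrite !field_reE dist_re_re. Qed.

Lemma field_permE G p (s : 'S_p) (w : hom G (tfield A M p)) :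
  field_perm s w = field_re s w.
Proof.
apply: exp_ext => H r d; rewrite [RHS]field_reE app_lam_comp.
rewrite -[dist_perm _ _]/(dist_re _ _) dist_re_comp app_comp.
by rewrite -compA pi1_pair pi2_pair.
Qed.

Lemma field_castE G m n (e : m = n) (w : hom G (tfield A M m)) :
  field_cast e w = field_re (cast_ord (esym e)) w.
Proof.
case: n / e; apply: exp_ext => H r d; rewrite field_reE /field_cast /=.
apply: exp_ext => K s g; rewrite dist_reE; congr app.
apply: exp_ext => L q c; rewrite cube_reE; congr app.
by rewrite -[LHS]tup_coord; apply: eq_tup => i; rewrite cast_ord_id.
Qed.

End Reindexing.

Section Convolution.
Context {E : universe} (A : line E) (M : E).
Implicit Types G H : E.

Lemma pcat_comp G H p q (a : hom G (pow (D A) p)) (b : hom G (pow (D A) q))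
    (r : hom H G) :
  pcat a b ∘ r = pcat (a ∘ r) (b ∘ r).
Proof.
rewrite /pcat tup_comp; apply: eq_tup => i.
by case: split => j; rewrite -coord_comp.
Qed.

(** The nested abstractions of the convolutions are named one binder at a time, so that
    extensionality can be applied to each separately. *)
Definition slice_l G p q (h : hom G (cube A M (p + q))) (a : hom G (pow (D A) p)) :
    hom G (cube A M q) :=
  lamN (fun H (r : hom H G) b => app (h ∘ r) (pcat (a ∘ r) b)).

Definition slice_r G p q (h : hom G (cube A M (p + q))) (b : hom G (pow (D A) q)) :
    hom G (cube A M p) :=
  lamN (fun H (r : hom H G) a => app (h ∘ r) (pcat a (b ∘ r))).

Lemma slice_lE G p q (h : hom G (cube A M (p + q))) a H (r : hom H G) b :
  app (slice_l h a ∘ r) b = app (h ∘ r) (pcat (a ∘ r) b).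
Proof. by rewrite app_lamN // => H0 K0 r0 x s; rewrite app_comp pcat_comp !compA. Qed.

Lemma slice_rE G p q (h : hom G (cube A M (p + q))) b H (r : hom H G) a :
  app (slice_r h b ∘ r) a = app (h ∘ r) (pcat a (b ∘ r)).
Proof. by rewrite app_lamN // => H0 K0 r0 x s; rewrite app_comp pcat_comp !compA. Qed.

Lemma slice_l_comp G H p q (h : hom G (cube A M (p + q))) a (r : hom H G) :
  slice_l h a ∘ r = slice_l (h ∘ r) (a ∘ r).
Proof. by apply: exp_ext => K s b; rewrite -compA !slice_lE !compA. Qed.

Lemma slice_r_comp G H p q (h : hom G (cube A M (p + q))) b (r : hom H G) :
  slice_r h b ∘ r = slice_r (h ∘ r) (b ∘ r).
Proof. by apply: exp_ext => K s a; rewrite -compA !slice_rE !compA. Qed.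

Definition part_r G p q (g : hom G (dist A M q)) (h : hom G (cube A M (p + q))) :
    hom G (cube A M p) :=
  lamN (fun H (r : hom H G) a => app (g ∘ r) (slice_l (h ∘ r) a)).

Definition part_l G p q (f : hom G (dist A M p)) (h : hom G (cube A M (p + q))) :
    hom G (cube A M q) :=
  lamN (fun H (r : hom H G) b => app (f ∘ r) (slice_r (h ∘ r) b)).

Lemma part_rE G p q (g : hom G (dist A M q)) (h : hom G (cube A M (p + q)))
    H (r : hom H G) a :
  app (part_r g h ∘ r) a = app (g ∘ r) (slice_l (h ∘ r) a).
Proof.
by rewrite app_lamN // => H0 K0 r0 x s; rewrite app_comp slice_l_comp !compA.
Qed.

Lemma part_lE G p q (f : hom G (dist A M p)) (h : hom G (cube A M (p + q)))
    H (r : hom H G) b :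
  app (part_l f h ∘ r) b = app (f ∘ r) (slice_r (h ∘ r) b).
Proof.
by rewrite app_lamN // => H0 K0 r0 x s; rewrite app_comp slice_r_comp !compA.
Qed.

Lemma convE G p q (f : hom G (dist A M p)) (g : hom G (dist A M q)) H (r : hom H G) h :
  app (conv f g ∘ r) h = app (f ∘ r) (part_r (g ∘ r) h).
Proof.
rewrite app_lam_comp app_comp -compA pi1_pair; congr app.
apply: exp_ext => K s a; rewrite -compA pair_comp [LHS]app_lam_comp app_comp part_rE.
rewrite -!compA !pi1_pair; congr app.
apply: exp_ext => L q0 b.
rewrite -compA pair_comp [LHS]app_lam_comp app_comp slice_lE pcat_comp.
by rewrite -!compA !(pi1_pair, pi2_pair, pi1_pair_comp, pi2_pair_comp) !compA.
Qed.

Lemma conv_tildeE G p q (f : hom G (dist A M p)) (g : hom G (dist A M q))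
    H (r : hom H G) h :
  app (conv_tilde f g ∘ r) h = app (g ∘ r) (part_l (f ∘ r) h).
Proof.
rewrite app_lam_comp app_comp -compA pi1_pair; congr app.
apply: exp_ext => K s a; rewrite -compA pair_comp [LHS]app_lam_comp app_comp part_lE.
rewrite -!compA !pi1_pair; congr app.
apply: exp_ext => L q0 b.
rewrite -compA pair_comp [LHS]app_lam_comp app_comp slice_rE pcat_comp.
by rewrite -!compA !(pi1_pair, pi2_pair, pi1_pair_comp, pi2_pair_comp) !compA.
Qed.

Lemma conv_comp G H p q (f : hom G (dist A M p)) (g : hom G (dist A M q))
    (r : hom H G) :
  conv f g ∘ r = conv (f ∘ r) (g ∘ r).
Proof. by apply: exp_ext => K s h; rewrite -compA !convE !compA. Qed.

Lemma conv_tilde_comp G H p q (f : hom G (dist A M p)) (g : hom G (dist A M q))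
    (r : hom H G) :
  conv_tilde f g ∘ r = conv_tilde (f ∘ r) (g ∘ r).
Proof. by apply: exp_ext => K s h; rewrite -compA !conv_tildeE !compA. Qed.

(** Evaluation at the origin commutes with any distribution on the other factor; this is why the two
    convolutions of fields agree on the axes of D(2). *)
Lemma conv_dirac_l G p q (g : hom G (dist A M q)) :
  conv (dirac p G) g = conv_tilde (dirac p G) g.
Proof.
apply: exp_ext => H r h; rewrite convE conv_tildeE diracE.
rewrite -[part_r _ _]comp_idr part_rE !comp_idr; congr app.
apply: exp_ext => K s b; rewrite slice_lE part_lE -compA diracE.
rewrite -[slice_r _ _]comp_idr slice_rE !comp_idr; congr (app _ (pcat _ _)).
by rewrite tup_comp; apply: eq_tup => i; rewrite dzero_comp.
Qed.

Lemma conv_dirac_r G p q (f : hom G (dist A M p)) :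
  conv f (dirac q G) = conv_tilde f (dirac q G).
Proof.
apply: exp_ext => H r h; rewrite convE conv_tildeE diracE.
rewrite -[part_l _ _]comp_idr part_lE !comp_idr; congr app.
apply: exp_ext => K s b; rewrite slice_rE part_rE -compA diracE.
rewrite -[slice_l _ _]comp_idr slice_lE !comp_idr; congr (app _ (pcat _ _)).
by rewrite tup_comp; apply: eq_tup => i; rewrite dzero_comp.
Qed.

Lemma conv_dirac G p q : conv (dirac p G) (dirac q G) = dirac (p + q) G
  :> hom G (dist A M (p + q)).
Proof.
apply: exp_ext => H r h; rewrite convE !diracE -[part_r _ _]comp_idr part_rE.
rewrite !comp_idr diracE -[slice_l _ _]comp_idr slice_lE !comp_idr; congr app.
by apply: eq_tup => i; case: split => j; rewrite coord_tup.
Qed.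

Lemma cconvE G p q (w1 : hom G (tfield A M p)) (w2 : hom G (tfield A M q))
    H (r : hom H G) d1 d2 :
  app (cconv w1 w2 ∘ r) ⟨d1, d2⟩ = conv (app (w1 ∘ r) d1) (app (w2 ∘ r) d2).
Proof.
rewrite app_lam_comp conv_comp !app_comp -!compA.
by rewrite !(pi1_pair, pi2_pair).
Qed.

Lemma cconv_tildeE G p q (w1 : hom G (tfield A M p)) (w2 : hom G (tfield A M q))
    H (r : hom H G) d1 d2 :
  app (cconv_tilde w1 w2 ∘ r) ⟨d1, d2⟩ =
  conv_tilde (app (w1 ∘ r) d1) (app (w2 ∘ r) d2).
Proof.
rewrite app_lam_comp conv_tilde_comp !app_comp -!compA.
by rewrite !(pi1_pair, pi2_pair).
Qed.

End Convolution.

Section LieBracket.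
Context {E : universe} (A : line E) (M : E) (mM : microlinear A M).
Implicit Types G H : E.

Lemma microlinear_dist n : microlinear A (dist A M n).
Proof. exact: microlinear_exp. Qed.

Arguments microlinear_dist n%_N C _ _ _ _ : clear implicits.

Section Pair.
Context {G : E} {p q : nat} (w1 : hom G (tfield A M p)) (w2 : hom G (tfield A M q)).
Hypotheses (b1 : app w1 dzero = dirac p G) (b2 : app w2 dzero = dirac q G).

Lemma lieE (k : forall H, hom H G -> hom H (K A) -> hom H (dist A M (p + q))) :
  natural k ->
  (forall H (r : hom H G) d1 d2,
    k H r (K_base d1 d2) = conv (app (w1 ∘ r) d1) (app (w2 ∘ r) d2)) ->
  (forall H (r : hom H G) d1 d2,
    k H r (K_graph d1 d2) = conv_tilde (app (w1 ∘ r) d1) (app (w2 ∘ r) d2)) ->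
  forall H (r : hom H G) e, app (lie w1 w2 ∘ r) e = k H r (K_axis e).
Proof.
move=> nk kb kg H r e; rewrite -(app_lamN nk) /lie.
apply: (sdiff_spec (microlinear_dist (p + q)%N)) => H0 r0 d1 d2.
by rewrite !(app_lamN nk) cconvE cconv_tildeE.
Qed.

(** The map on all of [K] is kept, not only its axis: the bracket laws are proved by transforming
    it, and it supplies the edges of the hexagon. *)
Lemma lie_kernel : exists k : hom G (K A ⇒ dist A M (p + q)),
  [/\ forall H (r : hom H G) d1 d2,
        app (k ∘ r) (K_base d1 d2) = conv (app (w1 ∘ r) d1) (app (w2 ∘ r) d2),
      forall H (r : hom H G) d1 d2,
        app (k ∘ r) (K_graph d1 d2) = conv_tilde (app (w1 ∘ r) d1) (app (w2 ∘ r) d2)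
    & forall H (r : hom H G) e, app (lie w1 w2 ∘ r) e = app (k ∘ r) (K_axis e)].
Proof.
have [|k kP] := K_glue (microlinear_dist (p + q)%N) (g1 := cconv_tilde w1 w2)
    (g2 := cconv w1 w2).
  move=> H r d1 d2 d12; rewrite cconvE cconv_tildeE.
  pose F (C : forall H, hom H (dist A M p) -> hom H (dist A M q) ->
      hom H (dist A M (p + q))) H (r : hom H G) (z : hom H (D2 A)) :=
    C H (app (w1 ∘ r) (D2_1 z)) (app (w2 ∘ r) (D2_2 z)).
  (* Only the axes of D(2) have to be compared, and there one of the two distributions is the Dirac
     one. *)
  have := @D2_uniq E A _ (microlinear_dist (p + q)%N) G (F (fun H => @conv_tilde _ _ _ _ _ H))
    (F (fun H => @conv _ _ _ _ _ H)) _ _ _ _ H r (mkD2 d12).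
  rewrite /F !D2_mkE; apply.
  - by move=> H0 K0 r0 z s; rewrite conv_tilde_comp !app_comp !D2_comp !compA.
  - by move=> H0 K0 r0 z s; rewrite conv_comp !app_comp !D2_comp !compA.
  - by move=> H0 r0 d; rewrite !D2_mkE (tan_based r0 b2) dirac_comp conv_dirac_r.
  - by move=> H0 r0 d; rewrite !D2_mkE (tan_based r0 b1) dirac_comp conv_dirac_l.
exists k; split=> [H r d1 d2|H r d1 d2|H r e].
- by rewrite (proj1 (kP _ _ _ _)) cconvE.
- by rewrite (proj2 (kP _ _ _ _)) cconv_tildeE.
exact: (sdiff_spec (microlinear_dist (p + q)%N)).
Qed.

Lemma lie_based : app (lie w1 w2) dzero = dirac (p + q) G.
Proof.
have [k [kb _ kE]] := lie_kernel.
rewrite -[lie w1 w2]comp_idr kE.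
have -> : K_axis dzero = K_base dzero dzero :> hom G (K A) by apply: eq_mkK.
by rewrite kb !comp_idr b1 b2 conv_dirac.
Qed.

Lemma lie_comp H (r : hom H G) : lie w1 w2 ∘ r = lie (w1 ∘ r) (w2 ∘ r).
Proof.
have [k [kb kg kE]] := lie_kernel.
apply: exp_ext => H0 s e; rewrite -compA kE compA; apply/esym.
apply: (sdiff_spec (microlinear_dist (p + q)%N)) => K0 s0 d1 d2.
by rewrite cconvE cconv_tildeE -!compA kb kg.
Qed.

End Pair.

Lemma K_scale_subproof H (a : hom H A) (z : hom H (K A)) :
  (dval (K_1 z) * dval (dscale a (K_3 z)) = 0) *
  (dval (dscale a (K_2 z)) * dval (dscale a (K_3 z)) = 0).
Proof.
rewrite !dval_scale; split; first by rewrite mulrCA K_13 mulr0.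
by rewrite mulrACA K_23 mulr0.
Qed.

Lemma lie_scale G p q (w1 : hom G (tfield A M p)) (w2 : hom G (tfield A M q))
    (a : hom G A) :
  app w1 dzero = dirac p G -> app w2 dzero = dirac q G ->
  lie w1 (tscale a w2) = tscale a (lie w1 w2).
Proof.
move=> b1 b2; have [k [kb kg kE]] := lie_kernel b1 b2; apply: exp_ext => H r e.
rewrite tscaleE kE.
(* Scaling d2 and e together by [a] respects the relations of [K], its base and its graph; so the
   map on [K] for the scaled field is [k] after this substitution. *)
pose kz H (r : hom H G) (z : hom H (K A)) :=
  mkK (K_scale_subproof (a ∘ r) z).1 (K_scale_subproof (a ∘ r) z).2.
have kzE H0 (r0 : hom H0 G) z :
    [/\ K_1 (kz _ r0 z) = K_1 z, K_2 (kz _ r0 z) = dscale (a ∘ r0) (K_2 z) &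
    K_3 (kz _ r0 z) = dscale (a ∘ r0) (K_3 z)] by rewrite /kz !K_mkE.
rewrite (lieE (k := fun H r z => app (k ∘ r) (kz H r z))).
- congr app; have [e1 e2 e3] := kzE H r (K_axis e).
  apply: K_ext; rewrite ?e1 ?e2 ?e3 !K_mkE //.
  by apply: D_ext; rewrite dval_scale dval0 mulr0.
- move=> H0 K0 r0 z s; rewrite app_comp compA; congr app.
  by apply: mkK_comp; rewrite ?dscale_comp !K_comp ?compA.
- move=> H0 r0 d1 d2; rewrite tscaleE -kb; congr app.
  have [e1 e2 e3] := kzE H0 r0 (K_base d1 d2).
  apply: K_ext; rewrite ?e1 ?e2 ?e3 !K_mkE //.
  by apply: D_ext; rewrite dval_scale dval0 mulr0.
- move=> H0 r0 d1 d2; rewrite tscaleE -kg; congr app.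
  have [e1 e2 e3] := kzE H0 r0 (K_graph d1 d2).
  apply: K_ext; rewrite ?e1 ?e2 ?e3 !K_mkE //.
  by apply: D_ext; rewrite dval_scale !dval_mul dval_scale mulrCA.
Qed.

Lemma lie_add G p q (w1 : hom G (tfield A M p)) (w2 w2' : hom G (tfield A M q)) :
  app w1 dzero = dirac p G -> app w2 dzero = dirac q G ->
  app w2' dzero = dirac q G ->
  lie w1 (tadd w2 w2') = tadd (lie w1 w2) (lie w1 w2').
Proof.
move=> b1 b2 b2'.
have b1r H (r : hom H G) : app (w1 ∘ r) dzero = dirac p H.
  by rewrite (tan_based r b1) dirac_comp.
have := homogeneous_additive (microlinear_dist q) (microlinear_dist (p + q)%N)
  (x := dirac q G) (y := dirac (p + q) G) (f := fun H r t => lie (w1 ∘ r) t).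
rewrite comp_idr; apply=> // [H r t|H K r t s|H r a t]; rewrite dirac_comp => bt.
- by rewrite dirac_comp; apply: lie_based.
- by rewrite lie_comp ?compA.
- by rewrite lie_scale.
Qed.

Definition shift_map p q q' (s : 'I_q -> 'I_q') (i : 'I_(p + q)) : 'I_(p + q') :=
  match split i with inl j => lshift q' j | inr k => rshift p (s k) end.

Lemma pcat_shift H p q q' (s : 'I_q' -> 'I_q) (a : hom H (pow (D A) p))
    (b : hom H (pow (D A) q)) :
  tup (fun i => coord (pcat a b) (shift_map s i)) =
  pcat a (tup (fun i => coord b (s i))).
Proof.
apply: eq_tup => i; rewrite /shift_map /pcat coord_tup.
case: (split i) => j; rewrite ?coord_tup.
  by rewrite -[lshift _ _]/(unsplit (inl j)) unsplitK.
by rewrite -[rshift _ _]/(unsplit (inr (s j))) unsplitK.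
Qed.

Lemma conv_re G p q q' (s : 'I_q' -> 'I_q) (f : hom G (dist A M p))
    (g : hom G (dist A M q)) :
  conv f (dist_re s g) = dist_re (shift_map s) (conv f g).
Proof.
apply: exp_ext => H r h; rewrite dist_reE !convE; congr app.
apply: exp_ext => K t a; rewrite !part_rE -compA dist_reE compA; congr app.
apply: exp_ext => L u b; rewrite cube_reE !slice_lE -[in RHS]compA cube_reE compA.
by rewrite pcat_shift.
Qed.

Lemma conv_tilde_re G p q q' (s : 'I_q' -> 'I_q) (f : hom G (dist A M p))
    (g : hom G (dist A M q)) :
  conv_tilde f (dist_re s g) = dist_re (shift_map s) (conv_tilde f g).
Proof.
apply: exp_ext => H r h; rewrite dist_reE !conv_tildeE dist_reE; congr app.
apply: exp_ext => K t b; rewrite cube_reE !part_lE; congr app.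
apply: exp_ext => L u a; rewrite !slice_rE -[in RHS]compA cube_reE compA.
rewrite pcat_shift tup_comp; congr (app _ (pcat _ _)).
by apply: eq_tup => i; rewrite coord_comp.
Qed.

Lemma lie_re G p q q' (s : 'I_q' -> 'I_q) (w1 : hom G (tfield A M p))
    (w2 : hom G (tfield A M q)) :
  app w1 dzero = dirac p G -> app w2 dzero = dirac q G ->
  lie w1 (field_re s w2) = field_re (shift_map s) (lie w1 w2).
Proof.
move=> b1 b2; have [k [kb kg kE]] := lie_kernel b1 b2; apply: exp_ext => H r e.
rewrite field_reE kE.
rewrite (lieE (k := fun H r z => dist_re (shift_map s) (app (k ∘ r) z))) //.
- by move=> H0 K0 r0 z t; rewrite dist_re_comp app_comp compA.
- by move=> H0 r0 d1 d2; rewrite field_reE kb conv_re.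
- by move=> H0 r0 d1 d2; rewrite field_reE kg conv_tilde_re.
Qed.

Lemma field_re_based G m n (s : 'I_n -> 'I_m) (w : hom G (tfield A M m)) :
  app w dzero = dirac m G -> app (field_re s w) dzero = dirac n G.
Proof.
by move=> b; rewrite -[field_re s w]comp_idr field_reE comp_idr b dist_re_dirac.
Qed.

Lemma field_re_add G m n (s : 'I_n -> 'I_m) (w w' : hom G (tfield A M m)) :
  app w dzero = app w' dzero ->
  field_re s (tadd w w') = tadd (field_re s w) (field_re s w').
Proof.
apply: (tpost_add (microlinear_dist m) (microlinear_dist n)) => *.
by rewrite dist_re_comp.
Qed.

Lemma field_re_scale G m n (s : 'I_n -> 'I_m) a (w : hom G (tfield A M m)) :
  field_re s (tscale a w) = tscale a (field_re s w).
Proof. by apply: tpost_scale => *; rewrite dist_re_comp. Qed.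

End LieBracket.

Arguments microlinear_dist {E A M} mM n%_N C _ G t _.

(** * The hexagon *)

Section ParametrizedUniqueness.
Context {E : universe} (A : line E) (X : E) (mX : microlinear A X) (G : E).
Implicit Types H : E.

Definition natural2 (Y Z : E)
    (F : forall H, hom H G -> hom H Y -> hom H Z -> hom H X) :=
  forall H L (r : hom H G) y z (s : hom L H),
    F H r y z ∘ s = F L (r ∘ s) (y ∘ s) (z ∘ s).

Context (F F' : forall H, hom H G -> hom H (D A) -> hom H (K A) -> hom H X).
Hypotheses (nF : natural2 F) (nF' : natural2 F').

(** The additional variable in D is absorbed into the stage, which becomes [G ⊗ D A]; uniqueness on
    [K] holds at every stage. *)
Let param (F0 : forall H, hom H G -> hom H (D A) -> hom H (K A) -> hom H X)
    H (r : hom H (G ⊗ D A)) (z : hom H (K A)) : hom H X :=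
  F0 H (pi1 ∘ r) (pi2 ∘ r) z.

Let nparam F0 : natural2 F0 -> natural (param F0).
Proof. by move=> n0 H L r z s; rewrite /param n0 !compA. Qed.

Let paramE F0 H (r : hom H G) d z : param F0 ⟨r, d⟩ z = F0 H r d z.
Proof. by rewrite /param pi1_pair pi2_pair. Qed.

Lemma K_uniq2 :
  (forall H (r : hom H G) d x y, F r d (K_base x y) = F' r d (K_base x y)) ->
  (forall H (r : hom H G) d x y, F r d (K_graph x y) = F' r d (K_graph x y)) ->
  forall H (r : hom H G) d z, F r d z = F' r d z.
Proof.
move=> eb eg H r d z; rewrite -!paramE.
by apply: (K_uniq mX (nparam nF) (nparam nF')) => *; rewrite /param ?eb ?eg.
Qed.

Lemma K_uniq_axis2 :
  (forall H (r : hom H G) d x y, F r d (K_base x y) = F' r d (K_base x y)) ->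
  (forall H (r : hom H G) d x, F r d (K_axis x) = F' r d (K_axis x)) ->
  forall H (r : hom H G) d z, F r d z = F' r d z.
Proof.
move=> eb eg H r d z; rewrite -!paramE.
by apply: (K_uniq_axis mX (nparam nF) (nparam nF')) => *; rewrite /param ?eb ?eg.
Qed.

Lemma K_uniq_graph_axis2 :
  (forall H (r : hom H G) d x y, F r d (K_graph x y) = F' r d (K_graph x y)) ->
  (forall H (r : hom H G) d x, F r d (K_axis x) = F' r d (K_axis x)) ->
  forall H (r : hom H G) d z, F r d z = F' r d z.
Proof.
move=> eb eg H r d z; rewrite -!paramE.
by apply: (K_uniq_graph_axis mX (nparam nF) (nparam nF')) => *; rewrite /param ?eb ?eg.
Qed.

End ParametrizedUniqueness.

(** The indices 1, 2, 3 of the forms are encoded as [None], [Some false], [Some true]. *)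
Definition triple (T : Type) (x y z : T) (i : option bool) : T :=
  match i with None => x | Some false => y | Some true => z end.

(* The vertices (None, i), (Some false, i), (Some true, i) carry the
   coordinates d_i, e_i, g_i. *)
Definition hex_facet (c : option (bool * option bool)) :
    {set option bool * option bool} :=
  match c with
  | None => [set t | t.1 == None]
  | Some (false, i) => [set (None, i); (Some false, i)]
  | Some (true, i) => [set (Some true, i)]
  end.

Definition hex_complex := cover_complex None hex_facet.

Section HexagonPoints.
Context {E : universe} {A : line E}.
Implicit Types G H : E.

(** Coordinates are taken in [A] rather than in D, so that points can be written as polynomials and
    compared by [ring]. The products left free, d_i d_j and d_i e_i, are those of the faces. *)
Record hex_valid H (d e g : option bool -> hom H A) : Prop := HexValid {
  hex_sq : forall i, [/\ d i * d i = 0, e i * e i = 0 & g i * g i = 0];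
  hex_de : forall i j, i != j -> d i * e j = 0;
  hex_ee : forall i j, i != j -> e i * e j = 0;
  hex_gg : forall i j, i != j -> g i * g j = 0;
  hex_dg : forall i j, d i * g j = 0;
  hex_eg : forall i j, e i * g j = 0
}.

Section Point.
Context {H : E} {d e g : option bool -> hom H A} (v : hex_valid d e g).

Definition hex_pt (t : option bool * option bool) : hom H (D A) :=
  match t.1 with
  | None => let: And3 s _ _ := hex_sq v t.2 in mkD s
  | Some false => let: And3 _ s _ := hex_sq v t.2 in mkD s
  | Some true => let: And3 _ _ s := hex_sq v t.2 in mkD s
  end.

Lemma dval_hex_pt t : dval (hex_pt t) =
  match t.1 with None => d t.2 | Some false => e t.2 | Some true => g t.2 end.
Proof.
by case: t => [[[]|] i]; rewrite /hex_pt /=; case: (hex_sq v i) => *; rewrite dval_mkD.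
Qed.

Lemma hex_pt_valid : valid hex_complex hex_pt.
Proof.
move=> S; rewrite cover_face => /existsPn nS.
(* A non-face contains some e_i or g_i, and also a vertex outside the facet of that one; the product
   of these two vanishes. *)
have /subsetPn[[k i] tS] := nS None; rewrite inE /= => nk.
case: k nk tS => // k _ tS.
have /subsetPn[[l j] sS] := nS (Some (k, i)).
have H2 t s : t \in S -> s \in S -> t != s -> dval (hex_pt t) * dval (hex_pt s) = 0 ->
  mono hex_pt S = 0 by move=> h1 h2 h3; apply: mono2 h1 h2 h3.
case: k tS => tS; rewrite !inE ?negb_or => nst.
  apply: (H2 _ _ tS sS); first by rewrite eq_sym.
  rewrite !dval_hex_pt /=.
  case: l {sS} nst => [[]|] nst; rewrite 1?mulrC ?(hex_dg v) ?(hex_eg v) //.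
  rewrite mulrC (hex_gg v) //; by apply: contra nst => /eqP->.
case/andP: nst => nst1 nst2; apply: (H2 _ _ tS sS); first by rewrite eq_sym.
rewrite !dval_hex_pt /=.
case: l {sS} nst1 nst2 => [[]|] nst1 nst2; rewrite ?(hex_eg v) //.
  by rewrite mulrC (hex_ee v) //; apply: contra nst2 => /eqP->.
by rewrite mulrC (hex_de v) //; apply: contra nst1 => /eqP->.
Qed.

End Point.

Lemma hex_valid_comp H L (d e g : option bool -> hom H A) (s : hom L H) :
  hex_valid d e g ->
  hex_valid (fun i => d i ∘ s) (fun i => e i ∘ s) (fun i => g i ∘ s).
Proof.
case=> hs hde hee hgg hdg heg; split=> [i|i j nij|i j nij|i j nij|i j|i j].
- by case: (hs i) => e1 e2 e3; split; rewrite -comp_M ?e1 ?e2 ?e3 comp_0.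
- by rewrite -comp_M hde // comp_0.
- by rewrite -comp_M hee // comp_0.
- by rewrite -comp_M hgg // comp_0.
- by rewrite -comp_M hdg comp_0.
- by rewrite -comp_M heg comp_0.
Qed.

End HexagonPoints.

Ltac hex_zero h1 h2 h3 h4 h5 h6 :=
  rewrite ?mulr0 ?mul0r; first [reflexivity | ring: h5 h6 h1 h2 h3 h4 | ring: h1 h2 h3 h4 h5 h6
    | ring: h6 h5 h4 h3 h2 h1 | ring: h3 h4 h5 h6 h1 h2].

Ltac hex_solve h1 h2 h3 h4 h5 h6 :=
  constructor;
  [ move=> [[]|]; split; rewrite /=
  | move=> [[]|] [[]|] //= _ | move=> [[]|] [[]|] //= _ | move=> [[]|] [[]|] //= _
  | move=> [[]|] [[]|] /= | move=> [[]|] [[]|] /= ];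
  hex_zero h1 h2 h3 h4 h5 h6.

Lemma hex_facet_Some c (k : bool) i :
  (Some k, i) \in hex_facet c -> c = Some (k, i).
Proof.
by case: c => [[[] j]|]; rewrite !inE //= => /eqP[-> ->].
Qed.

Section HexagonGlue.
Context {E : universe} (A : line E) (X : E) (mX : microlinear A X) (G : E).
Implicit Types H : E.
Local Notation edge := (forall H, hom H G -> hom H (D A) -> hom H (K A) -> hom H X).

(* An edge joins the two orders in its name: its restriction to the base of K is
   the first one, its restriction to the graph the second, and its D-argument is
   the coordinate of the form that stays outside the transposed pair. *)
Variables e123_132 e231_321 e231_213 e312_132 e312_321 e123_213 : edge.
Hypotheses (n1 : natural2 e123_132) (n1' : natural2 e231_321)
  (n2 : natural2 e231_213) (n2' : natural2 e312_132)
  (n3 : natural2 e312_321) (n3' : natural2 e123_213).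

(** One condition for each vertex of the hexagon, where two edges meet; [d1], [d2], [d3] always
    belong to the forms 1, 2, 3. *)
Hypothesis v123 : forall H (r : hom H G) d1 d2 d3,
  e123_132 r d1 (K_base d2 d3) = e123_213 r d3 (K_base d1 d2).
Hypothesis v132 : forall H (r : hom H G) d1 d2 d3,
  e123_132 r d1 (K_graph d2 d3) = e312_132 r d2 (K_graph d3 d1).
Hypothesis v231 : forall H (r : hom H G) d1 d2 d3,
  e231_321 r d1 (K_base d2 d3) = e231_213 r d2 (K_base d3 d1).
Hypothesis v321 : forall H (r : hom H G) d1 d2 d3,
  e231_321 r d1 (K_graph d2 d3) = e312_321 r d3 (K_graph d1 d2).
Hypothesis v213 : forall H (r : hom H G) d1 d2 d3,
  e231_213 r d2 (K_graph d3 d1) = e123_213 r d3 (K_graph d1 d2).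
Hypothesis v312 : forall H (r : hom H G) d1 d2 d3,
  e312_132 r d2 (K_base d3 d1) = e312_321 r d3 (K_base d1 d2).

(** [k1] joins the two opposite edges in which form 1 stays outside, with [2,3] read on their axes:
    it is the map on [K] behind the double bracket of 1 with [2,3]. Likewise for [k2] and [k3]. *)
Variables k1 k2 k3 : hom G (K A ⇒ X).
Hypothesis k1P : forall H (r : hom H G) d e,
  app (k1 ∘ r) (K_base d e) = e123_132 r d (K_axis e) /\
  app (k1 ∘ r) (K_graph d e) = e231_321 r d (K_axis e).
Hypothesis k2P : forall H (r : hom H G) d e,
  app (k2 ∘ r) (K_base d e) = e231_213 r d (K_axis e) /\
  app (k2 ∘ r) (K_graph d e) = e312_132 r d (K_axis e).
Hypothesis k3P : forall H (r : hom H G) d e,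
  app (k3 ∘ r) (K_base d e) = e312_321 r d (K_axis e) /\
  app (k3 ∘ r) (K_graph d e) = e123_213 r d (K_axis e).

Local Notation k := (triple k1 k2 k3).

Let base H (r : hom H G) (d : option bool -> hom H (D A)) : hom H X :=
  e123_132 r (d None) (K_base (d (Some false)) (d (Some true))).

(** The edge along which form i stays in first place; its axis is the product of form i with the
    inner bracket, which is the base of [k i]. *)
Let spoke (i : option bool) : edge := triple e123_132 e231_213 e312_321 i.

Let on_axis H (d : hom H (D A)) (i j : option bool) : hom H (D A) :=
  if i == j then d else dzero.

Lemma K_base0 H (d : hom H (D A)) :
  (K_base d dzero = K_graph d dzero) * (K_base dzero d = K_graph dzero d).
Proof.
by split; apply: eq_mkK => //; apply: D_ext; rewrite dval_mul !dval0 ?mulr0 ?mul0r.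
Qed.

Lemma K_axis0 H : K_axis dzero = K_base dzero dzero :> hom H (K A).
Proof. exact: eq_mkK. Qed.

(** When at most one coordinate is nonzero, base and graph of every edge coincide by [K_base0], so
    the vertex conditions lead from any order back to 123. *)
Let spoke0 i H (r : hom H G) (d : hom H (D A)) :
  spoke i r d (K_axis dzero) = base r (on_axis d i).
Proof.
rewrite /base /spoke /on_axis K_axis0; case: i => [[]|] //=.
  by rewrite -v312 !K_base0 -v132.
by rewrite -v231 !K_base0 v321 -!K_base0 -v312 !K_base0 -v132.
Qed.

Let k0 i H (r : hom H G) : app (k i ∘ r) (K_axis dzero) = base r (fun=> dzero).
Proof.
rewrite K_axis0; have := spoke0 i r dzero.
have -> : on_axis dzero i = (fun=> dzero) :> (_ -> hom H (D A)).
  by apply/funext => j; rewrite /on_axis; case: ifP.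
move=> <-; case: i => [[]|] /=.
- exact: (proj1 (k3P _ _ _)).
- exact: (proj1 (k2P _ _ _)).
- exact: (proj1 (k1P _ _ _)).
Qed.

Let facet_map (c : option (bool * option bool)) H (r : hom H G)
    (d : option bool * option bool -> hom H (D A)) : hom H X :=
  match c with
  | None => base r (fun i => d (None, i))
  | Some (false, i) => spoke i r (d (None, i)) (K_axis (d (Some false, i)))
  | Some (true, i) => app (k i ∘ r) (K_axis (d (Some true, i)))
  end.

Let facet_map_nat c H L (r : hom H G) d (s : hom L H) :
  facet_map c r d ∘ s = facet_map c (r ∘ s) (fun t => d t ∘ s).
Proof.
case: c => [[[] i]|] /=.
- by rewrite app_comp compA K_axis_comp.
- by case: i => [[]|] /=; rewrite ?n1 ?n2 ?n3 K_axis_comp.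
- by rewrite /base n1 K_base_comp.
Qed.

Let facet_base c H (r : hom H G) d :
  (forall t, t \notin hex_facet None -> d t = dzero) ->
  facet_map c r d = base r (fun i => restr (hex_facet c) d (None, i)).
Proof.
move=> d0; have e0 k i : d (Some k, i) = dzero by apply: d0; rewrite inE.
case: c => [[[] i]|] /=; rewrite ?e0.
- by rewrite k0; congr base; apply/funext => j; rewrite /restr inE.
- rewrite spoke0; congr base; apply/funext => j; rewrite /on_axis /restr !inE.
  by rewrite orbF xpair_eqE eqxx /= eq_sym; case: eqP => [->|].
- by congr base; apply/funext => j; rewrite /restr inE.
Qed.

Lemma hex_glue : exists u : hom G (Sp A hex_complex ⇒ X),
  forall c H (r : hom H G) x d, dco x = restr (hex_facet c) d ->
    app (u ∘ r) x = facet_map c r (restr (hex_facet c) d).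
Proof.
apply: (cover_glue None mX) => [c H L r d s|c c' H r d]; first exact: facet_map_nat.
have [->//|ncc'] := eqVneq c c'.
(* Two different facets have no e or g vertex in common, so on their overlap both maps reduce to
   [base]. *)
have off t : t \notin hex_facet None ->
    restr (hex_facet c :&: hex_facet c') d t = dzero.
  case: t => [[k|] i]; rewrite inE //= => _; rewrite /restr inE.
  case: ifP => // /andP[/hex_facet_Some e /hex_facet_Some].
  by rewrite -e => /eqP; rewrite eq_sym (negPf ncc').
rewrite !facet_base //; congr base; apply/funext => i; rewrite /restr inE.
by case: (_ \in hex_facet c); case: (_ \in hex_facet c').
Qed.

(** Total in the coordinates, so that these can be rewritten without carrying proofs of validity;
    the value at invalid coordinates is arbitrary. *)
Definition hex H (r : hom H G) (d e g : option bool -> hom H A) : hom H X :=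
  if pselect (hex_valid d e g) is left v
  then app (sval (cid hex_glue) ∘ r) (mkSp (hex_pt_valid v))
  else app (k1 ∘ r) (K_axis dzero).

Lemma hex_facetE c H (r : hom H G) d e g (v : hex_valid d e g) x :
  (forall t, hex_pt v t = restr (hex_facet c) x t) ->
  hex r d e g = facet_map c r (restr (hex_facet c) x).
Proof.
move=> /funext vx; rewrite /hex; case: pselect => // v'.
case: (cid _) => u uP /=; apply: uP; rewrite dco_mkSp -vx.
by congr hex_pt; apply: Prop_irrelevance.
Qed.

Lemma hex_nat H L (r : hom H G) d e g (s : hom L H) : hex_valid d e g ->
  hex r d e g ∘ s =
  hex (r ∘ s) (fun i => d i ∘ s) (fun i => e i ∘ s) (fun i => g i ∘ s).
Proof.
move=> v; rewrite /hex; case: pselect => // {}v.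
case: pselect => [v'|[]]; last exact: hex_valid_comp.
rewrite app_comp compA; congr app; apply: sp_ext => t.
rewrite dco_comp !dco_mkSp; apply: D_ext; rewrite dval_comp !dval_hex_pt.
by case: t.1 => [[]|].
Qed.

Local Notation t0 := (triple 0 0 0).

Lemma hex_vertex H (r : hom H G) d1 d2 d3 :
  hex r (triple (dval d1) (dval d2) (dval d3)) t0 t0 = e123_132 r d1 (K_base d2 d3).
Proof.
have v : hex_valid (triple (dval d1) (dval d2) (dval d3)) t0 t0.
  have s1 := dval_sq d1; have s2 := dval_sq d2; have s3 := dval_sq d3.
  hex_solve s1 s2 s3 s1 s1 s1.
rewrite (@hex_facetE None H r _ _ _ v (fun t => triple d1 d2 d3 t.2)).
  by rewrite /facet_map /base /restr !inE.
by move=> [[[]|] [[]|]]; apply: D_ext; rewrite dval_hex_pt /restr inE /= ?dval0.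
Qed.

Definition single (i : option bool) H (x : hom H A) (j : option bool) : hom H A :=
  if i == j then x else 0.

Lemma hex_spoke i H (r : hom H G) d e :
  hex r (single i (dval d)) (single i (dval e)) t0 = spoke i r d (K_axis e).
Proof.
have v : hex_valid (single i (dval d)) (single i (dval e)) t0.
  have s1 := dval_sq d; have s2 := dval_sq e.
  by case: i; rewrite /single; [case|]; hex_solve s1 s2 s1 s1 s1 s1.
rewrite (@hex_facetE (Some (false, i)) H r _ _ _ v (fun t => if t.1 == None then d else e)).
  by rewrite /facet_map /restr !inE !eqxx orbT.
move=> [[[]|] j]; apply: D_ext; rewrite dval_hex_pt /restr !inE /= ?dval0.
- by case: j => [[]|].
- by rewrite /single xpair_eqE eqxx /= eq_sym; case: eqP; rewrite ?dval0.
- by rewrite /single xpair_eqE eqxx /= eq_sym orbF; case: eqP; rewrite ?dval0.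
Qed.

Lemma hex_ray i H (r : hom H G) g :
  hex r t0 t0 (single i (dval g)) = app (k i ∘ r) (K_axis g).
Proof.
have v : hex_valid t0 t0 (single i (dval g)).
  have s1 := dval_sq g.
  by case: i; rewrite /single; [case|]; hex_solve s1 s1 s1 s1 s1 s1.
rewrite (@hex_facetE (Some (true, i)) H r _ _ _ v (fun=> g)).
  by rewrite /facet_map /restr !inE !eqxx.
move=> [[[]|] j]; apply: D_ext; rewrite dval_hex_pt /restr !inE /= ?dval0.
- by rewrite /single xpair_eqE eqxx /= eq_sym; case: eqP; rewrite ?dval0.
- by case: j => [[]|].
- by case: j => [[]|].
Qed.

Lemma single_1 H (x : hom H A) : single None x = triple x 0 0.
Proof. by apply/funext => -[[]|]. Qed.
Lemma single_2 H (x : hom H A) : single (Some false) x = triple 0 x 0.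
Proof. by apply/funext => -[[]|]. Qed.
Lemma single_3 H (x : hom H A) : single (Some true) x = triple 0 0 x.
Proof. by apply/funext => -[[]|]. Qed.
Definition singleE := (single_1, single_2, single_3).

Lemma eq_hex H (r : hom H G) (d1 d2 d3 e1 e2 e3 g1 g2 g3 : hom H A)
    d1' d2' d3' e1' e2' e3' g1' g2' g3' :
  d1 = d1' -> d2 = d2' -> d3 = d3' -> e1 = e1' -> e2 = e2' -> e3 = e3' ->
  g1 = g1' -> g2 = g2' -> g3 = g3' ->
  hex r (triple d1 d2 d3) (triple e1 e2 e3) (triple g1 g2 g3) =
  hex r (triple d1' d2' d3') (triple e1' e2' e3') (triple g1' g2' g3').
Proof. by do 9!move=> ->. Qed.

Lemma triple_comp H L (x y z : hom H A) (s : hom L H) :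
  (fun i => triple x y z i ∘ s) = triple (x ∘ s) (y ∘ s) (z ∘ s).
Proof. by apply/funext => -[[]|]. Qed.

Lemma single0 i H : single i (0 : hom H A) = t0.
Proof. by apply/funext => -[[]|]; rewrite /single; case: ifP. Qed.

Lemma single_comp i H L (x : hom H A) (s : hom L H) :
  (fun j => single i x j ∘ s) = single i (x ∘ s).
Proof. by apply/funext => j; rewrite /single; case: ifP; rewrite ?comp_0. Qed.

(** The coordinates d_i, e_i, g_i satisfy the relations of [K]; the base of [k i] is then the facet
    of d_i and e_i, and its axis is the ray g_i. *)
Lemma hex_kernel i H (r : hom H G) z :
  app (k i ∘ r) z =
  hex r (single i (dval (K_1 z))) (single i (dval (K_2 z))) (single i (dval (K_3 z))).
Proof.
have v H0 (z0 : hom H0 (K A)) : hex_valid (single i (dval (K_1 z0)))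
    (single i (dval (K_2 z0))) (single i (dval (K_3 z0))).
  have s1 := dval_sq (K_1 z0); have s2 := dval_sq (K_2 z0).
  have s3 := dval_sq (K_3 z0); have s13 := K_13 z0; have s23 := K_23 z0.
  by case: i; rewrite /single; [case|]; hex_solve s1 s2 s3 s1 s13 s23.
apply: (K_uniq_axis mX (F := fun H r z => app (k i ∘ r) z) (F' := fun H r z =>
  hex r (single i (dval (K_1 z))) (single i (dval (K_2 z))) (single i (dval (K_3 z))))).
- exact: natural_app.
- by move=> H0 L r0 z0 s; rewrite hex_nat // !single_comp !K_comp !dval_comp.
- move=> H0 r0 d e; rewrite !K_mkE dval0 single0 hex_spoke.
  case: (i) => [[]|] /=.
  + exact: (proj1 (k3P _ _ _)).
  + exact: (proj1 (k2P _ _ _)).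
  + exact: (proj1 (k1P _ _ _)).
- by move=> H0 r0 e; rewrite !K_mkE dval0 !single0 hex_ray.
Qed.

Ltac hex_natural v :=
  move=> ? ? ? ? ? ?; rewrite (hex_nat _ _ (v _ _ _)) !triple_comp
    !(comp_D, comp_N, comp_M, comp_0) -!dval_comp -!K_comp.

Ltac hex_facts d z :=
  let s1 := fresh in have s1 := dval_sq d;
  let s2 := fresh in have s2 := dval_sq (K_1 z);
  let s3 := fresh in have s3 := dval_sq (K_2 z);
  let s4 := fresh in have s4 := dval_sq (K_3 z);
  let s5 := fresh in have s5 := K_13 z;
  let s6 := fresh in have s6 := K_23 z;
  hex_solve s1 s2 s3 s4 s5 s6.

(** From the vertex 123 on the base and the first spoke on the axis, both of which are facets. *)
Lemma hex_e123_132 H (r : hom H G) d z : e123_132 r d z =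
  hex r (triple (dval d) (dval (K_1 z)) (dval (K_2 z))) (triple (dval (K_3 z)) 0 0) t0.
Proof.
have v H0 (d0 : hom H0 (D A)) (z0 : hom H0 (K A)) :
  hex_valid (triple (dval d0) (dval (K_1 z0)) (dval (K_2 z0)))
    (triple (dval (K_3 z0)) 0 0) t0 by hex_facts d0 z0.
apply: (K_uniq_axis2 mX (F := e123_132) (F' := fun H r d z =>
  hex r (triple (dval d) (dval (K_1 z)) (dval (K_2 z)))
    (triple (dval (K_3 z)) 0 0) t0)) => //.
- by hex_natural v.
- by move=> H0 r0 d0 x y; rewrite !K_mkE dval0 hex_vertex.
- by move=> H0 r0 d0 x; rewrite -[LHS](hex_spoke None) !singleE !K_mkE dval0.
Qed.

(** From the vertex 123 on the base and the graph of [k3] on the axis; the latter contributes the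
    [g]-term. *)
Lemma hex_e123_213 H (r : hom H G) d z : e123_213 r d z =
  hex r (triple (dval (K_1 z)) (dval (K_2 z)) (dval d)) (triple 0 0 (dval (K_3 z)))
    (triple 0 0 (dval d * dval (K_3 z))).
Proof.
have v H0 (d0 : hom H0 (D A)) (z0 : hom H0 (K A)) :
  hex_valid (triple (dval (K_1 z0)) (dval (K_2 z0)) (dval d0))
    (triple 0 0 (dval (K_3 z0))) (triple 0 0 (dval d0 * dval (K_3 z0))).
  by hex_facts d0 z0.
apply: (K_uniq_axis2 mX (F := e123_213) (F' := fun H r d z =>
  hex r (triple (dval (K_1 z)) (dval (K_2 z)) (dval d)) (triple 0 0 (dval (K_3 z)))
    (triple 0 0 (dval d * dval (K_3 z))))) => //.
- by hex_natural v.
- by move=> H0 r0 d0 x y; rewrite !K_mkE dval0 mulr0 hex_vertex v123.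
- move=> H0 r0 d0 x; rewrite -(proj2 (k3P _ _ _)) (hex_kernel (Some true)).
  by rewrite !singleE !K_mkE dval0 dval_mul.
Qed.

(** From the vertex 213 on the graph and the second spoke on the axis. Subtracting the product of
    the first two coordinates makes the new e-direction vanish on the graph; the remaining terms
    come from 213. *)
Lemma hex_e231_213 H (r : hom H G) d z : e231_213 r d z =
  hex r (triple (dval (K_2 z)) (dval d) (dval (K_1 z)))
    (triple 0 (dval (K_3 z) - dval (K_1 z) * dval (K_2 z)) (dval (K_2 z) * dval d))
    (triple 0 0 (dval (K_1 z) * dval (K_2 z) * dval d)).
Proof.
have v H0 (d0 : hom H0 (D A)) (z0 : hom H0 (K A)) :
  hex_valid (triple (dval (K_2 z0)) (dval d0) (dval (K_1 z0)))
    (triple 0 (dval (K_3 z0) - dval (K_1 z0) * dval (K_2 z0)) (dval (K_2 z0) * dval d0))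
    (triple 0 0 (dval (K_1 z0) * dval (K_2 z0) * dval d0)).
  by hex_facts d0 z0.
apply: (K_uniq_graph_axis2 mX (F := e231_213) (F' := fun H r d z =>
  hex r (triple (dval (K_2 z)) (dval d) (dval (K_1 z)))
    (triple 0 (dval (K_3 z) - dval (K_1 z) * dval (K_2 z)) (dval (K_2 z) * dval d))
    (triple 0 0 (dval (K_1 z) * dval (K_2 z) * dval d)))) => //.
- by hex_natural v.
- move=> H0 r0 d0 x y; rewrite v213 hex_e123_213 !K_mkE !dval_mul.
  by apply: eq_hex => //; ring.
- move=> H0 r0 d0 x; rewrite -[LHS](hex_spoke (Some false)) !singleE !K_mkE dval0.
  by apply: eq_hex => //; ring.
Qed.

(** From the vertex 231 on the base and the graph of [k1] on the axis. *)
Lemma hex_e231_321 H (r : hom H G) d z : e231_321 r d z =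
  hex r (triple (dval d) (dval (K_1 z)) (dval (K_2 z)))
    (triple (dval (K_3 z)) (- (dval d * dval (K_2 z))) (dval d * dval (K_1 z)))
    (triple (dval d * dval (K_3 z)) 0 (dval d * dval (K_1 z) * dval (K_2 z))).
Proof.
have v H0 (d0 : hom H0 (D A)) (z0 : hom H0 (K A)) :
  hex_valid (triple (dval d0) (dval (K_1 z0)) (dval (K_2 z0)))
    (triple (dval (K_3 z0)) (- (dval d0 * dval (K_2 z0))) (dval d0 * dval (K_1 z0)))
    (triple (dval d0 * dval (K_3 z0)) 0 (dval d0 * dval (K_1 z0) * dval (K_2 z0))).
  by hex_facts d0 z0.
apply: (K_uniq_axis2 mX (F := e231_321) (F' := fun H r d z =>
  hex r (triple (dval d) (dval (K_1 z)) (dval (K_2 z)))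
    (triple (dval (K_3 z)) (- (dval d * dval (K_2 z))) (dval d * dval (K_1 z)))
    (triple (dval d * dval (K_3 z)) 0 (dval d * dval (K_1 z) * dval (K_2 z))))) => //.
- by hex_natural v.
- move=> H0 r0 d0 x y; rewrite v231 hex_e231_213 !K_mkE !dval0.
  by apply: eq_hex => //; ring.
- move=> H0 r0 d0 x; rewrite -(proj2 (k1P _ _ _)) (hex_kernel None).
  rewrite !singleE !K_mkE dval0 dval_mul.
  by apply: eq_hex => //; ring.
Qed.

(** The other way round the hexagon: from the vertex 132 on the graph and the graph of [k2] on the
    axis, again with the correction that vanishes on the graph. *)
Lemma hex_e312_132 H (r : hom H G) d z : e312_132 r d z =
  hex r (triple (dval (K_2 z)) (dval d) (dval (K_1 z)))
    (triple (dval d * dval (K_1 z)) (dval (K_3 z) - dval (K_1 z) * dval (K_2 z)) 0)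
    (triple 0 (dval d * (dval (K_3 z) - dval (K_1 z) * dval (K_2 z))) 0).
Proof.
have v H0 (d0 : hom H0 (D A)) (z0 : hom H0 (K A)) :
  hex_valid (triple (dval (K_2 z0)) (dval d0) (dval (K_1 z0)))
    (triple (dval d0 * dval (K_1 z0)) (dval (K_3 z0) - dval (K_1 z0) * dval (K_2 z0)) 0)
    (triple 0 (dval d0 * (dval (K_3 z0) - dval (K_1 z0) * dval (K_2 z0))) 0).
  by hex_facts d0 z0.
apply: (K_uniq_graph_axis2 mX (F := e312_132) (F' := fun H r d z =>
  hex r (triple (dval (K_2 z)) (dval d) (dval (K_1 z)))
    (triple (dval d * dval (K_1 z)) (dval (K_3 z) - dval (K_1 z) * dval (K_2 z)) 0)
    (triple 0 (dval d * (dval (K_3 z) - dval (K_1 z) * dval (K_2 z))) 0))) => //.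
- by hex_natural v.
- move=> H0 r0 d0 x y; rewrite -v132 hex_e123_132 !K_mkE !dval_mul.
  by apply: eq_hex => //; ring.
- move=> H0 r0 d0 x; rewrite -(proj2 (k2P _ _ _)) (hex_kernel (Some false)).
  rewrite !singleE !K_mkE dval0 dval_mul.
  by apply: eq_hex => //; ring.
Qed.

(** From the vertex 312 on the base and the third spoke on the axis. *)
Lemma hex_e312_321 H (r : hom H G) d z : e312_321 r d z =
  hex r (triple (dval (K_1 z)) (dval (K_2 z)) (dval d))
    (triple (dval (K_2 z) * dval d) (- (dval (K_1 z) * dval d)) (dval (K_3 z)))
    (triple 0 (- (dval (K_1 z) * dval (K_2 z) * dval d)) 0).
Proof.
have v H0 (d0 : hom H0 (D A)) (z0 : hom H0 (K A)) :
  hex_valid (triple (dval (K_1 z0)) (dval (K_2 z0)) (dval d0))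
    (triple (dval (K_2 z0) * dval d0) (- (dval (K_1 z0) * dval d0)) (dval (K_3 z0)))
    (triple 0 (- (dval (K_1 z0) * dval (K_2 z0) * dval d0)) 0).
  by hex_facts d0 z0.
apply: (K_uniq_axis2 mX (F := e312_321) (F' := fun H r d z =>
  hex r (triple (dval (K_1 z)) (dval (K_2 z)) (dval d))
    (triple (dval (K_2 z) * dval d) (- (dval (K_1 z) * dval d)) (dval (K_3 z)))
    (triple 0 (- (dval (K_1 z) * dval (K_2 z) * dval d)) 0))) => //.
- by hex_natural v.
- move=> H0 r0 d0 x y; rewrite -v312 hex_e312_132 !K_mkE !dval0.
  by apply: eq_hex => //; ring.
- move=> H0 r0 d0 x; rewrite -[LHS](hex_spoke (Some true)) !singleE !K_mkE dval0.
  by apply: eq_hex => //; ring.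
Qed.

(* The two expressions for the order 321 differ by the sum of the three rays. *)
Lemma hex_diagonal H (r : hom H G) (d : hom H (D A)) :
  hex r t0 t0 (triple (dval d) (dval d) (dval d)) = hex r t0 t0 t0.
Proof.
(* [K_3 z] is put in place of d2 d3 so that the base is trivial and the graph is the equality of the
   two expressions for 321; the axis then has d2 d3 cancelled. *)
have sum1 H0 (r0 : hom H0 G) d0 z : hex r0 (triple (dval d0) (dval (K_1 z)) (dval (K_2 z)))
    (triple (dval (K_1 z) * dval (K_2 z)) (- (dval d0 * dval (K_2 z)))
      (dval d0 * dval (K_1 z)))
    (triple (dval d0 * dval (K_3 z))
      (dval d0 * (dval (K_3 z) - dval (K_1 z) * dval (K_2 z))) (dval d0 * dval (K_3 z))) =
  hex r0 (triple (dval d0) (dval (K_1 z)) (dval (K_2 z)))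
    (triple (dval (K_1 z) * dval (K_2 z)) (- (dval d0 * dval (K_2 z)))
      (dval d0 * dval (K_1 z)))
    (triple 0 (- (dval d0 * dval (K_1 z) * dval (K_2 z))) 0).
  have v H1 (d1 : hom H1 (D A)) (z1 : hom H1 (K A)) : hex_valid
    (triple (dval d1) (dval (K_1 z1)) (dval (K_2 z1)))
    (triple (dval (K_1 z1) * dval (K_2 z1)) (- (dval d1 * dval (K_2 z1)))
      (dval d1 * dval (K_1 z1)))
    (triple (dval d1 * dval (K_3 z1))
      (dval d1 * (dval (K_3 z1) - dval (K_1 z1) * dval (K_2 z1))) (dval d1 * dval (K_3 z1))).
    by hex_facts d1 z1.
  have v' H1 (d1 : hom H1 (D A)) (z1 : hom H1 (K A)) : hex_valid
    (triple (dval d1) (dval (K_1 z1)) (dval (K_2 z1)))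
    (triple (dval (K_1 z1) * dval (K_2 z1)) (- (dval d1 * dval (K_2 z1)))
      (dval d1 * dval (K_1 z1)))
    (triple 0 (- (dval d1 * dval (K_1 z1) * dval (K_2 z1))) 0).
    by hex_facts d1 z1.
  apply: (K_uniq2 mX (F := fun H r d z =>
    hex r (triple (dval d) (dval (K_1 z)) (dval (K_2 z)))
    (triple (dval (K_1 z) * dval (K_2 z)) (- (dval d * dval (K_2 z)))
      (dval d * dval (K_1 z)))
    (triple (dval d * dval (K_3 z))
      (dval d * (dval (K_3 z) - dval (K_1 z) * dval (K_2 z))) (dval d * dval (K_3 z))))
    (F' := fun H r d z => hex r (triple (dval d) (dval (K_1 z)) (dval (K_2 z)))
    (triple (dval (K_1 z) * dval (K_2 z)) (- (dval d * dval (K_2 z)))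
      (dval d * dval (K_1 z)))
    (triple 0 (- (dval d * dval (K_1 z) * dval (K_2 z))) 0))).
  - by hex_natural v.
  - by hex_natural v'.
  - by move=> H1 r1 d1 x y; rewrite !K_mkE dval0; apply: eq_hex => //; ring.
  - move=> H1 r1 d1 x y; have := v321 r1 d1 x y.
    rewrite hex_e231_321 hex_e312_321 !K_mkE !dval_mul => e.
    transitivity (hex r1 (triple (dval d1) (dval x) (dval y))
      (triple (dval x * dval y) (- (dval d1 * dval y)) (dval d1 * dval x))
      (triple (dval d1 * (dval x * dval y)) 0 (dval d1 * dval x * dval y))).
      by apply: eq_hex => //; ring.
    by rewrite e; apply: eq_hex => //; ring.
(* The same device cancels d1: now [K_3 z] stands for the product of d1 with the element freed by
   [sum1]. *)
have sum2 H0 (r0 : hom H0 G) z :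
    hex r0 (triple (dval (K_1 z)) 0 0) t0
      (triple (dval (K_3 z)) (dval (K_3 z)) (dval (K_3 z))) =
    hex r0 (triple (dval (K_1 z)) 0 0) t0 t0.
  have v H1 (z1 : hom H1 (K A)) : hex_valid (triple (dval (K_1 z1)) 0 0) t0
      (triple (dval (K_3 z1)) (dval (K_3 z1)) (dval (K_3 z1))).
    by hex_facts (K_1 z1) z1.
  have v' H1 (z1 : hom H1 (K A)) : hex_valid (triple (dval (K_1 z1)) 0 0) t0 t0.
    by hex_facts (K_1 z1) z1.
  apply: (K_uniq mX (F := fun H r z => hex r (triple (dval (K_1 z)) 0 0) t0
      (triple (dval (K_3 z)) (dval (K_3 z)) (dval (K_3 z))))
    (F' := fun H r z => hex r (triple (dval (K_1 z)) 0 0) t0 t0)).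
  - move=> ? ? ? ? ?; rewrite (hex_nat _ _ (v _ _)) !triple_comp
      !(comp_D, comp_N, comp_M, comp_0) -!dval_comp -!K_comp; by [].
  - move=> ? ? ? ? ?; rewrite (hex_nat _ _ (v' _ _)) !triple_comp
      !(comp_D, comp_N, comp_M, comp_0) -!dval_comp -!K_comp; by [].
  - by move=> H1 r1 x y; rewrite !K_mkE dval0.
  - move=> H1 r1 x y; have := sum1 H1 r1 x (K_axis y).
    rewrite !K_mkE !dval_mul !dval0 => e; apply: etrans (etrans _ e) _;
    by apply: eq_hex => //; ring.
by have := sum2 H r (K_axis d); rewrite !K_mkE dval0.
Qed.

(** The rays have pairwise zero products, so [hex] extends the three vectors to D(3), and the
    iterated sum is its diagonal. *)
Lemma hexagon_sum (t1 t2 t3 : hom G (D A ⇒ X)) :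
  (forall H (r : hom H G) d, app (t1 ∘ r) d = app (k1 ∘ r) (K_axis d)) ->
  (forall H (r : hom H G) d, app (t2 ∘ r) d = app (k2 ∘ r) (K_axis d)) ->
  (forall H (r : hom H G) d, app (t3 ∘ r) d = app (k3 ∘ r) (K_axis d)) ->
  tadd (tadd t1 t2) t3 = tzero (app t1 dzero).
Proof.
move=> t1P t2P t3P.
have t1E H (r : hom H G) d : app (t1 ∘ r) d = hex r t0 t0 (triple (dval d) 0 0).
  by rewrite t1P -[LHS](hex_ray None) singleE.
have t2E H (r : hom H G) d : app (t2 ∘ r) d = hex r t0 t0 (triple 0 (dval d) 0).
  by rewrite t2P -[LHS](hex_ray (Some false)) singleE.
have t3E H (r : hom H G) d : app (t3 ∘ r) d = hex r t0 t0 (triple 0 0 (dval d)).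
  by rewrite t3P -[LHS](hex_ray (Some true)) singleE.
have v12 H (z : hom H (D2 A)) : hex_valid t0 t0 (triple (dval (D2_1 z)) (dval (D2_2 z)) 0).
  have s1 := dval_sq (D2_1 z); have s2 := dval_sq (D2_2 z); have s12 := D2_12 z.
  by hex_solve s1 s2 s12 s12 s12 s12.
have v23 H (z : hom H (D2 A)) :
    hex_valid t0 t0 (triple (dval (D2_1 z)) (dval (D2_1 z)) (dval (D2_2 z))).
  have s1 := dval_sq (D2_1 z); have s2 := dval_sq (D2_2 z); have s12 := D2_12 z.
  by hex_solve s1 s2 s12 s12 s12 s12.
have t12E H (r : hom H G) d :
    app (tadd t1 t2 ∘ r) d = hex r t0 t0 (triple (dval d) (dval d) 0).
  rewrite (taddE mX (l := fun H r z =>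
    hex r t0 t0 (triple (dval (D2_1 z)) (dval (D2_2 z)) 0))) ?D2_mkE //.
  - move=> ? ? ? ? ?; rewrite (hex_nat _ _ (v12 _ _)) !triple_comp !comp_0.
    by rewrite -!dval_comp -!D2_comp.
  - by move=> H0 r0 d0; rewrite !D2_mkE dval0 t1E.
  - by move=> H0 r0 d0; rewrite !D2_mkE dval0 t2E.
apply: exp_ext => H r d; rewrite tzeroE app_comp dzero_comp t1E dval0.
rewrite (taddE mX (l := fun H r z =>
  hex r t0 t0 (triple (dval (D2_1 z)) (dval (D2_1 z)) (dval (D2_2 z))))) ?D2_mkE.
- exact: hex_diagonal.
- move=> ? ? ? ? ?; rewrite (hex_nat _ _ (v23 _ _)) !triple_comp !comp_0.
  by rewrite -!dval_comp -!D2_comp.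
- by move=> H0 r0 d0; rewrite !D2_mkE dval0 t12E.
- by move=> H0 r0 d0; rewrite !D2_mkE dval0 t3E.
Qed.

End HexagonGlue.

(** * Convolutions of three distributions and the Jacobi identity before alternation *)

Section TripleConvolution.
Context {E : universe} (A : line E) (M : E).
Implicit Types G H : E.

Lemma part_r_comp G H p q (g : hom G (dist A M q)) (h : hom G (cube A M (p + q)))
    (r : hom H G) : part_r g h ∘ r = part_r (g ∘ r) (h ∘ r).
Proof. by apply: exp_ext => K s a; rewrite -compA !part_rE !compA. Qed.

Lemma part_l_comp G H p q (f : hom G (dist A M p)) (h : hom G (cube A M (p + q)))
    (r : hom H G) : part_l f h ∘ r = part_l (f ∘ r) (h ∘ r).
Proof. by apply: exp_ext => K s a; rewrite -compA !part_lE !compA. Qed.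

Definition push_comp := (@conv_comp E A M, @conv_tilde_comp E A M, part_r_comp,
  part_l_comp, @slice_l_comp E A M, @slice_r_comp E A M, @cube_re_comp E A M,
  @dist_re_comp E A M, @pcat_comp E A).

Lemma convE1 G p q (f : hom G (dist A M p)) (g : hom G (dist A M q)) h :
  app (conv f g) h = app f (part_r g h).
Proof. by have := convE f g idm h; rewrite !comp_idr. Qed.

Lemma conv_tildeE1 G p q (f : hom G (dist A M p)) (g : hom G (dist A M q)) h :
  app (conv_tilde f g) h = app g (part_l f h).
Proof. by have := conv_tildeE f g idm h; rewrite !comp_idr. Qed.

Lemma part_rE1 G p q (g : hom G (dist A M q)) (h : hom G (cube A M (p + q))) a :
  app (part_r g h) a = app g (slice_l h a).
Proof. by have := part_rE g h idm a; rewrite !comp_idr. Qed.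

Lemma part_lE1 G p q (f : hom G (dist A M p)) (h : hom G (cube A M (p + q))) b :
  app (part_l f h) b = app f (slice_r h b).
Proof. by have := part_lE f h idm b; rewrite !comp_idr. Qed.

Lemma slice_lE1 G p q (h : hom G (cube A M (p + q))) a b :
  app (slice_l h a) b = app h (pcat a b).
Proof. by have := slice_lE h a idm b; rewrite !comp_idr. Qed.

Lemma slice_rE1 G p q (h : hom G (cube A M (p + q))) a b :
  app (slice_r h b) a = app h (pcat a b).
Proof. by have := slice_rE h b idm a; rewrite !comp_idr. Qed.

Lemma cube_reE1 G n m (s : 'I_n -> 'I_m) (g : hom G (cube A M n)) d :
  app (cube_re s g) d = app g (tup (fun i => coord d (s i))).
Proof. by have := cube_reE s g idm d; rewrite !comp_idr. Qed.

Lemma dist_reE1 G n m (s : 'I_n -> 'I_m) (f : hom G (dist A M m)) g :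
  app (dist_re s f) g = app f (cube_re s g).
Proof. by have := dist_reE s f idm g; rewrite !comp_idr. Qed.

Definition app_distE := (convE1, conv_tildeE1, part_rE1, part_lE1, slice_lE1,
  slice_rE1, cube_reE1, dist_reE1).

Section Blocks.
Variables p q r : nat.

(* Blocks of lengths p, q, r in this order, looked up in the cyclic orders
   (p, q, r), (q, r, p) and (r, p, q). *)
Definition block_pqr (i : 'I_(p + q + r)) : 'I_(p + (q + r)) :=
  match split i with
  | inl j => match split j with
             | inl a => lshift (q + r) a
             | inr b => rshift p (lshift r b)
             end
  | inr c => rshift p (rshift q c)
  end.

Definition block_qrp (i : 'I_(p + q + r)) : 'I_(q + (r + p)) :=
  match split i with
  | inl j => match split j with
             | inl a => rshift q (rshift r a)
             | inr b => lshift (r + p) b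
             end
  | inr c => rshift q (lshift p c)
  end.

Definition block_rpq (i : 'I_(p + q + r)) : 'I_(r + (p + q)) :=
  match split i with inl j => rshift r j | inr c => lshift (p + q) c end.

Lemma coord_pcat_l H m n (a : hom H (pow (D A) m)) (b : hom H (pow (D A) n)) i :
  coord (pcat a b) (lshift n i) = coord a i.
Proof. by rewrite /pcat coord_tup -[lshift _ _]/(unsplit (inl i)) unsplitK. Qed.

Lemma coord_pcat_r H m n (a : hom H (pow (D A) m)) (b : hom H (pow (D A) n)) i :
  coord (pcat a b) (rshift m i) = coord b i.
Proof. by rewrite /pcat coord_tup -[rshift _ _]/(unsplit (inr i)) unsplitK. Qed.

Section Points.
Context {H : E} (a : hom H (pow (D A) p)) (b : hom H (pow (D A) q)).
Context (c : hom H (pow (D A) r)).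

Lemma pcat_pqr : tup (fun i => coord (pcat a (pcat b c)) (block_pqr i)) =
  pcat (pcat a b) c.
Proof.
apply: eq_tup => i; rewrite /block_pqr; case: (split i) => [j|j].
  by rewrite [RHS]coord_tup; case: (split j) => k; rewrite ?coord_pcat_r coord_pcat_l.
by rewrite !coord_pcat_r.
Qed.

Lemma pcat_qrp : tup (fun i => coord (pcat b (pcat c a)) (block_qrp i)) =
  pcat (pcat a b) c.
Proof.
apply: eq_tup => i; rewrite /block_qrp; case: (split i) => [j|j].
  by rewrite [RHS]coord_tup; case: (split j) => k; rewrite ?coord_pcat_r ?coord_pcat_l.
by rewrite coord_pcat_r coord_pcat_l.
Qed.

Lemma pcat_rpq : tup (fun i => coord (pcat c (pcat a b)) (block_rpq i)) =
  pcat (pcat a b) c.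
Proof.
apply: eq_tup => i; rewrite /block_rpq; case: (split i) => j.
  by rewrite coord_pcat_r.
by rewrite coord_pcat_l.
Qed.

End Points.

Context {G : E} (f1 : hom G (dist A M p)) (f2 : hom G (dist A M q)).
Context (f3 : hom G (dist A M r)).

(** One round of extensionality for the argument and one for each of the three nested blocks; what
    remains is a regrouping of coordinates. *)
Ltac conv_vertex :=
  apply: exp_ext => ? ? ?; rewrite !push_comp !app_distE; congr app;
  apply: exp_ext => ? ? ?; rewrite !push_comp !app_distE; congr app;
  apply: exp_ext => ? ? ?; rewrite !push_comp !app_distE; congr app;
  apply: exp_ext => ? ? ?; rewrite !push_comp !app_distE;
  by rewrite ?pcat_pqr ?pcat_qrp ?pcat_rpq.

Lemma conv_123 : dist_re block_pqr (conv f1 (conv f2 f3)) =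
  dist_re block_rpq (conv_tilde f3 (conv f1 f2)).
Proof. conv_vertex. Qed.

Lemma conv_132 : dist_re block_pqr (conv f1 (conv_tilde f2 f3)) =
  dist_re block_qrp (conv_tilde f2 (conv_tilde f3 f1)).
Proof. conv_vertex. Qed.

Lemma conv_231 : dist_re block_pqr (conv_tilde f1 (conv f2 f3)) =
  dist_re block_qrp (conv f2 (conv f3 f1)).
Proof. conv_vertex. Qed.

Lemma conv_321 : dist_re block_pqr (conv_tilde f1 (conv_tilde f2 f3)) =
  dist_re block_rpq (conv f3 (conv_tilde f1 f2)).
Proof. conv_vertex. Qed.

Lemma conv_213 : dist_re block_qrp (conv f2 (conv_tilde f3 f1)) =
  dist_re block_rpq (conv_tilde f3 (conv_tilde f1 f2)).
Proof. conv_vertex. Qed.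

Lemma conv_312 : dist_re block_qrp (conv_tilde f2 (conv f3 f1)) =
  dist_re block_rpq (conv f3 (conv f1 f2)).
Proof. conv_vertex. Qed.

End Blocks.

End TripleConvolution.

Section LieJacobi.
Context {E : universe} (A : line E) (M : E) (mM : microlinear A M) {G : E}.
Context {p q r : nat} (w1 : hom G (tfield A M p)) (w2 : hom G (tfield A M q)).
Context (w3 : hom G (tfield A M r)).
Hypotheses (b1 : app w1 dzero = dirac p G) (b2 : app w2 dzero = dirac q G).
Hypothesis b3 : app w3 dzero = dirac r G.

(** The three double brackets have their coordinates in different block orders; the reindexings
    bring those of [w1], [w2], [w3] into this order, and then no signs occur. *)
Lemma lie_jacobi :
  tadd (tadd (field_re (@block_pqr p q r) (lie w1 (lie w2 w3)))
             (field_re (@block_qrp p q r) (lie w2 (lie w3 w1))))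
       (field_re (@block_rpq p q r) (lie w3 (lie w1 w2))) =
  tzero (dirac (p + q + r) G).
Proof.
have [k23 [k23b k23g k23E]] := lie_kernel mM b2 b3.
have [k31 [k31b k31g k31E]] := lie_kernel mM b3 b1.
have [k12 [k12b k12g k12E]] := lie_kernel mM b1 b2.
have c23 := lie_based mM b2 b3; have c31 := lie_based mM b3 b1.
have c12 := lie_based mM b1 b2.
have [k1 [k1b k1g k1E]] := lie_kernel mM b1 c23.
have [k2 [k2b k2g k2E]] := lie_kernel mM b2 c31.
have [k3 [k3b k3g k3E]] := lie_kernel mM b3 c12.
pose re n (s : 'I_(p + q + r) -> 'I_n) (k : hom G (K A ⇒ dist A M n)) :
  hom G (K A ⇒ dist A M (p + q + r)) :=
  lamN (fun H (t : hom H G) z => dist_re s (app (k ∘ t) z)).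
have reE n s k H (t : hom H G) z : app (re n s k ∘ t) z = dist_re s (app (k ∘ t) z).
  by rewrite app_lamN // => H0 L t0 z0 s0; rewrite dist_re_comp app_comp compA.
have based : app (field_re (@block_pqr p q r) (lie w1 (lie w2 w3))) dzero =
    dirac (p + q + r) G.
  exact/field_re_based/lie_based.
rewrite -based.
(* An edge convolves one form with the map on [K] of the bracket of the other two: [conv] puts that
   form first in the order, [conv_tilde] last. *)
apply: (@hexagon_sum E A _ (microlinear_dist mM (p + q + r)%N) G
  (fun H t d z => dist_re (@block_pqr p q r) (conv (app (w1 ∘ t) d) (app (k23 ∘ t) z)))
  (fun H t d z => dist_re (@block_pqr p q r) (conv_tilde (app (w1 ∘ t) d) (app (k23 ∘ t) z)))
  (fun H t d z => dist_re (@block_qrp p q r) (conv (app (w2 ∘ t) d) (app (k31 ∘ t) z)))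
  (fun H t d z => dist_re (@block_qrp p q r) (conv_tilde (app (w2 ∘ t) d) (app (k31 ∘ t) z)))
  (fun H t d z => dist_re (@block_rpq p q r) (conv (app (w3 ∘ t) d) (app (k12 ∘ t) z)))
  (fun H t d z => dist_re (@block_rpq p q r) (conv_tilde (app (w3 ∘ t) d) (app (k12 ∘ t) z)))
  _ _ _ _ _ _ _ _ _ _ _ _
  (re _ (@block_pqr p q r) k1) (re _ (@block_qrp p q r) k2) (re _ (@block_rpq p q r) k3)).
1-6: by move=> H L t d z s; rewrite dist_re_comp ?conv_comp ?conv_tilde_comp !app_comp !compA.
- by move=> H t d1 d2 d3; rewrite k23b k12b conv_123.
- by move=> H t d1 d2 d3; rewrite k23g k31g conv_132.
- by move=> H t d1 d2 d3; rewrite k23b k31b conv_231.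
- by move=> H t d1 d2 d3; rewrite k23g k12g conv_321.
- by move=> H t d1 d2 d3; rewrite k31g k12g conv_213.
- by move=> H t d1 d2 d3; rewrite k31b k12b conv_312.
- by move=> H t d e; rewrite !reE k1b k1g k23E.
- by move=> H t d e; rewrite !reE k2b k2g k31E.
- by move=> H t d e; rewrite !reE k3b k3g k12E.
- by move=> H t d; rewrite field_reE reE k1E.
- by move=> H t d; rewrite field_reE reE k2E.
- by move=> H t d; rewrite field_reE reE k3E.
Qed.

End LieJacobi.

(** * Alternation *)

Lemma shift_map_inj p q (t : 'S_q) : injective (@shift_map p q q t).
Proof.
move=> i j; rewrite /shift_map => e; rewrite -(splitK i) -(splitK j).
have := congr1 (@split p q) e.
case: (split i) => [i'|i']; case: (split j) => [j'|j'];
  rewrite -?[lshift _ _]/(unsplit (inl _)) -?[rshift _ _]/(unsplit (inr _)) !unsplitK //.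
  by move=> [->].
by move=> [/perm_inj->].
Qed.

Definition shift_perm p q (t : 'S_q) : 'S_(p + q) := perm (@shift_map_inj p q t).

Lemma odd_shift_perm p q (t : 'S_q) : odd_perm (shift_perm p t) = odd_perm t.
Proof.
elim: p => [|p IH].
  congr odd_perm; apply/permP => i; rewrite permE /shift_map.
  case: splitP => [[]//|j ej]; apply: val_inj => /=; congr (val (t _)).
  by apply: val_inj; rewrite /= ej.
rewrite -IH.
(* One more fixed index in front is [lift_perm] at 0, which keeps the parity. *)
have -> : shift_perm p.+1 t = lift_perm ord0 ord0 (shift_perm p t).
  apply/permP => i; case: (unliftP ord0 i) => [j|] ->; last first.
    rewrite lift_perm_id permE /shift_map; case: splitP => [k ek|k] //.
    exact: val_inj.
  rewrite lift_perm_lift !permE /shift_map; apply: val_inj.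
  case: (splitP j) => k /= ek; case: splitP => l; rewrite /= /bump /= ek add1n => el.
  - by rewrite -el.
  - by have := ltn_ord k; rewrite -[(k < p)%N]ltnS el addSn ltnS ltnNge leq_addr.
  - by have := ltn_ord l; rewrite -el ltnS ltnNge leq_addr.
  - by have -> : l = k by apply: val_inj; move/eqP: el; rewrite addSn eqSS eqn_add2l => /eqP.
by rewrite odd_lift_perm.
Qed.

(** The rotation is the n-th power of the cycle through all m + n points, whose parity is that of m
    + n - 1; and n (m + n - 1) has the parity of m n because n (n - 1) is even. *)
Lemma rotation_perm N m n : N = (m + n)%N -> exists s : 'S_N,
  (forall i, s i = (if (i < m)%N then n + i else i - m)%N :> nat) /\
  odd_perm s = odd (m * n).
Proof.
case: N => [|N] e.
  exists 1%g; split=> [[]//|]; rewrite odd_perm1.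
  by move/esym/eqP: e; rewrite addn_eq0 => /andP[/eqP->].
pose step : 'S_N.+1 := lift_perm ord_max ord0 1.
have stepE i : step i = (if i == ord_max then 0 else i.+1)%N :> nat.
  case: (unliftP ord_max i) => [j|] ->; last by rewrite lift_perm_id eqxx.
  rewrite lift_perm_lift perm1 eq_sym (negPf (neq_lift _ _)) /= /bump leq0n add1n.
  by rewrite leqNgt ltn_ord.
have stepX k i : (step ^+ k)%g i = ((i + k) %% N.+1)%N :> nat.
  elim: k => [|k IH]; first by rewrite expg0 perm1 addn0 modn_small.
  rewrite expgSr permM stepE -(inj_eq val_inj) /= IH.
  rewrite addnS -[in RHS]addn1 -[in RHS]modnDml addn1.
  have := ltn_pmod (i + k) (ltn0Sn N); case: eqP => [/= ->|/= nk]; first by rewrite modnn.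
  rewrite ltnS leq_eqVlt; case: eqP => //= _ lt; by rewrite [in RHS]modn_small ?ltnS.
exists (step ^+ n)%g; split=> [i|].
  rewrite stepX; case: ltnP => leim.
    by rewrite modn_small addnC // [ltnRHS]e addnC ltn_add2r.
  have -> : (i + n = i - m + N.+1)%N.
    by rewrite (congr1 (addn (i - m)) e) addnA subnK.
  by rewrite modnDr modn_small // (leq_ltn_trans (leq_subr m i)).
have -> : odd_perm (step ^+ n)%g = odd n && odd N.
  elim: (n) => [|k IH]; first by rewrite expg0 odd_perm1.
  by rewrite expgSr odd_permM IH odd_lift_perm odd_perm1 /=; case: odd; case: odd.
have : odd N.+1 = odd (m + n) by rewrite e.
by rewrite oddD oddM /=; case: (odd N); case: (odd m); case: (odd n).
Qed.

Lemma val_block_pqr p q r (i : 'I_(p + q + r)) : block_pqr i = i :> nat.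
Proof.
rewrite /block_pqr; case: (splitP i) => [j ->|j -> /=]; last by rewrite addnA.
by case: (splitP j) => k ->.
Qed.

Lemma val_block_qrp p q r (i : 'I_(p + q + r)) :
  block_qrp i = (if (i < p)%N then q + r + i else i - p)%N :> nat.
Proof.
rewrite /block_qrp; case: (splitP i) => [j ->|j -> /=].
  by case: (splitP j) => k -> /=; rewrite ?addnA ?addKn.
by rewrite -addnA ltnNge leq_addr addKn.
Qed.

Lemma val_block_rpq p q r (i : 'I_(p + q + r)) :
  block_rpq i = (if (i < p + q)%N then r + i else i - (p + q))%N :> nat.
Proof.
rewrite /block_rpq; by case: (splitP i) => j -> //=; rewrite addKn.
Qed.

Section Alternation.
Context {E : universe} {A : line E} {M : E} (mM : microlinear A M) {G : E}.

Definition dtan n := tangent (microlinear_dist mM n) (dirac n G).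

Definition tan_re n m (s : 'I_n -> 'I_m) (t : dtan m) : dtan n :=
  Tangent _ (field_re_based s (tvecP t)).

Lemma tan_re_linear n m (s : 'I_n -> 'I_m) : linear (tan_re s).
Proof.
move=> a t t'; apply: tvec_inj; rewrite /= field_re_add ?field_re_scale //.
by rewrite !tvecP (tscale_based _ (tvecP t)).
Qed.

HB.instance Definition _ n m (s : 'I_n -> 'I_m) :=
  GRing.isLinear.Build (hom G A) (dtan m) (dtan n) *:%R (tan_re s) (tan_re_linear s).

Lemma tan_re_re n m l (s : 'I_n -> 'I_m) (u : 'I_m -> 'I_l) (t : dtan l) :
  tan_re s (tan_re u t) = tan_re (u \o s) t.
Proof. by apply: tvec_inj; rewrite /= field_re_re. Qed.

Lemma eq_tan_re n m (s s' : 'I_n -> 'I_m) (t : dtan m) :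
  s =1 s' -> tan_re s t = tan_re s' t.
Proof. by move=> /funext->. Qed.

Definition tan_lie p q (t : dtan p) (t' : dtan q) : dtan (p + q) :=
  Tangent _ (lie_based mM (tvecP t) (tvecP t')).

Lemma tan_lie_linear p q (t : dtan p) : linear (@tan_lie p q t).
Proof.
move=> a u v; apply: tvec_inj.
rewrite /= (lie_add mM) ?(lie_scale mM) ?tvecP //.
exact: tscale_based (tvecP u).
Qed.

HB.instance Definition _ p q (t : dtan p) :=
  GRing.isLinear.Build (hom G A) (dtan q) (dtan (p + q)) *:%R (tan_lie t)
    (tan_lie_linear t).

Lemma tan_lie_re p q q' (s : 'I_q' -> 'I_q) (t : dtan p) (u : dtan q) :
  tan_lie t (tan_re s u) = tan_re (shift_map s) (tan_lie t u).
Proof. by apply: tvec_inj; rewrite /= (lie_re mM) ?tvecP. Qed.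

Definition tan_alt n (t : dtan n) : dtan n :=
  \sum_(s : 'S_n) ((-1) ^+ s : hom G A) *: tan_re s t.

Lemma tan_alt_linear n : linear (@tan_alt n).
Proof.
move=> a t u; rewrite /tan_alt scaler_sumr -big_split; apply: eq_bigr => s _.
by rewrite linearP scalerDr !scalerA mulrC.
Qed.

HB.instance Definition _ n :=
  GRing.isLinear.Build (hom G A) (dtan n) (dtan n) *:%R (@tan_alt n) (@tan_alt_linear n).

Lemma tan_alt_perm n (s : 'S_n) (t : dtan n) :
  tan_alt (tan_re s t) = ((-1) ^+ s : hom G A) *: tan_alt t.
Proof.
rewrite /tan_alt scaler_sumr (reindex_inj (mulIg s^-1)%g) /=.
apply: eq_bigr => u _; rewrite tan_re_re scalerA odd_permM odd_permV signr_addb mulrC.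
by congr (_ *: _); apply: eq_tan_re => i /=; rewrite permM permKV.
Qed.

Lemma tan_alt_cast m n (e : m = n) (t : dtan m) :
  tan_re (cast_ord (esym e)) (tan_alt t) = tan_alt (tan_re (cast_ord (esym e)) t).
Proof.
case: n / e; have re1 (u : dtan m) : tan_re (cast_ord (esym erefl)) u = u.
  by apply: tvec_inj; apply: (esym (field_castE erefl (tvec u))).
by rewrite !re1.
Qed.

(** Each [s] of the inner alternation acts on the bracket as [shift_perm p s]; the outer alternation
    turns it into the sign of [s], which cancels the sign already there. So all q! terms are
    equal. *)
Lemma tan_alt_lie_alt p q (t : dtan p) (u : dtan q) :
  tan_alt (tan_lie t (tan_alt u)) = (q`!%:R : hom G A) *: tan_alt (tan_lie t u).
Proof.
rewrite {2}/tan_alt linear_sum linear_sum.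
transitivity (\sum_(s : 'S_q) tan_alt (tan_lie t u)); last first.
  by rewrite sumr_const card_Sn scaler_nat.
apply: eq_bigr => s _; rewrite linearZ linearZ /= tan_lie_re.
have -> : tan_re (shift_map s) (tan_lie t u) = tan_re (shift_perm p s) (tan_lie t u).
  by apply: eq_tan_re => i; rewrite permE.
by rewrite tan_alt_perm scalerA odd_shift_perm -signr_addb addbb scale1r.
Qed.

Definition inv_nat n : hom G A := invn A n ∘ bang.

Lemma inv_natP n : (0 < n)%N -> n%:R * inv_nat n = 1.
Proof. by move=> n0; rewrite -(comp_nat n bang) -comp_M invnP // comp_1. Qed.

Lemma altE p q (t : dtan (p + q)) :
  alt (tvec t) = tvec (inv_nat (p`! * q`!)%N *: tan_alt t).
Proof.
by rewrite /= /alt tvec_sum; congr tscale; apply: eq_bigr => s _; rewrite /= field_permE.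
Qed.

Definition tan_fn p q (t : dtan p) (u : dtan q) : dtan (p + q) :=
  inv_nat (p`! * q`!)%N *: tan_alt (tan_lie t u).

Lemma fn_bracketE p q (t : dtan p) (u : dtan q) :
  fn_bracket (tvec t) (tvec u) = tvec (tan_fn t u).
Proof. by rewrite -altE. Qed.

(** The factor (q + r)! from absorbing the inner alternation cancels against the normalization of
    the outer bracket, leaving 1/(p! q! r!) for all three double brackets. [c] is given by its
    equation because these have the factorials in different orders. *)
Lemma tan_fn_fn p q r (t : dtan p) (u : dtan q) (v : dtan r) (c : hom G A) :
  (p`! * q`! * r`!)%N%:R * c = 1 ->
  tan_fn t (tan_fn u v) = c *: tan_alt (tan_lie t (tan_lie u v)).
Proof.
move=> cP; rewrite /tan_fn linearZ linearZ /= tan_alt_lie_alt !scalerA.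
congr (_ *: _).
have fg n : (0 < n`!)%N := fact_gt0 n.
have a : (p`! * (q + r)`!)%N%:R * inv_nat (p`! * (q + r)`!)%N = 1.
  by apply: inv_natP; rewrite muln_gt0 !fg.
have b : (q`! * r`!)%N%:R * inv_nat (q`! * r`!)%N = 1.
  by apply: inv_natP; rewrite muln_gt0 !fg.
move: (inv_nat _) (inv_nat _) a b cP => y x; rewrite !natrM => a b cP.
rewrite -[LHS]mulr1 -[X in _ * X = _]cP.
transitivity ((p`!%:R * (q + r)`!%:R * x) * (q`!%:R * r`!%:R * y) * c); first by ring.
by rewrite a b !mul1r.
Qed.

(** The cast keeps positions while [b] moves blocks of lengths m and n past each other; alternation
    turns the rotation between them into its signature. *)
Lemma tan_alt_rotation N m n (e : (m + n)%N = N) l (f : l = N)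
    (b : 'I_N -> 'I_l) (t : dtan l) :
  (forall i : 'I_N, b i = (if (i < m)%N then n + i else i - m)%N :> nat) ->
  ((-1) ^+ (m * n) : hom G A) *: tan_alt (tan_re (cast_ord (esym f)) t) =
  tan_alt (tan_re b t).
Proof.
move=> bP; have [s [sP s_odd]] := rotation_perm (esym e).
rewrite -signr_odd -s_odd -tan_alt_perm tan_re_re; congr tan_alt.
by apply: eq_tan_re => i; apply: val_inj; rewrite /= sP bP.
Qed.

End Alternation.

(** * The graded Jacobi identity *)

Theorem theorem20 (E : universe) (A : line E) (M : space E)
    (hM : microlinear A M) (p q r : nat) (G : space E)
    (w1 : hom G (tfield A M p)) (w2 : hom G (tfield A M q))
    (w3 : hom G (tfield A M r))
    (h1 : form w1) (h2 : form w2) (h3 : form w3) :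
  tadd
    (tadd
      (field_cast (addnA p q r) (fn_bracket w1 (fn_bracket w2 w3)))
      (tscale ((-1) ^+ (p * (q + r)))%R
        (field_cast (addn_cycle1 p q r) (fn_bracket w2 (fn_bracket w3 w1)))))
    (tscale ((-1) ^+ (r * (p + q)))%R
      (field_cast (addn_cycle2 p q r) (fn_bracket w3 (fn_bracket w1 w2))))
  = tzero (dirac (p + q + r) G).
Proof.
have [[b1 _] _] := h1; have [[b2 _] _] := h2; have [[b3 _] _] := h3.
pose t1 : dtan hM p := Tangent _ b1; pose t2 : dtan hM q := Tangent _ b2.
pose t3 : dtan hM r := Tangent _ b3.
rewrite -[w1]/(tvec t1) -[w2]/(tvec t2) -[w3]/(tvec t3) !fn_bracketE !field_castE.
pose c : hom G A := inv_nat (p`! * q`! * r`!)%N.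
have cP : (p`! * q`! * r`!)%N%:R * c = 1.
  by apply: inv_natP; rewrite !muln_gt0 !fact_gt0.
have cP2 : (q`! * r`! * p`!)%N%:R * c = 1 by rewrite mulnC mulnA.
have cP3 : (r`! * p`! * q`!)%N%:R * c = 1 by rewrite -mulnA mulnC.
rewrite (tan_fn_fn _ _ _ cP) (tan_fn_fn _ _ _ cP2) (tan_fn_fn _ _ _ cP3).
pose L1 := tan_lie t1 (tan_lie t2 t3); pose L2 := tan_lie t2 (tan_lie t3 t1).
pose L3 := tan_lie t3 (tan_lie t1 t2).
rewrite -/L1 -/L2 -/L3.
pose cast m (e : m = (p + q + r)%N) (t : @dtan E A M hM G m) :=
  tan_re (cast_ord (esym e)) t.
(* The identity now lives in the module of tangent vectors at the Dirac distribution, where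
   linearity can be used. *)
transitivity (tvec (cast _ (addnA p q r) (c *: tan_alt L1) +
  ((-1) ^+ (p * (q + r)) : hom G A) *: cast _ (addn_cycle1 p q r) (c *: tan_alt L2) +
  ((-1) ^+ (r * (p + q)) : hom G A) *: cast _ (addn_cycle2 p q r) (c *: tan_alt L3))) => //.
rewrite -[RHS]/(tvec (0 : @dtan E A M hM G (p + q + r))); congr tvec.
rewrite /cast !linearZ /= !tan_alt_cast -!scalerDr.
(* The casts keep positions, whereas [lie_jacobi] needs the blocks in the order of the three forms.
   The rotations between them exchange p with q + r and p + q with r; their signatures are the signs
   of the identity. *)
rewrite (tan_alt_rotation (addnA p q r) _ _ (@val_block_qrp p q r)).
rewrite [(r * _)%N]mulnC (tan_alt_rotation erefl _ _ (@val_block_rpq p q r)).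
have -> : tan_re (cast_ord (esym (addnA p q r))) L1 = tan_re (@block_pqr p q r) L1.
  by apply: eq_tan_re => i; apply: val_inj; rewrite /= val_block_pqr.
rewrite -!linearD /=.
have -> : tan_re (@block_pqr p q r) L1 + tan_re (@block_qrp p q r) L2 +
    tan_re (@block_rpq p q r) L3 = 0.
  by apply: tvec_inj; apply: lie_jacobi.
by rewrite linear0 scaler0.
Qed.
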